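(* Let $v:[0,T]\times\mathcal{P}_c(\mathbb{R}^d)\times\mathbb{R}^d\to\mathbb{R}^d$ satisfy hypotheses (CE) of the context and let $K:=B(0,r)$ with $r>0$. Let $\mathcal{T}:=\mathcal{T}^*\cap\mathcal{T}_m\subset(0,T)$, where $\mathcal{T}^*$ is the full-measure set of uniform Lebesgue points of $v$ described in the context and $\mathcal{T}_m$ is the set of Lebesgue points of $m(\cdot)\in L^1([0,T],\mathbb{R}_+)$. Then for every $\tau\in\mathcal{T}$ and $\mu\in\mathcal{P}(K)$, the map $s\in\mathcal{T}\mapsto\Phi_{(s,\cdot)}[\mu](\cdot)\in C^0([0,T]\times K,\mathbb{R}^d)$ is differentiable at $\tau$. Moreover, given $h\in\mathbb{R}$ such that $\tau+h\in[0,T]$, the Taylor expansion $$\Phi_{(\tau+h,t)}[\mu](\cdot)=\Phi_{(\tau,t)}[\mu](\cdot)+h\Psi_\tau(t,\cdot)+o_{\tau,t,K}(h)$$ holds in $C^0(K,\mathbb{R}^d)$ for all times $t\in[0,T]$, with $\sup_{t\in[0,T]}\|o_{\tau,t,K}(h)\|_{C^0(K,\mathbb{R}^d)}=o_{\tau,K}(h)$. Here, for any $x\in K$, the map $t\in[0,T]\mapsto\Psi_\tau(t,x)\in\mathbb{R}^d$ is the unique solution of the linearised Cauchy problem $$\begin{cases}\partial_t\Psi_\tau(t,x)=D_xv\big(t,\mu(t),\Phi_{(\tau,t)}[\mu](x)\big)\Psi_\tau(t,x)+\displaystyle\int_{\mathbb{R}^d}D_\mu v\big(t,\mu(t),\Phi_{(\tau,t)}[\mu](x)\big)\big(\Phi_{(\tau,t)}[\mu](y)\big)\Psi_\tau(t,y)\,d\mu(y),\\\Psi_\tau(\tau,x)=-v(\tau,\mu,x),\end{cases}$$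 where $\mu(t):=\Phi_{(\tau,t)}[\mu](\cdot)_\#\mu$ for all times $t\in[0,T]$.
   Context: Notation. $T>0$, $d\ge1$. $B(0,R)$ is the closed ball. $\mathcal{P}_c(\mathbb{R}^d)$: compactly supported Borel probability measures; $\mathcal{P}(K)$: those supported in $K$; $\mathcal{P}_1(K)$: $\mathcal{P}(K)$ with the $W_1$-metric (also used on $\mathcal{P}(K)$ in $C^0(\mathcal{P}(K)\times K,\cdot)$); $\mathcal{M}_1(\mu)=\int|x|d\mu$. $\Gamma_o(\mu,\nu)$: 2-optimal transport plans. $o(h)$ denotes a quantity with $o(h)/|h|\to0$ as $h\to0$, with a rate depending on the parameters in the subscript and the fixed data. Local differentiability. Let $B_R(\mu)=\bigcup_{x\in\mathrm{supp}(\mu)}B(x,R)$ and $\mathrm{Tan}_\mu$ be the closure of $\{\nabla\xi:\xi\in C_c^\infty(\mathbb{R}^d,\mathbb{R})\}$ in $L^2(\mathbb{R}^d,\mathbb{R}^d;\mu)$. For $\phi:\mathcal{P}_c(\mathbb{R}^d)\to\mathbb{R}$, $\xi\in L^2(\mathbb{R}^d,\mathbb{R}^d;\mu)$ belongs to $\partial^-\phi(\mu)$ if for every $R>0$ and $\nu\in\mathcal{P}(B_R(\mu))$, $\phi(\nu)-\phi(\mu)\ge\inf_{\gamma\in\Gamma_o(\mu,\nu)}\int\langle\xi(x),y-x\rangle d\gamma(x,y)+o_R(W_2(\mu,\nu))$; $\xi\in\partial^+\phi(\mu)$ if $-\xi\in\partial^-(-\phi)(\mu)$. $\phi$ is locally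 differentiable at $\mu$ if there is $\nabla\phi(\mu)\in\mathrm{Tan}_\mu$ with $\partial^-\phi(\mu)\cap\partial^+\phi(\mu)=\{\nabla\phi(\mu)\}$. For vector-valued maps this is required componentwise and $D_\mu\phi(\mu)(x)$ is the matrix whose rows are the gradients of the components at $x$. Hypotheses (CE). For any $R>0$, with $K=B(0,R)$: (i) $t\mapsto v(t,\mu,x)$ is $\mathcal{L}^1$-measurable for any $(\mu,x)$ and there is $m\in L^1([0,T],\mathbb{R}_+)$ with $|v(t,\mu,x)|\le m(t)(1+|x|+\mathcal{M}_1(\mu))$ for a.e. $t$ and any $(\mu,x)\in\mathcal{P}_c(\mathbb{R}^d)\times\mathbb{R}^d$; (ii) there are $l_K,L_K\in L^1([0,T],\mathbb{R}_+)$ with $|v(t,\mu,x)-v(t,\mu,y)|\le l_K(t)|x-y|$ and $|v(t,\mu,x)-v(t,\nu,x)|\le L_K(t)W_1(\mu,\nu)$ for a.e. $t$, all $\mu,\nu\in\mathcal{P}(K)$, $x,y\in K$; (iii) $x\mapsto v(t,\mu,x)$ is Fréchet-differentiable for a.e. $t$ and any $\mu$, and $(\mu,x)\in\mathcal{P}_1(K)\times K\mapsto D_xv(t,\mu,x)$ is continuous; (iv) $\mu\mapsto v(t,\mu,x)$ is locally differentiable for a.e. $t$ and any $x$, and $(\mu,x,y)\in\mathcal{P}_1(K)\times K\times K\mapsto D_\mu v(t,\mu,x)(y)$ is continuous. Lebesgue points. For a Banach space $X$ and Bochner-integrable $f:[0,T]\to X$, $\tau\in(0,T)$ is a Lebesgue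 point if $\frac1h\int_\tau^{\tau+h}\|f(t)-f(\tau)\|_Xdt\to0$ as $h\to0$. $\mathcal{T}^*\subset(0,T)$ is a subset of full $\mathcal{L}^1$-measure such that for every compact $K\subset\mathbb{R}^d$, its elements are Lebesgue points of the restricted maps $t\mapsto v(t,\cdot,\cdot)\in C^0(\mathcal{P}(K)\times K,\mathbb{R}^d)$, $t\mapsto D_xv(t,\cdot,\cdot)\in C^0(\mathcal{P}(K)\times K,\mathbb{R}^{d\times d})$ and $t\mapsto D_\mu v(t,\cdot,\cdot)(\cdot)\in C^0(\mathcal{P}(K)\times K\times K,\mathbb{R}^{d\times d})$ (such a set exists). Non-local flow. For $\mu\in\mathcal{P}(K)$ and $\tau\in[0,T]$, $\Phi_{(\tau,\cdot)}[\mu](\cdot)\in C^0([0,T]\times K,\mathbb{R}^d)$ is the unique solution of $\Phi_{(\tau,t)}[\mu](x)=x+\int_\tau^tv\big(s,\Phi_{(\tau,s)}[\mu](\cdot)_\#\mu,\Phi_{(\tau,s)}[\mu](x)\big)ds$ for $(t,x)\in[0,T]\times K$. *)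

(* Defs.v *)
From HB Require Import structures.
From mathcomp Require Import all_boot all_order all_algebra.
From mathcomp Require Import all_classical all_reals all_analysis.

Set Implicit Arguments.
Unset Strict Implicit.
Unset Printing Implicit Defensive.
Import Order.TTheory GRing.Theory Num.Theory.
Import numFieldNormedType.Exports.
Local Open Scope classical_set_scope.
Local Open Scope ring_scope.

(* The library norm of a matrix is the maximum of its entries; [enorm] is the
   Euclidean norm of a vector of R^d (a row vector) and the Frobenius norm of
   a matrix. *)
Definition enorm {R : realType} {m n : nat} (A : 'M[R]_(m, n)) : R :=
  Num.sqrt (\sum_i \sum_j A i j ^+ 2).

Definition dotp {R : realType} {d : nat} (x y : 'rV[R]_d) : R :=
  \sum_i x 0 i * y 0 i.

Definition cball {R : realType} {d : nat} (r : R) : set 'rV[R]_d :=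
  [set x | enorm x <= r].

Notation leb := (@lebesgue_measure _).

(* The sigma-algebra underlying [lebesgue_measure] is the Borel one: a function
   of time is Lebesgue measurable iff it has a Borel representative. *)

Definition Lmeasurable {R : realType} (T : R) (f : R -> R) : Prop :=
  exists2 g : R -> R, measurable_fun `[0, T] g &
    {ae leb, forall t, t \in `[0, T] -> f t = g t}.

Definition L1_nonneg {R : realType} (T : R) (f : R -> R) : Prop :=
  (forall t, t \in `[0, T] -> 0 <= f t) /\
  exists2 g : R -> R, leb.-integrable `[0, T] (EFin \o g) &
    {ae leb, forall t, t \in `[0, T] -> f t = g t}.

Definition oriented_int {R : realType} (a b : R) (f : R -> R) : R :=
  if a <= b then \int[leb]_(s in `[a, b]) f s
  else - \int[leb]_(s in `[b, a]) f s.

Definition abs_continuous {R : realType} {d : nat} (T : R)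
    (f : R -> 'rV[R]_d) : Prop :=
  forall e : R, 0 < e -> exists2 delta : R, 0 < delta &
    forall (n : nat) (a b : 'I_n -> R),
      (forall k, 0 <= a k /\ a k <= b k /\ b k <= T) ->
      trivIset setT (fun k : 'I_n => [set` `]a k, b k[]) ->
      \sum_k (b k - a k) < delta -> \sum_k enorm (f (b k) - f (a k)) < e.

Definition Borel (R : realType) (d : nat) :=
  g_sigma_algebraType (@open 'rV[R]_d).

Definition supp {R : realType} {d : nat} (mu : probability (Borel R d) R) :
    set 'rV[R]_d :=
  [set x | forall U : set 'rV[R]_d, open U -> U x -> (0 < mu U)%E].

Record Pc (R : realType) (d : nat) := MkPc {
  Pc_measure :> probability (Borel R d) R ;
  Pc_compact : compact (supp Pc_measure) }.

HB.instance Definition _ (R : realType) (d : nat) := gen_eqMixin (Pc R d).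
HB.instance Definition _ (R : realType) (d : nat) := gen_choiceMixin (Pc R d).

Definition PP {R : realType} {d : nat} (A : set 'rV[R]_d) : set (Pc R d) :=
  [set mu | supp mu `<=` A].

Definition M1 {R : realType} {d : nat} (mu : Pc R d) : R :=
  \int[mu]_x enorm (x : 'rV[R]_d).

(* The image of [mu] (supported in [K]) under a map [f] which only matters on
   [K]. For [f] continuous on a compact [K] such a [nu] exists and is unique;
   [mu] is a dummy value otherwise. *)
Definition push {R : realType} {d : nat} (K : set 'rV[R]_d)
    (f : 'rV[R]_d -> 'rV[R]_d) (mu : Pc R d) : Pc R d :=
  xget mu [set nu : Pc R d | forall A : set (Borel R d), measurable A ->
    nu A = mu (K `&` f @^-1` A)].

Definition coupling {R : realType} {d : nat} (mu nu : Pc R d) :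
    set (probability (Borel R d * Borel R d)%type R) :=
  [set gamma | forall A : set (Borel R d), measurable A ->
    gamma (A `*` setT) = mu A /\ gamma (setT `*` A) = nu A].

Definition cost {R : realType} {d : nat} (p : nat)
    (gamma : probability (Borel R d * Borel R d)%type R) : \bar R :=
  (\int[gamma]_z (enorm ((z.2 : 'rV[R]_d) - z.1) ^+ p)%:E)%E.

Definition W {R : realType} {d : nat} (p : nat) (mu nu : Pc R d) : R :=
  fine (ereal_inf [set cost p gamma | gamma in coupling mu nu]) `^ (p%:R^-1).

Definition Gamma_o {R : realType} {d : nat} (mu nu : Pc R d) :
    set (probability (Borel R d * Borel R d)%type R) :=
  [set gamma | coupling mu nu gamma /\
    forall gamma', coupling mu nu gamma' -> (cost 2 gamma <= cost 2 gamma')%E].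

Definition L2 {R : realType} {d : nat} (mu : Pc R d)
    (xi : 'rV[R]_d -> 'rV[R]_d) : Prop :=
  measurable_fun setT (xi : Borel R d -> Borel R d) /\
  (\int[mu]_x (enorm (xi x) ^+ 2)%:E < +oo)%E.

Definition partial {R : realType} {d : nat} (i : 'I_d) (f : 'rV[R]_d -> R) :
    'rV[R]_d -> R :=
  fun x => 'D_(delta_mx 0 i) f x.

Definition grad {R : realType} {d : nat} (f : 'rV[R]_d -> R) (x : 'rV[R]_d) :
    'rV[R]_d :=
  \row_i partial i f x.

Definition test_function {R : realType} {d : nat} (f : 'rV[R]_d -> R) : Prop :=
  (forall (s : seq 'I_d) (x : 'rV[R]_d), differentiable (foldr partial f s) x)
  /\ compact (closure [set x | f x != 0]).

Definition Tan {R : realType} {d : nat} (mu : Pc R d)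
    (xi : 'rV[R]_d -> 'rV[R]_d) : Prop :=
  L2 mu xi /\
  forall e : R, 0 < e -> exists2 f, test_function f &
    (\int[mu]_x (enorm (xi x - grad f x) ^+ 2)%:E < e%:E)%E.

Definition fattening {R : realType} {d : nat} (r : R) (mu : Pc R d) :
    set 'rV[R]_d :=
  [set y | exists2 x, supp mu x & enorm (y - x) <= r].

Definition subdiff {R : realType} {d : nat} (phi : Pc R d -> R) (mu : Pc R d)
    (xi : 'rV[R]_d -> 'rV[R]_d) : Prop :=
  L2 mu xi /\
  forall r : R, 0 < r -> forall e : R, 0 < e -> exists2 delta : R, 0 < delta &
    forall nu : Pc R d, PP (fattening r mu) nu -> W 2 mu nu < delta ->
      (ereal_inf [set \int[gamma]_z (dotp (xi z.1) ((z.2 : 'rV[R]_d) - z.1))%:E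
                 | gamma in Gamma_o mu nu]
       - (e * W 2 mu nu)%:E <= (phi nu - phi mu)%:E)%E.

Definition superdiff {R : realType} {d : nat} (phi : Pc R d -> R) (mu : Pc R d)
    (xi : 'rV[R]_d -> 'rV[R]_d) : Prop :=
  subdiff (fun nu => - phi nu) mu (fun x => - xi x).

(* [xi] represents the gradient of [phi] at [mu]. Elements of L^2(mu) are
   equal up to mu-null sets, and the singleton condition is imposed among the
   elements of [Tan mu]: the barycentric displacement of an optimal plan lies
   in [Tan mu], so adding to an element of the sub- (or super-)differential a
   field orthogonal to [Tan mu] does not leave it, and without this convention
   not even a constant [phi] would be differentiable at a measure with
   [Tan mu] <> L^2(mu). A [phi] for which the whole intersection in L^2(mu)
   is the singleton {xi}, with [xi] in [Tan mu], satisfies this. *)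
Definition is_gradient {R : realType} {d : nat} (phi : Pc R d -> R)
    (mu : Pc R d) (xi : 'rV[R]_d -> 'rV[R]_d) : Prop :=
  Tan mu xi /\
  forall eta, Tan mu eta ->
    (subdiff phi mu eta /\ superdiff phi mu eta <->
     {ae (Pc_measure mu), forall x, eta x = xi x}).

(* [Pc] carries no topology of its own: continuity on P_1(K) * K and on
   P_1(K) * K * K refers to these distances. *)

Definition dist2 {R : realType} {d : nat} (z z' : Pc R d * 'rV[R]_d) : R :=
  W 1 z.1 z'.1 + enorm (z.2 - z'.2).

Definition dist3 {R : realType} {d : nat}
    (z z' : Pc R d * 'rV[R]_d * 'rV[R]_d) : R :=
  dist2 z.1 z'.1 + enorm (z.2 - z'.2).

Definition C0 {R : realType} {Z : Type} {m n : nat} (dist : Z -> Z -> R)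
    (A : set Z) (F : Z -> 'M[R]_(m, n)) : Prop :=
  forall z0, A z0 -> forall e : R, 0 < e -> exists2 delta : R, 0 < delta &
    forall z, A z -> dist z0 z < delta -> enorm (F z - F z0) < e.

Definition supnorm {R : realType} {Z : Type} {m n : nat} (A : set Z)
    (F : Z -> 'M[R]_(m, n)) : \bar R :=
  ereal_sup [set (enorm (F z))%:E | z in A].

(* [g t] is meant to be the norm of [f t - f tau]. *)
Definition lebesgue_limit {R : realType} (tau : R) (g : R -> \bar R) : Prop :=
  ((`|h|^-1)%:E *
    \int[leb]_(t in `[(Num.min tau (tau + h))%R, (Num.max tau (tau + h))%R]) g t)%E
  @[h --> (0 : R)^'] --> (0 : \bar R).

Definition C0_lebesgue_point {R : realType} {Z : Type} {m n : nat}
    (dist : Z -> Z -> R) (A : set Z) (f : R -> Z -> 'M[R]_(m, n)) (tau : R) :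
    Prop :=
  C0 dist A (f tau) /\
  lebesgue_limit tau (fun t => supnorm A (fun z => f t z - f tau z)).

Definition lebesgue_points {R : realType} (T : R) (m : R -> R) : set R :=
  [set tau : R | (tau \in `]0, T[) /\
    lebesgue_limit tau (fun t => (`|m t - m tau|)%:E)].

(* The library's Jacobian acts on row vectors from the right. *)
Definition Dx {R : realType} {d : nat}
    (v : R -> Pc R d -> 'rV[R]_d -> 'rV[R]_d) (t : R) (mu : Pc R d)
    (x : 'rV[R]_d) : 'M[R]_d :=
  (jacobian (v t mu) x)^T.

Definition mxact {R : realType} {d : nat} (A : 'M[R]_d) (x : 'rV[R]_d) :
    'rV[R]_d :=
  (A *m x^T)^T.

(* [Dmuv t mu x y] is the value at [y] of the representative of D_mu v(t,mu,x)
   which is continuous in (mu, x, y). *)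
Record CE {R : realType} {d : nat} (T : R)
    (v : R -> Pc R d -> 'rV[R]_d -> 'rV[R]_d)
    (Dmuv : R -> Pc R d -> 'rV[R]_d -> 'rV[R]_d -> 'M[R]_d) (m : R -> R) :
    Prop := {
  CE_measurable : forall mu x i, Lmeasurable T (fun t => v t mu x 0 i) ;
  CE_m : L1_nonneg T m ;
  CE_growth : {ae leb, forall t, t \in `[0, T] -> forall mu x,
    enorm (v t mu x) <= m t * (1 + enorm x + M1 mu)} ;
  CE_lipschitz : forall r : R, 0 < r -> exists l L : R -> R,
    [/\ L1_nonneg T l, L1_nonneg T L &
      {ae leb, forall t, t \in `[0, T] -> forall mu nu x y,
        PP (cball r) mu -> PP (cball r) nu -> cball r x -> cball r y ->
        enorm (v t mu x - v t mu y) <= l t * enorm (x - y) /\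
        enorm (v t mu x - v t nu x) <= L t * W 1 mu nu}] ;
  CE_diff_x : {ae leb, forall t, t \in `[0, T] -> forall mu x,
    differentiable (v t mu) x} ;
  CE_Dx_continuous : forall r : R, 0 < r ->
    {ae leb, forall t, t \in `[0, T] ->
      C0 dist2 (PP (cball r) `*` cball r) (fun z => Dx v t z.1 z.2)} ;
  CE_diff_mu : {ae leb, forall t, t \in `[0, T] -> forall mu x (i : 'I_d),
    is_gradient (fun nu => v t nu x 0 i) mu (fun y => row i (Dmuv t mu x y))} ;
  CE_Dmu_continuous : forall r : R, 0 < r ->
    {ae leb, forall t, t \in `[0, T] ->
      C0 dist3 (PP (cball r) `*` cball r `*` cball r)
        (fun z => Dmuv t z.1.1 z.1.2 z.2)} }.

(* The condition [K !=set0] only discards the supremum over the empty set. *)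
Definition uniform_lebesgue_set {R : realType} {d : nat} (T : R)
    (v : R -> Pc R d -> 'rV[R]_d -> 'rV[R]_d)
    (Dmuv : R -> Pc R d -> 'rV[R]_d -> 'rV[R]_d -> 'M[R]_d) (S : set R) :
    Prop :=
  [/\ S `<=` [set` `]0, T[], leb.-negligible ([set` `]0, T[] `\` S) &
    forall (K : set 'rV[R]_d) (tau : R), compact K -> K !=set0 -> S tau ->
    [/\ C0_lebesgue_point dist2 (PP K `*` K) (fun t z => v t z.1 z.2) tau,
        C0_lebesgue_point dist2 (PP K `*` K) (fun t z => Dx v t z.1 z.2) tau &
        C0_lebesgue_point dist3 (PP K `*` K `*` K)
          (fun t z => Dmuv t z.1.1 z.1.2 z.2) tau]].

(* [Phi tau t mu x] is Phi_(tau,t)[mu](x); only its values for [tau], [t] in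
   [0, T], [mu] in P(K) and [x] in [K] matter. *)
Definition nonlocal_flow {R : realType} {d : nat} (T : R)
    (v : R -> Pc R d -> 'rV[R]_d -> 'rV[R]_d) (K : set 'rV[R]_d)
    (Phi : R -> R -> Pc R d -> 'rV[R]_d -> 'rV[R]_d) : Prop :=
  forall tau mu, tau \in `[0, T] -> PP K mu ->
    {within [set` `[0, T]] `*` K,
      continuous (fun z : R * 'rV[R]_d => Phi tau z.1 mu z.2)} /\
    forall t x, t \in `[0, T] -> K x ->
      Phi tau t mu x = x + \row_i oriented_int tau t
        (fun s => v s (push K (Phi tau s mu) mu) (Phi tau s mu x) 0 i).

Definition linearised_rhs {R : realType} {d : nat}
    (v : R -> Pc R d -> 'rV[R]_d -> 'rV[R]_d)
    (Dmuv : R -> Pc R d -> 'rV[R]_d -> 'rV[R]_d -> 'M[R]_d)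
    (K : set 'rV[R]_d) (Phi : R -> R -> Pc R d -> 'rV[R]_d -> 'rV[R]_d)
    (tau : R) (mu : Pc R d) (psi : R -> 'rV[R]_d -> 'rV[R]_d)
    (t : R) (x : 'rV[R]_d) : 'rV[R]_d :=
  let phi := Phi tau t mu in
  let mut := push K phi mu in
  mxact (Dx v t mut (phi x)) (psi t x) +
  \row_i \int[mu]_(y in K) mxact (Dmuv t mut (phi x) (phi y)) (psi t y) 0 i.

(* The coefficients are merely integrable in time, so solutions are absolutely
   continuous and satisfy the equation for almost every time. *)
Definition linearised_solution {R : realType} {d : nat} (T : R)
    (v : R -> Pc R d -> 'rV[R]_d -> 'rV[R]_d)
    (Dmuv : R -> Pc R d -> 'rV[R]_d -> 'rV[R]_d -> 'M[R]_d)
    (K : set 'rV[R]_d) (Phi : R -> R -> Pc R d -> 'rV[R]_d -> 'rV[R]_d)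
    (tau : R) (mu : Pc R d) (psi : R -> 'rV[R]_d -> 'rV[R]_d) : Prop :=
  {within [set` `[0, T]] `*` K,
    continuous (fun z : R * 'rV[R]_d => psi z.1 z.2)} /\
  forall x, K x ->
    [/\ abs_continuous T (fun t => psi t x),
        {ae leb, forall t : R, t \in `]0, T[ ->
          is_derive t 1 (fun s : R => psi s x)
            (linearised_rhs v Dmuv K Phi tau mu psi t x)} &
        psi tau x = - v tau mu x].

Definition C0_differentiable {R : realType} {d : nat} (T : R)
    (K : set 'rV[R]_d) (S : set R) (f : R -> R * 'rV[R]_d -> 'rV[R]_d)
    (tau : R) : Prop :=
  exists2 g : R * 'rV[R]_d -> 'rV[R]_d,
    {within [set` `[0, T]] `*` K, continuous g} &
    ((`|(s - tau)%R|^-1)%:E * supnorm ([set` `[0%R, T]] `*` K)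
       (fun z => (f s z - f tau z - (s - tau) *: g z)%R))%E
    @[s --> within S tau^'] --> (0 : \bar R).

(* Main.v *)
Require Import Defs.
From HB Require Import structures.
From mathcomp Require Import all_boot all_order all_algebra.
From mathcomp Require Import all_classical all_reals all_analysis.
From mathcomp Require Import measurable_realfun ring lra.
Set Implicit Arguments.
Unset Strict Implicit.
Unset Printing Implicit Defensive.
Import Order.TTheory GRing.Theory Num.Theory.
Import numFieldNormedType.Exports.
Local Open Scope classical_set_scope.
Local Open Scope ring_scope.

(** The flow is differentiated by estimating its difference quotients
    q_h = (Phi_(tau+h,t) - Phi_(tau,t)) / h in the initial time, uniformly in
    all times, points of K and measures supported in K.

    The chain rule. At almost every time the local gradient of v in the
    measure only controls optimal plans, whereas the measures at hand are
    images of one measure mu under varying maps. A tangent field is an L^2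
    limit of gradients of test functions, and for these Taylor's formula makes
    the first-order term of a plan depend on its marginals only, up to its
    quadratic cost. Hence all plans of small cost have the same first-order
    term, and h |-> v(push (f + h w) mu) has the derivative that the formula
    for the linearised equation predicts ([gradient_expansion]).

    Uniformity. The remainder of this expansion is uniformly small
    ([linearisation_remainder]) once the derivatives of v are known to be
    close at the images of mu under uniformly close maps, for all mu at once
    ([C0_uniform]). Continuity gives this by compactness: a sequence of
    counterexamples has joint laws on a ball, and along a subsequence these
    are the laws of almost surely convergent random vectors ([skorokhod]).
    That representation is obtained by encoding points of the ball by reals,
    so that quantile functions and Helly's theorem apply.

    The quotients. Over the time interval between tau and tau + h the flow
    moves by O(h) because tau is a Lebesgue point of m, so by Gronwall's
    inequality the quotients are bounded ([flow_lipschitz]). At almost every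
    time the quotient of the velocities is therefore within o(1) of the
    linearised velocity of q_h ([quotient_linearisation]); both are
    dominated by a multiple of the Lipschitz constants of v(t), which are
    integrable in t, so the integrals of the errors tend to 0
    ([quotient_increment]). At time tau the quotient tends
    to - v(tau, mu, x), since tau is a uniform Lebesgue point of v
    ([quotient_start]). Gronwall's inequality for q_h - q_h' then shows that
    the quotients are uniformly Cauchy ([quotient_cauchy]).

    The limit. The limit [psi] of the quotients inherits their integral
    equation, the linearised velocity being measurable as an almost everywhere
    limit of measurable functions ([psi_integral]); differentiating it almost
    everywhere gives the linearised equation. Two absolutely continuous
    solutions are compared through their almost everywhere derivatives
    ([ac_nondecreasing], [solution_increment]) and coincide by Gronwall's
    inequality ([solution_unique]). *)

(** * Euclidean norms and balls *)

Section EuclideanNorm.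
Context {R : realType}.

Lemma cauchy_schwarz_sum (I : finType) (a b : I -> R) :
  (\sum_i a i * b i) ^+ 2 <= (\sum_i a i ^+ 2) * (\sum_i b i ^+ 2).
Proof.
have : 0 <= \sum_i \sum_j (a i * b j - a j * b i) ^+ 2.
  by apply: sumr_ge0 => i _; apply: sumr_ge0 => j _; exact: sqr_ge0.
set A := \sum_i a i ^+ 2; set B := \sum_i b i ^+ 2; set S := \sum_i a i * b i.
suff -> : \sum_i \sum_j (a i * b j - a j * b i) ^+ 2 = A * B + B * A - S * S *+ 2.
  by rewrite mulr2n; lra.
transitivity (\sum_i (a i ^+ 2 * B + b i ^+ 2 * A - (a i * b i * S) *+ 2)).
  apply: eq_bigr => i _; rewrite !mulr_sumr -sumrMnl -big_split -sumrB /=.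
  by apply: eq_bigr => j _; ring.
by rewrite sumrB big_split /= sumrMnl -!mulr_suml.
Qed.

Lemma enorm_pairE m n (A : 'M[R]_(m, n)) :
  enorm A = Num.sqrt (\sum_(p : 'I_m * 'I_n) A p.1 p.2 ^+ 2).
Proof. by rewrite /enorm pair_big. Qed.

Lemma enorm_ge0 m n (A : 'M[R]_(m, n)) : 0 <= enorm A.
Proof. exact: sqrtr_ge0. Qed.

Lemma sqr_enorm m n (A : 'M[R]_(m, n)) :
  enorm A ^+ 2 = \sum_(p : 'I_m * 'I_n) A p.1 p.2 ^+ 2.
Proof.
by rewrite enorm_pairE sqr_sqrtr// sumr_ge0// => i _; exact: sqr_ge0.
Qed.

Lemma enormD m n (A B : 'M[R]_(m, n)) : enorm (A + B) <= enorm A + enorm B.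
Proof.
rewrite -(@ler_pXn2r _ 2)// ?nnegrE ?addr_ge0 ?enorm_ge0//.
rewrite sqrrD !sqr_enorm.
have -> : \sum_(p : 'I_m * 'I_n) (A + B) p.1 p.2 ^+ 2 =
   \sum_(p : 'I_m * 'I_n) A p.1 p.2 ^+ 2 +
   (\sum_(p : 'I_m * 'I_n) A p.1 p.2 * B p.1 p.2) *+ 2 +
   \sum_(p : 'I_m * 'I_n) B p.1 p.2 ^+ 2.
  rewrite -sumrMnl -!big_split /=; apply: eq_bigr => p _.
  by rewrite mxE; ring.
rewrite lerD2r lerD2l lerMn2r/=.
apply: le_trans (ler_norm _) _.
rewrite -(@ler_pXn2r _ 2)// ?nnegrE ?mulr_ge0 ?enorm_ge0//.
by rewrite real_normK ?num_real// exprMn !sqr_enorm; exact: cauchy_schwarz_sum.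
Qed.

Lemma enormZ m n (a : R) (A : 'M[R]_(m, n)) : enorm (a *: A) = `|a| * enorm A.
Proof.
rewrite !enorm_pairE -sqrtr_sqr -sqrtrM ?sqr_ge0//; congr Num.sqrt.
by rewrite mulr_sumr; apply: eq_bigr => p _; rewrite mxE exprMn.
Qed.

Lemma enorm0 m n : enorm (0 : 'M[R]_(m, n)) = 0.
Proof. by rewrite -(scale0r 0) enormZ normr0 mul0r. Qed.

Lemma enormN m n (A : 'M[R]_(m, n)) : enorm (- A) = enorm A.
Proof. by rewrite -scaleN1r enormZ normrN normr1 mul1r. Qed.

Lemma enormB m n (A B : 'M[R]_(m, n)) : enorm (A - B) = enorm (B - A).
Proof. by rewrite -enormN opprB. Qed.

Lemma enorm_trans m n (B A C : 'M[R]_(m, n)) :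
  enorm (A - C) <= enorm (A - B) + enorm (B - C).
Proof. by apply: le_trans (enormD _ _); rewrite addrA subrK. Qed.

Lemma enorm_subl m n (A B : 'M[R]_(m, n)) : enorm A <= enorm (A - B) + enorm B.
Proof. by apply: le_trans (enormD _ _); rewrite subrK. Qed.

Lemma coord_le_enorm m n (A : 'M[R]_(m, n)) i j : `|A i j| <= enorm A.
Proof.
rewrite -(@ler_pXn2r _ 2)// ?nnegrE ?enorm_ge0// sqr_enorm real_normK ?num_real//.
rewrite (bigD1 (i, j))//= lerDl sumr_ge0// => p _; exact: sqr_ge0.
Qed.

Lemma enorm_le_sum m n (A : 'M[R]_(m, n)) :
  enorm A <= \sum_(p : 'I_m * 'I_n) `|A p.1 p.2|.
Proof.
have S0 : 0 <= \sum_(p : 'I_m * 'I_n) `|A p.1 p.2| by apply: sumr_ge0.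
rewrite -(@ler_pXn2r _ 2)// ?nnegrE ?enorm_ge0// sqr_enorm.
have aux (s : seq ('I_m * 'I_n)) :
  \sum_(p <- s) A p.1 p.2 ^+ 2 <= (\sum_(p <- s) `|A p.1 p.2|) ^+ 2.
  elim: s => [|p s IH]; first by rewrite !big_nil expr0n.
  rewrite !big_cons sqrrD real_normK ?num_real//.
  have : 0 <= `|A p.1 p.2| * (\sum_(p <- s) `|A p.1 p.2|).
    by rewrite mulr_ge0// sumr_ge0.
  by move=> h; rewrite -addrA lerD2l (le_trans IH)// lerDr mulrn_wge0.
exact: aux.
Qed.

Lemma enorm_le_bound m n (A : 'M[R]_(m, n)) (c : R) :
  (forall i j, `|A i j| <= c) -> enorm A <= (m * n)%:R * c.
Proof.
move=> h; apply: le_trans (enorm_le_sum A) _.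
apply: le_trans (ler_sum _ (fun p _ => h p.1 p.2)) _.
by rewrite sumr_const card_prod !card_ord mulr_natl.
Qed.

Lemma enorm_rV_le n (x : 'rV[R]_n) (c : R) :
  (forall i, `|x 0 i| <= c) -> enorm x <= n%:R * c.
Proof.
move=> h; have := @enorm_le_bound _ _ x c; rewrite mul1n; apply=> i j.
by rewrite ord1.
Qed.

Lemma norm_le_enorm m n (A : 'M[R]_(m, n)) : `|A| <= enorm A.
Proof.
rewrite [leLHS]/Num.norm /= mx_normrE; apply/bigmax_leP; split; first exact: enorm_ge0.
by move=> p _; exact: coord_le_enorm.
Qed.

Lemma coord_le_norm m n (A : 'M[R]_(m, n)) i j : `|A i j| <= `|A|.
Proof.
rewrite [leRHS]/Num.norm /= mx_normrE.
by apply/bigmax_geP; right => /=; exists (i, j).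
Qed.

Lemma enorm_le_norm n (x : 'rV[R]_n) : enorm x <= n%:R * `|x|.
Proof. by apply: enorm_rV_le => i; exact: coord_le_norm. Qed.

Lemma dotp_le n (x y : 'rV[R]_n) : `|dotp x y| <= enorm x * enorm y.
Proof.
rewrite -(@ler_pXn2r _ 2)// ?nnegrE ?mulr_ge0 ?enorm_ge0//.
rewrite exprMn real_normK ?num_real// /enorm !sqr_sqrtr; last 2 first.
- by rewrite !sumr_ge0// => i _; rewrite sumr_ge0// => j _; exact: sqr_ge0.
- by rewrite !sumr_ge0// => i _; rewrite sumr_ge0// => j _; exact: sqr_ge0.
by rewrite !big_ord1; exact: cauchy_schwarz_sum.
Qed.

Lemma dotpDl n (x y z : 'rV[R]_n) : dotp (x + y) z = dotp x z + dotp y z.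
Proof. by rewrite -big_split/=; apply: eq_bigr => i _; rewrite mxE mulrDl. Qed.

Lemma dotpZr n a (x y : 'rV[R]_n) : dotp x (a *: y) = a * dotp x y.
Proof. by rewrite mulr_sumr; apply: eq_bigr => i _; rewrite mxE mulrCA. Qed.

Lemma dotpNl n (x y : 'rV[R]_n) : dotp (- x) y = - dotp x y.
Proof. by rewrite -sumrN; apply: eq_bigr => i _; rewrite mxE mulNr. Qed.

Lemma dotpBl n (x y z : 'rV[R]_n) : dotp (x - y) z = dotp x z - dotp y z.
Proof. by rewrite dotpDl dotpNl. Qed.

Lemma dotpDr n (x y z : 'rV[R]_n) : dotp z (x + y) = dotp z x + dotp z y.
Proof. by rewrite -big_split/=; apply: eq_bigr => i _; rewrite mxE mulrDr. Qed.

Lemma cball0 n (r : R) : 0 <= r -> cball r (0 : 'rV[R]_n).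
Proof. by move=> r0; rewrite /cball /= enorm0. Qed.

Lemma cball_sub n (r s : R) : r <= s -> cball r `<=` (cball s : set 'rV[R]_n).
Proof. by move=> rs x /le_trans; exact. Qed.

Lemma cball_segment n (r t : R) (x y : 'rV[R]_n) : 0 <= t <= 1 ->
  cball r x -> cball r y -> cball r (x + t *: (y - x)).
Proof.
move=> /andP[t0 t1]; rewrite /cball /= => hx hy.
have -> : x + t *: (y - x) = (1 - t) *: x + t *: y.
  by rewrite scalerBr scalerBl scale1r addrA addrAC.
apply: le_trans (enormD _ _) _.
by rewrite !enormZ !ger0_norm ?subr_ge0//; nra.
Qed.

(** The Euclidean norm and the maximum norm are equivalent. *)
Lemma nbhs_enormP n (x : 'rV[R]_n) (U : set 'rV[R]_n) :
  nbhs x U <-> exists2 e : R, 0 < e & forall y, enorm (y - x) < e -> U y.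
Proof.
split=> [/nbhs_ballP[e /= e0 h]|[e e0 h]].
  exists e => // y yx; apply: h; rewrite -ball_normE /=.
  by rewrite distrC (le_lt_trans (norm_le_enorm _)).
apply/nbhs_ballP; exists (e / n.+1%:R) => /=; first by rewrite divr_gt0.
move=> y; rewrite -ball_normE /= distrC => xy; apply: h.
apply: le_lt_trans (enorm_le_norm _) _.
rewrite ltr_pdivlMr// mulrC in xy; apply: le_lt_trans xy.
by rewrite ler_wpM2r// ler_nat.
Qed.

Lemma enorm_continuous n : continuous (@enorm R 1 n).
Proof.
move=> x U /nbhs_ballP[e /= e0 eU]; apply/nbhs_enormP; exists e => // y yx.
apply: eU; rewrite -ball_normE /= ltr_norml; have := enorm_subl x y; have := enorm_subl y x.
by rewrite [enorm (x - y)]enormB; lra.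
Qed.

Lemma cball_closed n (r : R) : closed (cball r : set 'rV[R]_n).
Proof.
have -> : cball r = @enorm R 1 n @^-1` [set y | y <= r] by [].
by apply: preimage_closed => [x _|]; [exact: enorm_continuous | exact: closed_le].
Qed.

Lemma cball_compact n (r : R) : compact (cball r : set 'rV[R]_n).
Proof.
apply: bounded_closed_compact; last exact: cball_closed.
exists r; split; first exact: num_real.
move=> M rM x xr; apply: le_trans (norm_le_enorm _) _.
by apply: le_trans xr _; exact: ltW.
Qed.

End EuclideanNorm.

(** * Uniform continuity on balls and on time intervals *)

(** Continuity is only required on the ball and on the time interval, off which
    the values of a flow are arbitrary. *)
Definition ucont {R : realType} {n p : nat} (r : R)
    (f : 'rV[R]_n -> 'rV[R]_p) : Prop :=
  forall e, 0 < e -> exists2 delta, 0 < delta & forall x y,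
    cball r x -> cball r y -> enorm (x - y) < delta -> enorm (f x - f y) < e.

Definition ucont2 {R : realType} {n p : nat} (T r : R)
    (F : R -> 'rV[R]_n -> 'rV[R]_p) : Prop :=
  forall e, 0 < e -> exists2 delta, 0 < delta & forall s t x y,
    s \in `[0, T] -> t \in `[0, T] -> cball r x -> cball r y ->
    `|s - t| < delta -> enorm (x - y) < delta -> enorm (F s x - F t y) < e.

Section UniformContinuity.
Context {R : realType} {n p : nat}.
Implicit Types (T r : R) (F G : R -> 'rV[R]_n -> 'rV[R]_p).

Lemma ucont2_slice T r F t : t \in `[0, T] -> ucont2 T r F -> ucont r (F t).
Proof.
move=> tT h e e0; have [de d0 H] := h _ e0; exists de => // x y xr yr xy.
by apply: H => //; rewrite subrr normr0.
Qed.

Lemma ucont2_lincomb T r F G (a b : R) : ucont2 T r F -> ucont2 T r G ->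
  ucont2 T r (fun t x => a *: F t x + b *: G t x).
Proof.
move=> hF hG e e0.
have ea : 0 < e / (2 * (`|a| + 1)) by rewrite divr_gt0// mulr_gt0// ltr_wpDl.
have eb : 0 < e / (2 * (`|b| + 1)) by rewrite divr_gt0// mulr_gt0// ltr_wpDl.
have [d1 d10 H1] := hF _ ea; have [d2 d20 H2] := hG _ eb.
exists (Num.min d1 d2); first by rewrite lt_min d10.
move=> s t x y sT tT xr yr; rewrite !lt_min => /andP[s1 s2] /andP[x1 x2].
have {}H1 := H1 _ _ _ _ sT tT xr yr s1 x1.
have {}H2 := H2 _ _ _ _ sT tT xr yr s2 x2.
rewrite opprD addrACA -!scalerBr; apply: le_lt_trans (enormD _ _) _.
rewrite !enormZ (splitr e); apply: ler_ltD.
  move: H1 => /ltW; rewrite ler_pdivlMr ?mulr_gt0 ?ltr_wpDl// => H1.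
  have := enorm_ge0 (F s x - F t y); have := normr_ge0 a; nra.
move: H2; rewrite ltr_pdivlMr ?mulr_gt0 ?ltr_wpDl// => H2.
have := enorm_ge0 (G s x - G t y); have := normr_ge0 b; nra.
Qed.

Lemma ucont_lincomb r (f g : 'rV[R]_n -> 'rV[R]_p) (a b : R) :
  ucont r f -> ucont r g -> ucont r (fun x => a *: f x + b *: g x).
Proof.
move=> hf hg.
have C (h : 'rV[R]_n -> 'rV[R]_p) : ucont r h -> ucont2 0 r (fun=> h).
  by move=> H e /H[de d0 K]; exists de => // s t x y _ _ xr yr _; exact: K.
have := @ucont2_lincomb 0 r (fun=> f) (fun=> g) a b (C _ hf) (C _ hg).
by move=> /(@ucont2_slice _ _ _ 0); apply; rewrite in_itv /= lexx.
Qed.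

Lemma ucont2_uniform_limit T r F :
  (forall e, 0 < e -> exists2 G, ucont2 T r G &
    forall t x, t \in `[0, T] -> cball r x -> enorm (F t x - G t x) <= e) ->
  ucont2 T r F.
Proof.
move=> h e e0; have e3 : 0 < e / 3%:R by rewrite divr_gt0.
have [G hG FG] := h _ e3; have [de d0 H] := hG _ e3; exists de => //.
move=> s t x y sT tT xr yr st xy.
have := H _ _ _ _ sT tT xr yr st xy.
have := FG _ _ sT xr; have := FG _ _ tT yr; rewrite (enormB (F t y)).
have := enorm_trans (G s x) (F s x) (F t y).
have := enorm_trans (G t y) (G s x) (F t y).
lra.
Qed.

Lemma compact_time_ball T r : compact ([set` `[0, T]] `*` (cball r : set 'rV[R]_n)).
Proof. by apply: compact_setX; [exact: segment_compact|exact: cball_compact]. Qed.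

(** Heine-Cantor on [0, T] x B(0, r). *)
Lemma within_ucont2 T r F :
  {within [set` `[0, T]] `*` cball r,
    continuous (fun z : R * 'rV[R]_n => F z.1 z.2)} -> ucont2 T r F.
Proof.
move=> /subspace_continuousP Fc e e0.
have e2 : 0 < e / 2 by rewrite divr_gt0.
have cK := @compact_time_ball T r.
move/compact_near_coveringP : cK => cK.
pose A := [set` `[0, T]] `*` (cball r : set 'rV[R]_n).
have key : \forall de \near (0 : R)^'+,
  forall z, A z -> A z -> forall w, A w ->
     `|z.1 - w.1| < de -> enorm (z.2 - w.2) < de ->
     enorm (F z.1 z.2 - F w.1 w.2) < e.
  apply: (cK R (0 : R)^'+ (fun de z => A z -> forall w, A w ->
     `|z.1 - w.1| < de -> enorm (z.2 - w.2) < de ->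
     enorm (F z.1 z.2 - F w.1 w.2) < e)) => -[t x] tx.
  have : nbhs (F t x) [set y | enorm (y - F t x) < e / 2].
    by apply/nbhs_enormP; exists (e / 2).
  move=> /(Fc _ tx)[[U B]/= [/nbhs_ballP[d1 /= d10 A1] /nbhs_enormP[d2 d20 B2]] AB].
  pose de := Num.min d1 d2 / 2.
  have de0 : 0 < de by rewrite divr_gt0// lt_min d10.
  exists (ball t de `*` [set y | enorm (y - x) < de], [set u | u < de]).
    split => /=.
      exists (ball t de, [set y | enorm (y - x) < de]) => //=; split.
        exact: nbhsx_ballx.
      by apply/nbhs_enormP; exists de.
    exact: nbhs_right_lt.
  move=> [[s y] u] /= [[ts yx] ude] Asy [w1 w2] Aw /= sw yw.
  rewrite -ball_normE /= in ts.
  have d1m : 2 * de <= d1 by rewrite /de mulrC divfK// ge_min lexx.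
  have d2m : 2 * de <= d2 by rewrite /de mulrC divfK// ge_min lexx orbT.
  have syK : enorm (F w1 w2 - F t x) < e / 2.
    apply: (AB (w1, w2)) => //; split => /=.
      apply: A1; rewrite -ball_normE /=.
      have := ler_normD (t - s) (s - w1); rewrite addrA subrK; lra.
    apply: B2; have := enorm_trans y w2 x; rewrite (enormB w2 y); lra.
  have swK : enorm (F s y - F t x) < e / 2.
    apply: (AB (s, y)) => //; split => /=; first by apply: A1; rewrite -ball_normE /=; lra.
    by apply: B2; lra.
  have := enorm_trans (F t x) (F s y) (F w1 w2); rewrite (enormB (F t x)).
  by lra.
have {key}[de /= de0 de1] := key.
exists (de / 2); first by rewrite divr_gt0.
move=> s t x y sT tT xr yr st xy.
have h1 : 0 < de / 2 by rewrite divr_gt0.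
have h2 : ball_ [eta Num.norm] 0 de (de / 2).
  by rewrite /ball_ /= sub0r normrN gtr0_norm//; lra.
exact: (de1 (de / 2) h2 h1 (s, x) (conj sT xr) (conj sT xr) (t, y) (conj tT yr)).
Qed.

Lemma ucont2_within T r F : ucont2 T r F ->
  {within [set` `[0, T]] `*` cball r,
    continuous (fun z : R * 'rV[R]_n => F z.1 z.2)}.
Proof.
move=> h; apply/subspace_continuousP => -[t x] [/= tT xr] U /nbhs_enormP[e e0 eU].
have [de d0 H] := h _ e0.
exists (ball t de, [set y | enorm (y - x) < de]) => /=.
  by split; [exact: nbhsx_ballx|apply/nbhs_enormP; exists de].
move=> [s y] /= [ts yx] [sT yr]; apply: eU; apply: H => //.
by rewrite -ball_normE /= in ts; rewrite distrC.
Qed.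

Lemma ucont_within r (f : 'rV[R]_n -> 'rV[R]_p) : ucont r f ->
  {within cball r, continuous f}.
Proof.
move=> h; apply/subspace_continuousP => x xr U /nbhs_enormP[e e0 eU].
have [de d0 H] := h _ e0; apply/nbhs_enormP; exists de => // y xy yr.
by apply: eU; exact: H.
Qed.

Lemma ucont2_bounded T r F : ucont2 T r F -> exists2 M, 0 <= M &
  forall t x, t \in `[0, T] -> cball r x -> enorm (F t x) <= M.
Proof.
move=> /ucont2_within Fc.
have := continuous_compact Fc (@compact_time_ball T r).
move=> /compact_bounded[M [_ hM]]; exists (p%:R * (`|M| + 1)).
  by rewrite mulr_ge0// addr_ge0.
move=> t x tT xr; apply: le_trans (enorm_le_norm _) _; rewrite ler_wpM2l//.
apply: (hM (`|M| + 1)); first by have := ler_norm M; lra.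
by exists (t, x).
Qed.

Lemma ucont_bounded r (f : 'rV[R]_n -> 'rV[R]_p) : ucont r f -> exists2 M, 0 <= M &
  forall x, cball r x -> enorm (f x) <= M.
Proof.
move=> h; have [|M M0 H] := @ucont2_bounded 0 r (fun=> f).
  by move=> e /h[de d0 H]; exists de => // s t x y _ _ xr yr _; exact: H.
by exists M => // x xr; apply: (H 0) => //; rewrite in_itv /= lexx.
Qed.

End UniformContinuity.

(** * Borel sets of R^n and supports *)

Section BorelSets.
Context {R : realType} {n : nat}.

Lemma measurable_openB (U : set 'rV[R]_n) :
  open U -> measurable (U : set (Borel R n)).
Proof. exact: sub_sigma_algebra. Qed.

Lemma measurable_closedB (U : set 'rV[R]_n) :
  closed U -> measurable (U : set (Borel R n)).
Proof.
move=> cU; rewrite -(setCK U); apply: measurableC.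
by apply: measurable_openB; exact: closed_openC.
Qed.

Lemma measurable_cball r : measurable (cball r : set (Borel R n)).
Proof. by apply: measurable_closedB; exact: cball_closed. Qed.

Lemma measurable_fun_borel dd (T : measurableType dd) (D : set T) (f : T -> 'rV[R]_n) :
  (forall U : set 'rV[R]_n, open U -> measurable (D `&` f @^-1` U)) ->
  measurable_fun D (f : T -> Borel R n).
Proof.
move=> h; apply: (@measurability _ _ T (Borel R n) D f (@open 'rV[R]_n)) => // A [U oU <-]; exact: h.
Qed.

Lemma measurable_continuousB (g : 'rV[R]_n -> R) :
  continuous g -> measurable_fun setT (g : Borel R n -> R).
Proof.
move=> cg; apply: (measurability _ (RGenOpens.measurableE R)).
move=> _ [_ [x [y ->]] <-]; rewrite setTI; apply: measurable_openB.
by apply: open_comp => [z _|]; [exact: cg | exact: interval_open].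
Qed.

Lemma measurable_coord i : measurable_fun setT (fun x : Borel R n => x 0 i : R).
Proof. by apply: measurable_continuousB; exact: coord_continuous. Qed.

Lemma measurable_enorm : measurable_fun setT (fun x : Borel R n => enorm (x : 'rV[R]_n)).
Proof. by apply: measurable_continuousB; exact: enorm_continuous. Qed.

(** The cubes with rational centre and radius 1/(k+1) form a countable base. *)
Definition ratcube (q : 'rV[rat]_n * nat) : set 'rV[R]_n :=
  [set x | forall i, `|x 0 i - ratr (q.1 0 i)| < q.2.+1%:R^-1].

Lemma ratcube_base (U : set 'rV[R]_n) x : open U -> U x ->
  exists2 q, ratcube q x & ratcube q `<=` U.
Proof.
move=> oU Ux; have /nbhs_enormP[e e0 eU] : nbhs x U by exact: open_nbhs_nbhs.
have [k ke] : exists k : nat, 2 * (n%:R + 1) / e < k.+1%:R.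
  exists (Num.truncn (2 * (n%:R + 1) / e)); exact: truncnS_gt.
have k0 : 0 < k.+1%:R^-1 :> R by rewrite invr_gt0.
have Q i : exists q : rat, `|x 0 i - ratr q| < k.+1%:R^-1.
  have [|q] := @rat_in_itvoo R (x 0 i - k.+1%:R^-1) (x 0 i + k.+1%:R^-1); first by rewrite ltrD2l (lt_trans _ k0)// oppr_lt0.
  by rewrite in_itv /= => /andP[a b]; exists q; rewrite ltr_distlC a.
have [q Hq] := choice Q.
exists (\row_i q i, k) => /=; first by move=> i /=; rewrite mxE.
move=> y Hy; apply: eU.
have : enorm (y - x) <= n%:R * (2 / k.+1%:R).
  apply: enorm_rV_le => i; rewrite !mxE.
  have := Hy i; rewrite /= mxE; have := Hq i; rewrite !ltr_norml ler_norml mulr_natl mulr2n.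
  move: (k.+1%:R^-1) => c.
  by move=> /andP[? ?] /andP[? ?]; apply/andP; split; lra.
move/le_lt_trans; apply.
rewrite mulrA ltr_pdivrMr// mulrC; move: ke; rewrite ltr_pdivrMr// mulrC; lra.
Qed.

(** An open set is a countable union of rational cubes, and the preimage of a
    cube is an intersection of conditions on single coordinates. *)
Lemma measurable_fun_rowP dd (T : measurableType dd) (D : set T)
    (f : T -> 'rV[R]_n) : measurable D ->
  (forall i, measurable_fun D (fun t => f t 0 i)) ->
  measurable_fun D (f : T -> Borel R n).
Proof.
move=> mD mf; apply: measurable_fun_borel => U oU.
have -> : D `&` f @^-1` U = \bigcup_q (D `&` f @^-1` (if `[< ratcube q `<=` U >] then ratcube q else set0)).
  apply/seteqP; split=> [t [Dt Ut]|t [q _ [Dt]]].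
    have [q qt qU] := ratcube_base oU Ut; exists q => //; split => //=.
    by case: asboolP.
  by case: asboolP => // qU /qU.
apply: countable_bigcupT_measurable => // q.
case: asboolP => _; last by rewrite preimage_set0 setI0.
have -> : D `&` f @^-1` ratcube q = D `&` \bigcap_(i in [set: 'I_n])
    (D `&` (fun t => f t 0 i) @^-1` `]ratr (q.1 0 i) - q.2.+1%:R^-1, ratr (q.1 0 i) + q.2.+1%:R^-1[).
  apply/seteqP; split=> [t [Dt h]|t [Dt h]]; split=> // i.
    by move=> _; split=> //=; rewrite in_itv /= -ltr_distl; exact: h.
  have [_ /=] := h i Logic.I.
  by rewrite in_itv /= -ltr_distl.
apply: measurableI => //; apply: fin_bigcap_measurable => // i _.
by apply: mf.
Qed.

Lemma open_bigcap_fin (I : finType) (F : I -> set 'rV[R]_n) :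
  (forall i, open (F i)) -> open (\bigcap_(i in [set: I]) F i).
Proof.
move=> oF; rewrite openE => x xF.
have : nbhs x [set y | forall i, F i y].
  by apply: (@filter_forall _ _ (fun i y => F i y) (nbhs x) (nbhs_filter x)) => i; apply: open_nbhs_nbhs; split => //; exact: xF.
by apply: filterS => y yF i _; exact: yF.
Qed.

Lemma measurable_addB dd (T : measurableType dd) (f g : T -> 'rV[R]_n) :
  measurable_fun setT (f : T -> Borel R n) -> measurable_fun setT (g : T -> Borel R n) ->
  measurable_fun setT ((fun t => f t + g t) : T -> Borel R n).
Proof.
move=> mf mg; apply: measurable_fun_rowP => // i.
under eq_fun do rewrite mxE.
by apply: measurable_funD; apply: (measurableT_comp (measurable_coord i)).
Qed.

Lemma measurable_scaleB dd (T : measurableType dd) a (f : T -> 'rV[R]_n) :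
  measurable_fun setT (f : T -> Borel R n) ->
  measurable_fun setT ((fun t => a *: f t) : T -> Borel R n).
Proof.
move=> mf; apply: measurable_fun_rowP => // i.
under eq_fun do rewrite mxE.
by apply: measurable_funM => //; apply: (measurableT_comp (measurable_coord i)).
Qed.

Lemma measurable_subB dd (T : measurableType dd) (f g : T -> 'rV[R]_n) :
  measurable_fun setT (f : T -> Borel R n) -> measurable_fun setT (g : T -> Borel R n) ->
  measurable_fun setT ((fun t => f t - g t) : T -> Borel R n).
Proof.
move=> mf mg; apply: measurable_addB => //.
by under eq_fun do rewrite -scaleN1r; exact: measurable_scaleB.
Qed.

Lemma measurable_enorm_comp dd (T : measurableType dd) (f : T -> 'rV[R]_n) :
  measurable_fun setT (f : T -> Borel R n) -> measurable_fun setT (fun t => enorm (f t)).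
Proof. by move=> mf; exact: (measurableT_comp measurable_enorm). Qed.

Lemma measurable_dotp dd (T : measurableType dd) (f g : T -> 'rV[R]_n) :
  measurable_fun setT (f : T -> Borel R n) -> measurable_fun setT (g : T -> Borel R n) ->
  measurable_fun setT (fun t => dotp (f t) (g t)).
Proof.
move=> mf mg; apply: measurable_sum => i; apply: measurable_funM.
  exact: (measurableT_comp (measurable_coord i)).
exact: (measurableT_comp (measurable_coord i)).
Qed.

Lemma supp_closed (mu : probability (Borel R n) R) : closed (supp mu).
Proof.
move=> x cx U oU Ux; have [y [sy Uy]] := cx U (open_nbhs_nbhs (conj oU Ux)).
exact: sy.
Qed.

(** The complement of the support is covered by countably many null cubes. *)
Lemma supp_full (mu : probability (Borel R n) R) : mu (~` supp mu) = 0%E.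
Proof.
pose F (q : 'rV[rat]_n * nat) : set (Borel R n) :=
  if `[< mu (ratcube q) = 0%E /\ open (ratcube q) >] then ratcube q else set0.
have mS : measurable (~` supp mu : set (Borel R n)).
  by apply: measurableC; apply: measurable_closedB; exact: supp_closed.
have oq q : open (ratcube q).
  have -> : ratcube q = \bigcap_(i in [set: 'I_n]) (fun x : 'rV[R]_n => x 0 i) @^-1`
     `]ratr (q.1 0 i) - q.2.+1%:R^-1, ratr (q.1 0 i) + q.2.+1%:R^-1[.
    apply/seteqP; split=> [x h i _|x h i].
      by rewrite /= in_itv /= -ltr_distl; exact: h.
    by have := h i Logic.I; rewrite /= in_itv /= -ltr_distl.
  apply: open_bigcap_fin => i; apply: open_comp; last exact: interval_open.
  by move=> x _; exact: coord_continuous.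
apply/negligibleP => //.
have : ~` supp mu `<=` \bigcup_q F q.
  move=> x /existsNP[U /not_implyP[oU /not_implyP[Ux]]].
  move/negP; rewrite -leNgt => mU.
  have [q qx qU] := ratcube_base oU Ux; exists q => //; rewrite /F.
  case: asboolP => // -[]; split => //; apply/eqP; rewrite eq_le measure_ge0 andbT.
  by apply: le_trans mU; apply: le_measure => //; rewrite inE; exact: measurable_openB.
move=> h; apply: (@negligibleS _ _ _ mu (\bigcup_q F q) (~` supp mu) h).
have -> : \bigcup_q F q = \bigcup_k (if unpickle k is Some q then F q else set0).
  apply/seteqP; split=> [x [q _ Fq]|x [k _]].
    by exists (pickle q) => //; rewrite pickleK.
  by case: unpickle => // q Fq; exists q.
apply: negligible_bigcup => k; case: unpickle => [q|]; last exact: negligible_set0.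
rewrite /F; case: asboolP => [[q0 _]|_]; last exact: negligible_set0.
by apply/negligibleP => //; exact: measurable_openB.
Qed.

Lemma supp_sub_full (mu : probability (Borel R n) R) (A : set (Borel R n)) :
  measurable A -> supp mu `<=` A -> mu A = 1%E /\ mu (~` A) = 0%E.
Proof.
move=> mA sA; have : mu (~` A) = 0%E.
  apply/eqP; rewrite eq_le measure_ge0 andbT -(supp_full mu).
  by apply: le_measure; rewrite ?inE;
    [exact: measurableC | apply: measurableC; apply: measurable_closedB; exact: supp_closed
    | exact: subsetC].
move=> A0; split=> //; have := probability_setC mu mA; rewrite A0.
move/esym/eqP; rewrite sube_eq ?fin_num_measure// add0e => /eqP ->//.
Qed.

Lemma full_supp_sub (mu : probability (Borel R n) R) (C : set 'rV[R]_n) :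
  closed C -> mu (C : set (Borel R n)) = 1%E -> supp mu `<=` C.
Proof.
move=> cC C1 x sx; apply: contrapT => nCx.
have := sx (~` C) (closed_openC cC) nCx.
by rewrite (probability_setC mu (measurable_closedB cC)) C1 subee// ltxx.
Qed.

End BorelSets.

(** * Laws of random vectors and couplings *)

(** A coupling is produced each time by two random vectors on a common
    probability space, so that costs become expectations. *)
Definition has_law {R : realType} {dd} {Om : measurableType dd} {n : nat}
    (P : probability Om R) (X : Om -> 'rV[R]_n)
    (mu : probability (Borel R n) R) : Prop :=
  measurable_fun setT (X : Om -> Borel R n) /\
  forall A : set (Borel R n), measurable A -> mu A = P (X @^-1` A).

Lemma integral_cst_probability {R : realType} {dd} {Om : measurableType dd}
  (P : probability Om R) (c : R) : (\int[P]_(w in setT) (cst c%:E) w)%E = c%:E.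
Proof. by rewrite integral_cst//= [P _](@probability_setT _ _ _ P) mule1. Qed.

Section Laws.
Context {R : realType} {dd} {Om : measurableType dd} (P : probability Om R).
Context {n : nat}.
Implicit Types (X Y : Om -> 'rV[R]_n) (mu nu : probability (Borel R n) R).

Lemma has_law_supp X mu (C : set 'rV[R]_n) : closed C ->
  has_law P X mu -> (forall w, C (X w)) -> supp mu `<=` C.
Proof.
move=> cC [mX lX] XC; apply: full_supp_sub => //.
rewrite lX; last exact: measurable_closedB.
by rewrite (_ : _ @^-1` _ = setT) ?probability_setT// -subTset => w _; exact: XC.
Qed.

Lemma law_exists X rho : measurable_fun setT (X : Om -> Borel R n) ->
  (forall w, cball rho (X w)) ->
  exists2 nu : Pc R n, has_law P X nu & PP (cball rho) nu.
Proof.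
move=> mX Xr.
pose iX := isMeasurableFun.Build _ _ _ _ (X : Om -> Borel R n) mX.
pose X' : {mfun Om >-> Borel R n} := HB.pack (X : Om -> Borel R n) iX.
pose nu : probability (Borel R n) R := distribution P X'.
have lX : has_law P X nu by split.
have sX : supp nu `<=` cball rho.
  by apply: has_law_supp lX _ => //; exact: cball_closed.
have cX : compact (supp nu).
  by apply: (subclosed_compact _ (@cball_compact R n rho) sX); exact: supp_closed.
by exists (MkPc cX).
Qed.

Lemma ge0_integral_law X mu (g : Borel R n -> \bar R) : has_law P X mu ->
  measurable_fun setT g -> (forall x, 0 <= g x)%E ->
  (\int[mu]_x g x = \int[P]_w g (X w))%E.
Proof.
move=> [mX lX] mg g0.
rewrite (eq_measure_integral (pushforward P (X : Om -> Borel R n))); last first.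
  by move=> A mA _; exact: lX.
by rewrite ge0_integral_pushforward//.
Qed.

Lemma integral_law X mu (g : Borel R n -> \bar R) : has_law P X mu ->
  measurable_fun setT g -> P.-integrable setT (fun w => g (X w)) ->
  (\int[mu]_x g x = \int[P]_w g (X w))%E.
Proof.
move=> [mX lX] mg ig.
rewrite (eq_measure_integral (pushforward P (X : Om -> Borel R n))); last first.
  by move=> A mA _; exact: lX.
by rewrite integral_pushforward//.
Qed.

Lemma coupling_of_laws X Y (mu nu : Pc R n) :
  has_law P X mu -> has_law P Y nu ->
  exists gamma, [/\ coupling mu nu gamma,
    forall g : Borel R n * Borel R n -> \bar R, measurable_fun setT g ->
      (forall z, 0 <= g z)%E -> (\int[gamma]_z g z = \int[P]_w g (X w, Y w))%E &
    forall g : Borel R n * Borel R n -> \bar R, measurable_fun setT g ->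
      P.-integrable setT (fun w => g (X w, Y w)) ->
      (\int[gamma]_z g z = \int[P]_w g (X w, Y w))%E].
Proof.
move=> [mX lX] [mY lY].
pose Z w : Borel R n * Borel R n := (X w, Y w).
have mZ : measurable_fun setT Z by exact: measurable_fun_pair.
pose iZ := isMeasurableFun.Build _ _ _ _ Z mZ.
pose Z' : {mfun Om >-> (Borel R n * Borel R n)%type} := HB.pack Z iZ.
exists (distribution P Z'); split.
- move=> A mA; rewrite lX// lY//; split; rewrite /distribution/= /pushforward/=; congr (P _).
    by rewrite setXT.
  by rewrite setTX.
- by move=> g mg g0; rewrite ge0_integral_distribution.
- by move=> g mg ig; rewrite integral_distribution.
Qed.

Lemma W_ge0 p (mu nu : Pc R n) : 0 <= W p mu nu.
Proof. exact: powR_ge0. Qed.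

Lemma cost_ge0 p gamma : (0 <= @cost R n p gamma)%E.
Proof. by apply: integral_ge0 => z _; rewrite lee_fin exprn_ge0// enorm_ge0. Qed.

Lemma inf_cost_ge0 p (mu nu : Pc R n) :
  (0 <= ereal_inf [set cost p gamma | gamma in coupling mu nu])%E.
Proof. by apply: le_ereal_inf_tmp => _ [g _ <-]; exact: cost_ge0. Qed.

Lemma measurable_cost p :
  measurable_fun setT (fun z : Borel R n * Borel R n =>
    (enorm ((z.2 : 'rV[R]_n) - z.1) ^+ p)%:E).
Proof.
apply/measurable_EFinP; apply: measurable_funX; apply: measurable_enorm_comp.
by apply: measurable_subB; [exact: measurable_snd|exact: measurable_fst].
Qed.

(** The joint law of two random vectors is one of the couplings over which
    the distance is an infimum. *)
Lemma W1_le X Y (mu nu : Pc R n) (c : R) :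
  has_law P X mu -> has_law P Y nu ->
  (\int[P]_w (enorm (Y w - X w))%:E <= c%:E)%E -> W 1 mu nu <= c.
Proof.
move=> lX lY hc; have [g [cg g0 _]] := coupling_of_laws lX lY.
rewrite /W invr1 powRr1; last exact: (fine_ge0 (inf_cost_ge0 _ _ _)).
have h : (ereal_inf [set cost 1 gamma | gamma in coupling mu nu] <= c%:E)%E.
  apply: ge_ereal_inf; exists (cost 1 g); first by exists g.
  rewrite /cost g0//; [exact: measurable_cost|].
  by move=> z; rewrite lee_fin exprn_ge0// enorm_ge0.
by have := inf_cost_ge0 1 mu nu; move: h; case: ereal_inf => //= s.
Qed.

Lemma W1_le_cst X Y (mu nu : Pc R n) (c : R) :
  has_law P X mu -> has_law P Y nu -> P.-negligible [set w | ~ enorm (Y w - X w) <= c] ->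
  0 <= c -> W 1 mu nu <= c.
Proof.
move=> lX lY h c0; apply: (W1_le lX lY).
have mE : measurable_fun setT (fun w => (enorm (Y w - X w))%:E).
  apply/measurable_EFinP; apply: measurable_enorm_comp.
  by apply: measurable_subB; [case: lY|case: lX].
have -> : c%:E = (\int[P]_(w in setT) (cst c%:E) w)%E.
  by rewrite integral_cst_probability.
apply: ae_ge0_le_integral => //.
- by move=> w _; rewrite lee_fin enorm_ge0.
- by apply: negligibleS h => w /= h1 h2; apply: h1 => _; rewrite lee_fin.
Qed.

End Laws.

(** * Images of measures *)

(** The extension of [f] by 0 off the ball is Borel, and has the same image of
    the measures supported in the ball. *)
Definition clip {R : realType} {n p : nat} (r : R) (f : 'rV[R]_n -> 'rV[R]_p)
    (x : 'rV[R]_n) : 'rV[R]_p := if enorm x <= r then f x else 0.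

Section Push.
Context {R : realType} {n : nat}.
Variable r : R.
Notation K := (cball r : set 'rV[R]_n).

Lemma clipE p (f : 'rV[R]_n -> 'rV[R]_p) x : K x -> clip r f x = f x.
Proof. by rewrite /clip /cball /= => ->. Qed.

Lemma measurable_clip p (f : 'rV[R]_n -> 'rV[R]_p) : ucont r f ->
  measurable_fun setT (clip r f : Borel R n -> Borel R p).
Proof.
move=> uf.
have mK := @measurable_cball R n r.
rewrite -(setUv (K : set (Borel R n))); apply/measurable_funU => //; first exact: measurableC.
split; last first.
  apply: (eq_measurable_fun (cst 0 : Borel R n -> Borel R p)) => // x; rewrite inE /clip /cball /= => /negP/negPf ->//.
apply: measurable_fun_borel => U oU.
have /continuousP/(_ U oU) := ucont_within uf.
move=> /open_subspaceP[V oV VE].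
have -> : (K : set (Borel R n)) `&` clip r f @^-1` U = V `&` K.
  apply/seteqP; split=> [x [Kx] /=|x VKx].
    rewrite clipE// => Ux; have : (f @^-1` U `&` K) x by [].
    by rewrite -VE.
  have : (f @^-1` U `&` K) x by rewrite -VE.
  by move=> [? ?]; split=> //=; rewrite clipE.
by apply: measurableI => //; exact: measurable_openB.
Qed.

Lemma PP_full (mu : Pc R n) : PP K mu -> mu (K : set (Borel R n)) = 1%E.
Proof. by move=> /(supp_sub_full (measurable_cball r))[]. Qed.

Lemma PP_null (mu : Pc R n) : PP K mu -> mu (~` K : set (Borel R n)) = 0%E.
Proof. by move=> /(supp_sub_full (measurable_cball r))[]. Qed.

Lemma clip_ucont_bounded p (f : 'rV[R]_n -> 'rV[R]_p) : ucont r f ->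
  exists2 M, 0 <= M & forall x, cball M (clip r f x).
Proof.
move=> /ucont_bounded[M M0 H]; exists M => // x; rewrite /clip /cball /=.
by case: ifPn => [/H//|_]; rewrite enorm0.
Qed.

Variable mu : Pc R n.
Hypothesis muK : PP K mu.

Lemma PP_ae (Q : 'rV[R]_n -> Prop) : (forall x, K x -> Q x) ->
  mu.-negligible [set x | ~ Q x].
Proof.
move=> h; exists (~` K : set (Borel R n)); split.
- by apply: measurableC; exact: measurable_cball.
- exact: PP_null.
- by move=> x /= nQ Kx; apply: nQ; exact: h.
Qed.

(** The choice made by [push] succeeds, since the law of the clipped map is a
    witness. *)
Lemma push_law f : ucont r f -> has_law mu (clip r f) (push K f mu).
Proof.
move=> uf; split; first exact: measurable_clip.
have eqA (A : set (Borel R n)) : measurable A ->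
    mu ((clip r f : Borel R n -> Borel R n) @^-1` A) = mu (K `&` f @^-1` A).
  move=> mA; have mKA : measurable (K `&` f @^-1` A : set (Borel R n)).
    have -> : K `&` f @^-1` A = K `&` (clip r f : Borel R n -> Borel R n) @^-1` A.
      by apply/seteqP; split=> x [Kx /=]; rewrite ?clipE// => Ax; split=> //=; rewrite clipE.
    apply: measurableI; first exact: measurable_cball.
    by rewrite -[X in measurable X]setTI; apply: measurable_clip.
  have mcA : measurable ((clip r f : Borel R n -> Borel R n) @^-1` A).
    by rewrite -[X in measurable X]setTI; apply: measurable_clip.
  have mCK : measurable (~` K : set (Borel R n)).
    by apply: measurableC; exact: measurable_cball.
  rewrite -[RHS](@measureU0 _ _ _ mu _ ((clip r f : Borel R n -> Borel R n) @^-1` A `&` ~` K))//.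
  - congr (mu _); apply/seteqP; split=> [x Ax|x [[Kx Ax]|[//]]] /=; last by rewrite clipE.
    have [Kx|nK] := pselect (K x); [left; split=> //|by right].
    by move: Ax; rewrite /= clipE.
  - exact: measurableI.
  - apply/eqP; rewrite eq_le measure_ge0 andbT -(PP_null muK).
    by apply: le_measure; rewrite ?inE//; exact: measurableI.
have [M M0 HM] := clip_ucont_bounded uf.
have [nu [_ lnu] _] := @law_exists _ _ _ mu _ _ _ (measurable_clip uf) HM.
rewrite /push; case: xgetP => [nu' _ /= h A mA|/(_ nu)].
  by rewrite h// eqA.
by case; move=> A mA; rewrite lnu// eqA.
Qed.

Lemma push_PP f rho : ucont r f -> (forall x, K x -> cball rho (f x)) ->
  PP (cball rho) (push K f mu).
Proof.
move=> uf h; apply: full_supp_sub; first exact: cball_closed.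
have [_ ->] := push_law uf; last exact: measurable_cball.
apply/eqP; rewrite eq_le probability_le1 /=; last first.
  rewrite -[X in measurable X]setTI; apply: measurable_clip => //; exact: measurable_cball.
rewrite -(PP_full muK); apply: le_measure; rewrite ?inE; first exact: measurable_cball.
  rewrite -[X in measurable X]setTI; apply: measurable_clip => //; exact: measurable_cball.
by move=> x Kx /=; rewrite clipE//; exact: h.
Qed.

Lemma W1_push f g c : ucont r f -> ucont r g -> 0 <= c ->
  (forall x, K x -> enorm (g x - f x) <= c) ->
  W 1 (push K f mu) (push K g mu) <= c.
Proof.
move=> uf ug c0 h; apply: (W1_le_cst (push_law uf) (push_law ug)) => //.
by apply: PP_ae => x Kx; rewrite !clipE//; exact: h.
Qed.

Lemma has_law_id : has_law mu (fun x => x) mu.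
Proof. by split. Qed.

Lemma W1_push_id f c : ucont r f -> 0 <= c ->
  (forall x, K x -> enorm (f x - x) <= c) -> W 1 mu (push K f mu) <= c.
Proof.
move=> uf c0 h; apply: (W1_le_cst has_law_id (push_law uf)) => //.
by apply: PP_ae => x Kx; rewrite !clipE//; exact: h.
Qed.

Lemma M1_push f rho : ucont r f -> 0 <= rho ->
  (forall x, K x -> cball rho (f x)) -> M1 (push K f mu) <= rho.
Proof.
move=> uf r0 h; rewrite /M1 /Rintegral.
have mE : measurable_fun setT (fun x : Borel R n => (enorm (x : 'rV[R]_n))%:E).
  by apply/measurable_EFinP; exact: measurable_enorm.
rewrite (ge0_integral_law (push_law uf)) => //; last by move=> x; rewrite lee_fin enorm_ge0.
have le : (\int[mu]_w (enorm (clip r f w))%:E <= rho%:E)%E.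
  have -> : rho%:E = (\int[mu]_(w in setT) (cst rho%:E) w)%E.
    by rewrite integral_cst_probability.
  apply: ae_ge0_le_integral => //.
  - by move=> w _; rewrite lee_fin enorm_ge0.
  - by apply/measurable_EFinP; apply: measurable_enorm_comp; exact: measurable_clip.
  - apply: negligibleS (PP_ae (Q := fun w => enorm (clip r f w) <= rho) _).
      by move=> w /= h1 h2; apply: h1 => _; rewrite lee_fin.
    by move=> x Kx; rewrite clipE//; exact: h.
have ge : (0 <= \int[mu]_w (enorm (clip r f w))%:E)%E.
  by apply: integral_ge0 => w _; rewrite lee_fin enorm_ge0.
by rewrite -lee_fin fineK// ge0_fin_numE// (le_lt_trans le) ?ltry.
Qed.

End Push.

(** * First-order expansions *)

(** [expands g t l] is differentiability at [t] with derivative [l] in the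
    epsilon-delta form in which it comes out of estimates. *)
Definition expands {R : realType} (g : R -> R) (t l : R) : Prop :=
  forall e, 0 < e -> exists2 delta, 0 < delta &
    forall h, `|h| < delta -> `|g (t + h) - g t - h * l| <= e * `|h|.

Section Expansions.
Context {R : realType}.

Lemma expands_is_derive (g : R -> R) (t l : R) : expands g t l -> is_derive t 1 g l.
Proof.
move=> hg.
have cv : h^-1 *: ((g \o shift t) (h *: (1 : R)) - g t) @[h --> (0 : R)^'] --> l.
  apply/cvgrPdist_le => e e0; have [de d0 H] := hg _ e0.
  near=> h.
  have h0 : h != 0 by near: h; exact: nbhs_dnbhs_neq.
  have hd : `|h| < de.
    by near: h; exact: dnbhs0_lt.
  have := H _ hd; rewrite /= /GRing.scale /= mulr1 [h + t]addrC => {}H.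
  have -> : l - h^-1 * (g (t + h) - g t) = - (h^-1 * (g (t + h) - g t - h * l)).
    by field.
  by rewrite normrN normrM normfV mulrC ler_pdivrMr ?normr_gt0.
by split; [apply/cvg_ex; exists l | exact: cvg_lim].
Unshelve. all: by end_near. Qed.

Lemma is_derive_expands (g : R -> R) (t l : R) : is_derive t 1 g l -> expands g t l.
Proof.
move=> [/cvg_ex[l' /[dup] cv /cvg_lim E] D] e e0.
have ll' : l = l' by rewrite -D -E.
rewrite {}ll' in D *.
move/cvgrPdist_le/(_ e e0): cv => /nbhs_ballP[de /= d0 H].
exists de => // h hd; have [->|h0] := eqVneq h 0.
  by rewrite addr0 mul0r !subrr normr0 mulr0.
have := H h; rewrite /ball /= sub0r normrN => /(_ hd h0).
rewrite /GRing.scale /= mulr1 [h + t]addrC => {}H.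
have -> : g (t + h) - g t - h * l' = - (h * (l' - h^-1 * (g (t + h) - g t))).
  by field.
by rewrite normrN normrM mulrC ler_wpM2r.
Qed.

Lemma expands_continuous (g : R -> R) (t l : R) : expands g t l -> {for t, continuous g}.
Proof.
move=> /expands_is_derive[D _].
by apply: differentiable_continuous; exact/derivable1_diffP.
Qed.

Lemma expands_mvt (g g' : R -> R) : (forall t, expands g t (g' t)) ->
  exists2 c, 0 <= c <= 1 & g 1 - g 0 = g' c.
Proof.
move=> hg.
have [||c] := @MVT_segment R g g' 0 1 ler01.
- by move=> x _; exact: expands_is_derive.
- by apply: continuous_subspaceT => x; exact: expands_continuous (hg x).
- by rewrite subr0 mulr1 in_itv => ? ?; exists c.
Qed.

Lemma differentiable_expands n p (F : 'rV[R]_n -> 'rV[R]_p) z :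
  differentiable F z -> forall e, 0 < e -> exists2 delta, 0 < delta &
    forall u, enorm u < delta -> enorm (F (z + u) - F z - 'd F z u) <= e * enorm u.
Proof.
move=> dF e e0; have := diff_locally dF => /eqaddoP.
have e1 : 0 < e / p.+1%:R by rewrite divr_gt0.
move=> /(_ _ e1) /nbhs_enormP[de d0 H]; exists de => // u ud.
have := H u; rewrite subr0 => /(_ ud) /=.
have -> : (F \o shift z - (cst (F z) + 'd F z)) u = F (z + u) - F z - 'd F z u.
  by rewrite !fctE /= [u + z]addrC opprD addrA.
move=> {}H; apply: le_trans (enorm_le_norm _) _.
apply: le_trans (ler_wpM2l _ H) _ => //.
rewrite mulrA mulrCA; apply: ler_pM; rewrite ?mulr_ge0 ?divr_ge0//; first exact: ltW.
  by rewrite ler_piMr ?ltW// mulrC ltr_pdivrMl// ?mulr1 ?ltr_nat.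
exact: norm_le_enorm.
Qed.

Lemma differentiable_expands_real n (f : 'rV[R]_n -> R) z :
  differentiable f z -> forall e, 0 < e -> exists2 delta, 0 < delta &
    forall u, enorm u < delta -> `|f (z + u) - f z - 'd f z u| <= e * enorm u.
Proof.
move=> dF e e0; have := diff_locally dF => /eqaddoP.
move=> /(_ _ e0) /nbhs_enormP[de d0 H]; exists de => // u ud.
have := H u; rewrite subr0 => /(_ ud) /=.
have -> : (f \o shift z - (cst (f z) + 'd f z)) u = f (z + u) - f z - 'd f z u.
  by rewrite !fctE /= [u + z]addrC opprD addrA.
by move=> /le_trans; apply; apply: ler_wpM2l; [exact: ltW|exact: norm_le_enorm].
Qed.

Lemma diff_grad n (f : 'rV[R]_n -> R) z u : differentiable f z ->
  'd f z u = dotp (grad f z) u.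
Proof.
move=> df; rewrite {1}(row_sum_delta u) linear_sum; apply: eq_bigr => i _.
by rewrite linearZ /= mxE /partial deriveE// mulrC.
Qed.

Lemma expands_line n p (F : 'rV[R]_n -> 'rV[R]_p) x u i t :
  differentiable F (x + t *: u) ->
  expands (fun s => F (x + s *: u) 0 i) t ('d F (x + t *: u) u 0 i).
Proof.
move=> /differentiable_expands hF e e0.
have e1 : 0 < e / (enorm u + 1) by rewrite divr_gt0// ltr_wpDl// enorm_ge0.
have [de d0 H] := hF _ e1; exists (de / (enorm u + 1)).
  by rewrite divr_gt0// ltr_wpDl// enorm_ge0.
move=> h; rewrite ltr_pdivlMr ?ltr_wpDl ?enorm_ge0// => hd.
have := H (h *: u); rewrite enormZ => /(_ _)/wrap[].
  by have := normr_ge0 h; have := enorm_ge0 u; nra.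
rewrite linearZ -[x + _ + _]addrA -scalerDl => {}H.
have := coord_le_enorm (F (x + (t + h) *: u) - F (x + t *: u) - h *: 'd F (x + t *: u) u) 0 i.
rewrite !mxE => /le_trans; apply; apply: le_trans H _.
rewrite mulrA mulrAC ler_wpM2r// -mulrA ler_piMr ?ltW// mulrC.
by rewrite ltr_pdivrMr ?ltr_wpDl ?enorm_ge0//; lra.
Qed.

Lemma expands_line_real n (f : 'rV[R]_n -> R) x u t :
  differentiable f (x + t *: u) ->
  expands (fun s => f (x + s *: u)) t ('d f (x + t *: u) u).
Proof.
move=> /differentiable_expands_real hF e e0.
have e1 : 0 < e / (enorm u + 1) by rewrite divr_gt0// ltr_wpDl// enorm_ge0.
have [de d0 H] := hF _ e1; exists (de / (enorm u + 1)).
  by rewrite divr_gt0// ltr_wpDl// enorm_ge0.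
move=> h; rewrite ltr_pdivlMr ?ltr_wpDl ?enorm_ge0// => hd.
have := H (h *: u); rewrite enormZ => /(_ _)/wrap[].
  by have := normr_ge0 h; have := enorm_ge0 u; nra.
rewrite linearZ -[x + _ + _]addrA -scalerDl => {}H.
apply: le_trans H _.
rewrite mulrA mulrAC ler_wpM2r// -mulrA ler_piMr ?ltW// mulrC.
by rewrite ltr_pdivrMr ?ltr_wpDl ?enorm_ge0//; lra.
Qed.

Lemma mvt_line n p (F : 'rV[R]_n -> 'rV[R]_p) x y i :
  (forall z, differentiable F z) -> exists2 c, 0 <= c <= 1 &
    F y 0 i - F x 0 i = 'd F (x + c *: (y - x)) (y - x) 0 i.
Proof.
move=> dF; have [c c01] := @expands_mvt (fun s => F (x + s *: (y - x)) 0 i)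
  (fun s => 'd F (x + s *: (y - x)) (y - x) 0 i) (fun t => expands_line _ (dF _)).
by rewrite scale1r scale0r addr0 [x + (y - x)]addrC subrK => E; exists c.
Qed.

Lemma mvt_line_real n (f : 'rV[R]_n -> R) x y :
  (forall z, differentiable f z) -> exists2 c, 0 <= c <= 1 &
    f y - f x = dotp (grad f (x + c *: (y - x))) (y - x).
Proof.
move=> df; have [c c01] := @expands_mvt (fun s => f (x + s *: (y - x)))
  (fun s => 'd f (x + s *: (y - x)) (y - x)) (fun t => expands_line_real (df _)).
rewrite scale1r scale0r addr0 [x + (y - x)]addrC subrK => E; exists c => //.
by rewrite E diff_grad.
Qed.

(** The second partial derivatives are continuous, hence bounded on the
    ball, and the mean value theorem is applied twice. *)
Lemma test_function_taylor n (f : 'rV[R]_n -> R) (B : R) : test_function f ->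
  exists2 C, 0 <= C & forall x y, cball B x -> cball B y ->
    `|f y - f x - dotp (grad f x) (y - x)| <= C * enorm (y - x) ^+ 2.
Proof.
move=> [df _].
have bounded_partial (i j : 'I_n) : exists2 M, 0 <= M &
    forall x, cball B x -> `|partial j (partial i f) x| <= M.
  have cj : continuous (partial j (partial i f)).
    by move=> x; apply: differentiable_continuous; exact: (df [:: j; i]).
  have := continuous_compact (continuous_subspaceT cj) (@cball_compact R n B).
  move=> /compact_bounded[M [_ hM]]; exists (`|M| + 1); first by rewrite addr_ge0.
  move=> x xB; apply: (hM (`|M| + 1)); first by have := ler_norm M; lra.
  by exists x.
have [M hM] : exists M : 'I_n -> 'I_n -> R, forall i j, 0 <= M i j /\
    forall x, cball B x -> `|partial j (partial i f) x| <= M i j.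
  have h i : exists Mi : 'I_n -> R, forall j, 0 <= Mi j /\
      forall x, cball B x -> `|partial j (partial i f) x| <= Mi j.
    have /choice[Mi H] : forall j, exists N, 0 <= N /\
        forall x, cball B x -> `|partial j (partial i f) x| <= N.
      by move=> j; have [N N0 H] := bounded_partial i j; exists N.
    by exists Mi.
  by have [N H] := choice h; exists N.
pose C := \sum_i \sum_j M i j.
have S0 i : 0 <= \sum_j M i j by apply: sumr_ge0 => j _; have [] := hM i j.
have C0 : 0 <= C by apply: sumr_ge0.
have lip i x y : cball B x -> cball B y ->
    `|partial i f y - partial i f x| <= (\sum_j M i j) * enorm (y - x).
  move=> xB yB; have [c c01 ->] := @mvt_line_real n (partial i f) x y (df [:: i]).
  apply: le_trans (ler_norm_sum _ _ _) _; rewrite mulr_suml; apply: ler_sum => j _.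
  rewrite normrM; apply: ler_pM => //.
    rewrite mxE; apply: (hM i j).2; exact: cball_segment.
  exact: coord_le_enorm.
exists C => // x y xB yB.
have [c c01 ->] := @mvt_line_real n f x y (df [::]).
rewrite -dotpBl; apply: le_trans (ler_norm_sum _ _ _) _.
rewrite expr2 mulrA /C !mulr_suml; apply: ler_sum => i _.
rewrite normrM; apply: ler_pM => //; last exact: coord_le_enorm.
rewrite !mxE; have := lip i x (x + c *: (y - x)) xB (cball_segment c01 xB yB).
move=> /le_trans; apply; apply: ler_wpM2l => //.
rewrite addrAC subrr add0r enormZ ler_piMl ?enorm_ge0//.
by move: c01 => /andP[c0 c1]; rewrite ger0_norm.
Qed.

End Expansions.

(** * Derivatives along transports *)

(** What is used of a tangent field: up to a small error in L^2 it is the field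
    [g] of a first-order Taylor expansion, on the ball of radius [B]. *)
Definition taylor_approximable {R : realType} {d : nat} (lam : Pc R d) (B : R)
    (xi : 'rV[R]_d -> 'rV[R]_d) : Prop :=
  forall e, 0 < e -> exists zeta : 'rV[R]_d -> R, exists g : 'rV[R]_d -> 'rV[R]_d,
    exists Z : R, exists C : R,
    [/\ measurable_fun setT (zeta : Borel R d -> R) /\ (forall x, `|zeta x| <= Z),
        measurable_fun setT (g : Borel R d -> Borel R d),
        0 <= C /\ (forall x y, cball B x -> cball B y ->
          `|zeta y - zeta x - dotp (g x) (y - x)| <= C * enorm (y - x) ^+ 2) &
        (\int[lam]_x (enorm (xi x - g x) ^+ 2)%:E <= (e ^+ 2)%:E)%E].

Section Transport.
Context {R : realType} {d : nat}.
Implicit Types (lam nu mu : Pc R d) (xi : 'rV[R]_d -> 'rV[R]_d).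

Lemma measurable_if_ball (B : R) (f : 'rV[R]_d -> R) :
  measurable_fun setT (f : Borel R d -> R) ->
  measurable_fun setT (fun x : Borel R d => if enorm (x : 'rV[R]_d) <= B then f x else 0).
Proof.
move=> mf; apply: measurable_fun_ifT => //.
by apply: measurable_fun_ler => //; exact: measurable_enorm.
Qed.

Lemma Tan_taylor lam B xi : 0 <= B -> PP (cball B) lam -> Tan lam xi ->
  taylor_approximable lam B xi.
Proof.
move=> B0 lB [_ H] e e0; have [|f tf fe] := H (e ^+ 2); first by rewrite exprn_gt0.
have [C C0 hC] := test_function_taylor B tf.
have [df _] := tf.
have cf : continuous f by move=> x; apply: differentiable_continuous; exact: (df [::]).
have mf := measurable_continuousB cf.
have [Z hZ] : exists Z, forall x, cball B x -> `|f x| <= Z.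
  have := continuous_compact (continuous_subspaceT cf) (@cball_compact R d B).
  move=> /compact_bounded[M [_ hM]]; exists (`|M| + 1) => x xB.
  by apply: (hM (`|M| + 1)); [have := ler_norm M; lra|exists x].
exists (fun x => if enorm x <= B then f x else 0), (grad f), `|Z|, C; split.
- split; first exact: measurable_if_ball.
  move=> x; case: ifPn => [/hZ/le_trans->//|_]; first exact: ler_norm.
  by rewrite normr0.
- apply: measurable_fun_rowP => // i.
  have -> : (fun t : Borel R d => grad f t 0 i) = partial i f.
    by apply/funext => x; rewrite mxE.
  apply: measurable_continuousB => x; apply: differentiable_continuous.
  exact: (df [:: i]).
- split=> // x y xB yB; move: (xB) (yB); rewrite /cball /= => -> ->.
  exact: hC.
- exact: ltW.
Qed.

Lemma taylor_approximableN lam B xi : taylor_approximable lam B xi ->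
  taylor_approximable lam B (fun x => - xi x).
Proof.
move=> H e /H[f [g [Z [C [[mf fZ] mg [C0 hC] he]]]]].
exists (fun x => - f x), (fun x => - g x), Z, C; split.
- split; first exact: measurable_funN.
  by move=> x; rewrite normrN.
- by under eq_fun do rewrite -scaleN1r; exact: measurable_scaleB.
- split=> // x y xB yB; apply: le_trans (hC x y xB yB).
  by rewrite dotpNl -normrN !opprD !opprK.
- apply: le_trans he; rewrite le_eqVlt; apply/orP; left; apply/eqP.
  by apply: eq_integral => x _; rewrite -opprD enormN.
Qed.

Lemma coupling_fst lam nu gamma : coupling lam nu gamma ->
  has_law gamma (fun z : Borel R d * Borel R d => z.1 : 'rV[R]_d) lam.
Proof.
move=> cg; split; first exact: measurable_fst.
by move=> A mA; have [<- _] := cg A mA; congr (gamma _); rewrite setXT.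
Qed.

Lemma coupling_snd lam nu gamma : coupling lam nu gamma ->
  has_law gamma (fun z : Borel R d * Borel R d => z.2 : 'rV[R]_d) nu.
Proof.
move=> cg; split; first exact: measurable_snd.
by move=> A mA; have [_ <-] := cg A mA; congr (gamma _); rewrite setTX.
Qed.

Lemma ge0_integral_lincomb dd (Om : measurableType dd) (P : probability Om R)
    (f g : Om -> R) (a b : R) : measurable_fun setT f -> measurable_fun setT g ->
  (forall x, 0 <= f x) -> (forall x, 0 <= g x) -> 0 <= a -> 0 <= b ->
  (\int[P]_x (a * f x + b * g x)%:E =
   a%:E * \int[P]_x (f x)%:E + b%:E * \int[P]_x (g x)%:E)%E.
Proof.
move=> mf mg f0 g0 a0 b0; under eq_integral do rewrite EFinD !EFinM.
have mf' : measurable_fun setT (fun x => (f x)%:E) by exact/measurable_EFinP.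
have mg' : measurable_fun setT (fun x => (g x)%:E) by exact/measurable_EFinP.
rewrite ge0_integralD//; last 4 first.
- by move=> z _; rewrite mule_ge0 ?lee_fin.
- exact: measurable_funeM.
- by move=> z _; rewrite mule_ge0 ?lee_fin.
- exact: measurable_funeM.
by rewrite !ge0_integralZl//; move=> z _; rewrite lee_fin.
Qed.

Lemma law_negligible dd (Om : measurableType dd) (P : probability Om R)
    (X : Om -> 'rV[R]_d) lam B : has_law P X lam -> PP (cball B) lam ->
  P.-negligible [set w | ~ cball B (X w)].
Proof.
move=> [mX lX] lB; have mC : measurable (~` cball B : set (Borel R d)).
  by apply: measurableC; exact: measurable_cball.
exists (X @^-1` (~` cball B)); split => //.
  by rewrite -[X in measurable X]setTI; exact: mX.
by rewrite -[LHS]lX//; exact: PP_null.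
Qed.

Lemma bounded_integrable dd (Om : measurableType dd) (P : probability Om R)
    (g : Om -> R) (Z : R) : measurable_fun setT g -> (forall x, `|g x| <= Z) ->
  P.-integrable setT (EFin \o g).
Proof.
move=> mg gZ; apply: (@le_integrable _ _ _ P _ measurableT _ (cst Z%:E)) => //.
- exact/measurable_EFinP.
- by move=> x _ /=; rewrite lee_fin (le_trans (gZ x))// ler_norm.
- exact: finite_measure_integrable_cst.
Qed.

(** Along a Taylor field the first-order term only depends on the marginals,
    up to the cost of the plan; the remaining error is split by Young's
    inequality with weight [s]. *)
Lemma coupling_approx lam nu gamma B xi zeta g (Z C s e2 kappa : R) :
  PP (cball B) lam -> PP (cball B) nu -> coupling lam nu gamma ->
  measurable_fun setT (xi : Borel R d -> Borel R d) ->
  measurable_fun setT (zeta : Borel R d -> R) -> (forall x, `|zeta x| <= Z) ->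
  measurable_fun setT (g : Borel R d -> Borel R d) -> 0 <= C ->
  (forall x y, cball B x -> cball B y ->
    `|zeta y - zeta x - dotp (g x) (y - x)| <= C * enorm (y - x) ^+ 2) ->
  (\int[lam]_x (enorm (xi x - g x) ^+ 2)%:E <= e2%:E)%E ->
  (cost 2 gamma <= kappa%:E)%E -> 0 < s ->
  let E := (2 * s)^-1 * e2 + (s / 2 + C) * kappa in
  let A := fine (\int[nu]_x (zeta x)%:E) - fine (\int[lam]_x (zeta x)%:E) in
  let I := (\int[gamma]_z (dotp (xi z.1) ((z.2 : 'rV[R]_d) - z.1))%:E)%E in
  ((A - E)%:E <= I /\ I <= (A + E)%:E)%E.
Proof.
move=> lB nB cg mxi mz zZ mg C0 hC he hk s0 E A I.
have l1 := coupling_fst cg; have l2 := coupling_snd cg.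
have mu1 : measurable_fun setT (fun z : Borel R d * Borel R d => (z.1 : Borel R d)) by exact: measurable_fst.
have mu2 : measurable_fun setT (fun z : Borel R d * Borel R d => (z.2 : Borel R d)) by exact: measurable_snd.
have msub : measurable_fun setT ((fun z : Borel R d * Borel R d => (z.2 : 'rV[R]_d) - z.1) : Borel R d * Borel R d -> Borel R d).
  exact: measurable_subB.
pose F (z : Borel R d * Borel R d) : R := dotp (xi z.1) ((z.2 : 'rV[R]_d) - z.1).
have mF : measurable_fun setT F.
  by apply: measurable_dotp => //; exact: (measurableT_comp mxi).
have iz1 : gamma.-integrable setT (fun z : Borel R d * Borel R d => (zeta z.1)%:E).
  by apply: bounded_integrable (fun z => zZ z.1); exact: (measurableT_comp mz).
have iz2 : gamma.-integrable setT (fun z : Borel R d * Borel R d => (zeta z.2)%:E).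
  by apply: bounded_integrable (fun z => zZ z.2); exact: (measurableT_comp mz).
pose G (z : Borel R d * Borel R d) : R := zeta z.2 - zeta z.1.
have iG : gamma.-integrable setT (EFin \o G) by exact: (integrableB measurableT iz2 iz1).
have mG : measurable_fun setT G by apply/measurable_EFinP; exact: measurable_int iG.
have IG : (\int[gamma]_z (G z)%:E = A%:E)%E.
  rewrite (_ : (fun z => (G z)%:E) = (fun z : Borel R d * Borel R d => (zeta z.2)%:E - (zeta z.1)%:E)%E)//.
  rewrite integralB// /A.
  have -> : (\int[gamma]_z (zeta z.2)%:E = \int[nu]_x (zeta x)%:E)%E.
    by apply/esym/(integral_law l2 (g := fun x => (zeta x)%:E)) => //; exact/measurable_EFinP.
  have -> : (\int[gamma]_z (zeta z.1)%:E = \int[lam]_x (zeta x)%:E)%E.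
    by apply/esym/(integral_law l1 (g := fun x => (zeta x)%:E)) => //; exact/measurable_EFinP.
  rewrite EFinB !fineK//; apply: integrable_fin_num => //; exact: bounded_integrable.
pose H (z : Borel R d * Borel R d) : R := (2 * s)^-1 * enorm (xi z.1 - g z.1) ^+ 2 +
  (s / 2 + C) * enorm ((z.2 : 'rV[R]_d) - z.1) ^+ 2.
have s20 : 0 <= (2 * s)^-1 by rewrite invr_ge0 mulr_ge0// ltW.
have sC0 : 0 <= s / 2 + C by rewrite addr_ge0// divr_ge0// ltW.
have H0 z : 0 <= H z by rewrite addr_ge0// mulr_ge0// exprn_ge0// enorm_ge0.
have mxg : measurable_fun setT (fun x : Borel R d => enorm (xi x - g x) ^+ 2).
  by apply: measurable_funX; apply: measurable_enorm_comp; exact: measurable_subB.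
have mxg1 : measurable_fun setT (fun z : Borel R d * Borel R d => enorm (xi z.1 - g z.1) ^+ 2).
  by apply: (measurableT_comp mxg).
have mc2 : measurable_fun setT (fun z : Borel R d * Borel R d => enorm ((z.2 : 'rV[R]_d) - z.1) ^+ 2).
  by apply: measurable_funX; exact: measurable_enorm_comp.
have mH : measurable_fun setT H.
  by apply: measurable_funD; exact: measurable_funM.
have IH : (\int[gamma]_z (H z)%:E <= E%:E)%E.
  rewrite ge0_integral_lincomb//; last 2 first.
  - by move=> z; rewrite exprn_ge0// enorm_ge0.
  - by move=> z; rewrite exprn_ge0// enorm_ge0.
  have -> : E%:E = (((2 * s)^-1)%:E * e2%:E + (s / 2 + C)%:E * kappa%:E)%E.
    by rewrite -!EFinM -EFinD.
  apply: leeD; apply: lee_wpmul2l => //.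
  apply: le_trans he; rewrite le_eqVlt; apply/orP; left; apply/eqP/esym.
  apply: (ge0_integral_law l1 (g := fun x => (enorm (xi x - g x) ^+ 2)%:E)).
    exact/measurable_EFinP.
  by move=> x; rewrite lee_fin exprn_ge0// enorm_ge0.
have FGH : gamma.-negligible [set z : Borel R d * Borel R d | ~ `|F z - G z| <= H z].
  have n1 : gamma.-negligible [set z : Borel R d * Borel R d | ~ cball B (z.1 : 'rV[R]_d)].
    exact: law_negligible l1 lB.
  have n2 : gamma.-negligible [set z : Borel R d * Borel R d | ~ cball B (z.2 : 'rV[R]_d)].
    exact: law_negligible l2 nB.
  apply: negligibleS (negligibleU n1 n2) => z /= nH.
  have [b1|nb1] := pselect (cball B (z.1 : 'rV[R]_d)); last by left.
  have [b2|nb2] := pselect (cball B (z.2 : 'rV[R]_d)); last by right.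
  exfalso; apply: nH; have := hC _ _ b1 b2; rewrite /F /G /H.
  set u := (z.2 : 'rV[R]_d) - z.1 => h1.
  have h2 := dotp_le (xi z.1 - g z.1) u; rewrite dotpBl in h2.
  have y : enorm (xi z.1 - g z.1) * enorm u <=
      (2 * s)^-1 * enorm (xi z.1 - g z.1) ^+ 2 + s / 2 * enorm u ^+ 2.
    have : 0 <= (2 * s)^-1 * (enorm (xi z.1 - g z.1) - s * enorm u) ^+ 2.
      by rewrite mulr_ge0// sqr_ge0.
    have -> : (2 * s)^-1 * (enorm (xi z.1 - g z.1) - s * enorm u) ^+ 2 =
      (2 * s)^-1 * enorm (xi z.1 - g z.1) ^+ 2 + s / 2 * enorm u ^+ 2
      - enorm (xi z.1 - g z.1) * enorm u.
      by field; rewrite gt_eqF.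
    lra.
  have := ler_normD (dotp (xi z.1) u - dotp (g z.1) u)
    (- (zeta z.2 - zeta z.1 - dotp (g z.1) u)).
  rewrite normrN.
  have -> : dotp (xi z.1) u - dotp (g z.1) u - (zeta z.2 - zeta z.1 - dotp (g z.1) u) =
    dotp (xi z.1) u - (zeta z.2 - zeta z.1) by ring.
  move=> /le_trans; apply; rewrite [(s / 2 + C) * _]mulrDl addrA.
  by apply: lerD => //; exact: le_trans h2 y.
pose D (z : Borel R d * Borel R d) := F z - G z.
have mD : measurable_fun setT D by apply: measurable_funB.
have ID : (\int[gamma]_z `|(D z)%:E| <= E%:E)%E.
  apply: le_trans IH; apply: ae_ge0_le_integral => //.
  - by apply: measurableT_comp => //; exact/measurable_EFinP.
  - by move=> z _; rewrite lee_fin.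
  - exact/measurable_EFinP.
  - by apply: negligibleS FGH => z /= h1 h2; apply: h1 => _; rewrite lee_fin.
have iD : gamma.-integrable setT (EFin \o D).
  apply/integrableP; split; first exact/measurable_EFinP.
  by apply: le_lt_trans ID _; rewrite ltry.
have IE : (I = A%:E + \int[gamma]_z (D z)%:E)%E.
  rewrite -IG -integralD//; apply: eq_integral => z _.
  by rewrite -EFinD /D [G z + _]addrC subrK.
have fD := integrable_fin_num measurableT iD.
have := le_trans (le_abse_integral gamma measurableT (measurable_int _ iD)) ID.
rewrite IE -(fineK fD) -EFinD !lee_fin ler_norml => /andP[h1 h2].
by split; rewrite lerD2l.
Qed.

End Transport.

(** A plan that is produced by a perturbation of the identity need not be
    optimal; comparing it with optimal plans through [coupling_approx] shows
    that the first-order term is nevertheless the one that it computes. *)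
Section DirectionalDerivative.
Context {R : realType} {d : nat}.
Variables (r : R) (mu : Pc R d).
Notation K := (cball r : set 'rV[R]_d).
Hypothesis muK : PP K mu.
Variables (f w : 'rV[R]_d -> 'rV[R]_d) (B M : R).
Hypotheses (uf : ucont r f) (uw : ucont r w).
Hypotheses (B0 : 0 <= B) (M0 : 0 <= M).
Hypothesis fB : forall x, K x -> enorm (f x) + M <= B.
Hypothesis wM : forall x, K x -> enorm (w x) <= M.

Let lam := push K f mu.
Let fh h x := f x + h *: w x.
Let nu h := push K (fh h) mu.

Let ufh h : ucont r (fh h).
Proof.
have := ucont_lincomb 1 h uf uw.
by rewrite (_ : (fun x => 1 *: f x + h *: w x) = fh h)//; apply/funext => x; rewrite scale1r.
Qed.

Let lamB : PP (cball B) lam.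
Proof.
by apply: push_PP => // x Kx; rewrite /cball /= (le_trans _ (fB Kx))// lerDl.
Qed.

Let nuB h : `|h| <= 1 -> PP (cball B) (nu h).
Proof.
move=> h1; apply: push_PP => // x Kx; rewrite /cball /= /fh.
apply: le_trans (enormD _ _) _; rewrite enormZ; have := fB Kx; have := wM Kx.
by have := enorm_ge0 (w x); nra.
Qed.

(** The points [f x + h w x] are close to [f x], which lies in the support of
    the image under [f]. The radius M + 1 is positive even for M = 0. *)
Lemma fattening_push h : `|h| <= 1 -> PP (fattening (M + 1) lam) (nu h).
Proof.
move=> h1; have sK := muK.
have csupp : compact (fh h @` supp mu).
  apply: continuous_compact; last exact: Pc_compact.
  by apply: continuous_subspaceW sK _; exact: ucont_within.
have mI : measurable (fh h @` supp mu : set (Borel R d)).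
  by apply: measurable_closedB; apply: compact_closed csupp; exact: norm_hausdorff.
have := @full_supp_sub R d (nu h) (fh h @` supp mu) (compact_closed (@norm_hausdorff _ _) csupp).
have mC : measurable (clip r (fh h) @^-1` (fh h @` supp mu) : set (Borel R d)).
  by rewrite -[X in measurable X]setTI; exact: (measurable_clip (ufh h)).
have msupp : measurable (supp mu : set (Borel R d)).
  by apply: measurable_closedB; exact: supp_closed.
move=> /(_ _)/wrap[].
  have [_ ->//] := push_law muK (ufh h).
  apply/eqP; rewrite eq_le probability_le1//=.
  have [<- _] := supp_sub_full msupp (@subset_refl _ (supp mu)).
  apply: le_measure; rewrite ?inE// => x sx; exists x => //.
  by rewrite clipE//; exact: sK.
move=> H y /H[x sx <-]; exists (f x); last first.
  rewrite /fh addrC addKr enormZ; have := wM (sK _ sx); have := enorm_ge0 (w x).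
  by have := normr_ge0 h; nra.
move=> U oU Ufx; have [_ ->] := push_law muK uf; last exact: measurable_openB.
have /nbhs_enormP[e e0 eU] : nbhs (f x) U by exact: open_nbhs_nbhs.
have [de d0 Hd] := uf e0.
have Kx := sK _ sx.
pose V : set 'rV[R]_d := [set z | enorm (z - x) < de].
have oV : open V.
  rewrite openE => z; rewrite /V /= => zx; apply/nbhs_enormP.
  exists (de - enorm (z - x)); first by rewrite subr_gt0.
  by move=> y' yz; have := enorm_trans z y' x; rewrite /V /=; lra.
have := sx V oV; rewrite /V /= subrr enorm0 => /(_ d0).
move=> /lt_le_trans; apply.
have mV : measurable (V : set (Borel R d)) by exact: measurable_openB.
have mK := @measurable_cball R d r.
have mN : measurable (V `&` ~` K : set (Borel R d)).
  by apply: measurableI => //; exact: measurableC.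
have VK0 : mu (V `&` ~` K : set (Borel R d)) = 0%E.
  apply/eqP; rewrite eq_le measure_ge0 andbT -(PP_null muK).
  by apply: le_measure; rewrite ?inE//; exact: measurableC.
rewrite -/V (_ : V = (V `&` K) `|` (V `&` ~` K)); last by rewrite -setIUr setUv setIT.
rewrite measureU0//; last exact: measurableI.
apply: le_measure; rewrite ?inE//; first exact: measurableI.
  by rewrite -[X in measurable X]setTI; apply: (measurable_clip uf) => //; exact: measurable_openB.
by move=> z [Vz Kz] /=; rewrite clipE//; apply: eU; exact: Hd.
Qed.

Let J (xi : 'rV[R]_d -> 'rV[R]_d) (x : Borel R d) : R := dotp (xi (clip r f x)) (clip r w x).

Lemma integral_J xi :
  (\int[mu]_(y in K) (dotp (xi (f y)) (w y))%:E = \int[mu]_y (J xi y)%:E)%E.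
Proof.
rewrite integral_mkcond; apply: eq_integral => y _; rewrite patchE.
case: ifPn; rewrite ?inE ?notin_setE /= => Ky; first by rewrite /J !clipE.
rewrite /J [clip r w y]/clip; case: ifPn => [//|_].
by rewrite /dotp big1// => i _; rewrite mxE mulr0.
Qed.

Lemma clip_w x : enorm (clip r w x) <= M.
Proof. by rewrite /clip; case: ifPn => [/wM//|_]; rewrite enorm0. Qed.

Lemma integrable_J xi : L2 lam xi -> mu.-integrable setT (EFin \o J xi).
Proof.
move=> [mxi ixi].
have mJ : measurable_fun setT (J xi).
  apply: measurable_dotp; last exact: measurable_clip.
  by apply: (measurableT_comp mxi); exact: measurable_clip.
have mx2 : measurable_fun setT (fun x : Borel R d => enorm (xi x) ^+ 2).
  by apply: measurable_funX; exact: measurable_enorm_comp.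
have mx2' : measurable_fun setT (fun x : Borel R d => enorm (xi (clip r f x)) ^+ 2).
  by apply: (measurableT_comp mx2); exact: measurable_clip.
apply/integrableP; split; first exact/measurable_EFinP.
apply: (@le_lt_trans _ _ (\int[mu]_x (M * cst 1 x + M * (enorm (xi (clip r f x)) ^+ 2))%:E)%E).
  apply: ge0_le_integral => //.
  - by apply/measurable_EFinP; exact: measurableT_comp.
  - by apply/measurable_EFinP; apply: measurable_funD; apply: measurable_funM.
  move=> x _; rewrite lee_fin; apply: le_trans (dotp_le _ _) _.
  have := enorm_ge0 (xi (clip r f x)); have := clip_w x; have := enorm_ge0 (clip r w x).
  set a := enorm (xi _); set b := enorm (clip _ _ _); rewrite /cst => b0 bM a0.
  apply: (@le_trans _ _ (a * M)); first by rewrite ler_wpM2l.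
  by have := sqr_ge0 (a - 1); nra.
rewrite ge0_integral_lincomb//; last by move=> x; rewrite exprn_ge0// enorm_ge0.
apply: lte_add_pinfty.
  have -> : (\int[mu]_x (cst 1 x)%:E)%E = 1%E := integral_cst_probability mu 1.
  by rewrite mule1 ltry.
have -> : (\int[mu]_x (enorm (xi (clip r f x)) ^+ 2)%:E = \int[lam]_x (enorm (xi x) ^+ 2)%:E)%E.
  apply/esym/(ge0_integral_law (push_law muK uf) (g := fun x => (enorm (xi x) ^+ 2)%:E)).
    exact/measurable_EFinP.
  by move=> x; rewrite lee_fin exprn_ge0// enorm_ge0.
by apply: lte_mul_pinfty.
Qed.


(** The subdifferential bounds [phi] below by an infimum over optimal plans,
    which are not explicit. The plan that moves [f x] to [f x + h w x] has a
    cost of order h^2, hence so has any optimal plan, and by [coupling_approx]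
    the first-order terms of all these plans agree up to o(h). *)
Lemma subdiff_lower (phi : Pc R d -> R) xi : subdiff phi lam xi ->
  taylor_approximable lam B xi ->
  forall e, 0 < e -> exists2 delta, 0 < delta & forall h, `|h| < delta ->
    h * (\int[mu]_(y in K) dotp (xi (f y)) (w y)) - e * `|h| <= phi (nu h) - phi lam.
Proof.
move=> [L2xi hsub] tay e e0.
pose D := \int[mu]_(y in K) dotp (xi (f y)) (w y).
have iJ := integrable_J L2xi.
have DE : (\int[mu]_y (J xi y)%:E = D%:E)%E.
  by rewrite -integral_J fineK// integral_J; exact: integrable_fin_num.
pose e' := e / (4 * (M + 1)).
have e'0 : 0 < e' by rewrite divr_gt0// mulr_gt0// ltr_wpDl.
pose ep := e / (4 * (1 + M ^+ 2)).
have ep0 : 0 < ep by rewrite divr_gt0// mulr_gt0// ltr_pwDl// exprn_ge0.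
have [zeta [g [Z [C [[mz zZ] mg [C0 hC] he]]]]] := tay _ ep0.
have M10 : 0 < M + 1 by rewrite ltr_wpDl.
have [d1 d10 Hd1] := hsub _ M10 _ e'0.
pose de := Num.min 1 (Num.min (d1 / (M + 1)) (e / (8 * (C * M ^+ 2 + 1)))).
have CM0 : 0 <= C * M ^+ 2 by rewrite mulr_ge0// exprn_ge0.
have de0 : 0 < de.
  rewrite !lt_min ltr01 !divr_gt0//; first by rewrite mulr_gt0// ltr_wpDl.
exists de => // h; rewrite !lt_min => /andP[h1 /andP[h2 h3]].
have [->|h0] := eqVneq h 0.
  rewrite mul0r normr0 mulr0 subrr.
  by rewrite /nu /fh (_ : (fun x => _) = f) ?subrr//; apply/funext => x; rewrite scale0r addr0.
have nh0 : 0 < `|h| by rewrite normr_gt0.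
have [gh [cgh cgh0 cghi]] := coupling_of_laws (push_law muK uf) (push_law muK (ufh h)).
pose kappa := (`|h| * M) ^+ 2.
have clipfh x : clip r (fh h) x - clip r f x = h *: clip r w x.
  by rewrite /clip; case: ifPn => _; rewrite ?subrr ?scaler0// /fh addrC addKr.
have costh : (cost 2 gh <= kappa%:E)%E.
  rewrite /cost cgh0//; [|exact: measurable_cost|].
    rewrite -(integral_cst_probability mu kappa); apply: ge0_le_integral => //.
    - by move=> x _; rewrite lee_fin exprn_ge0// enorm_ge0.
    - apply/measurable_EFinP; apply: measurable_funX; apply: measurable_enorm_comp.
      by apply: measurable_subB; exact: measurable_clip.
    - move=> x _; rewrite lee_fin /= clipfh enormZ /kappa.
      by rewrite lerXn2r ?nnegrE ?mulr_ge0 ?enorm_ge0// ler_wpM2l// clip_w.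
  by move=> z; rewrite lee_fin exprn_ge0// enorm_ge0.
have h1' : `|h| <= 1 by exact: ltW.
have W2 : W 2 lam (nu h) <= `|h| * M.
  rewrite /W; have hinf : (ereal_inf [set cost 2 g | g in coupling lam (nu h)] <= kappa%:E)%E.
    by apply: ge_ereal_inf; exists (cost 2 gh) => //; exists gh.
  have := inf_cost_ge0 2 lam (nu h).
  move: hinf; case: ereal_inf => //= c; rewrite !lee_fin => ck c0.
  rewrite powR12_sqrt// -(ger0_norm (mulr_ge0 (normr_ge0 h) M0)) -sqrtr_sqr.
  by rewrite ler_wsqrtr.
have W2d : W 2 lam (nu h) < d1.
  apply: le_lt_trans W2 _; apply: le_lt_trans (_ : `|h| * (M + 1) < _).
    by rewrite ler_wpM2l// lerDl.
  by rewrite -ltr_pdivlMr.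
have := Hd1 (nu h) (fattening_push h1') W2d.
(* with this weight both error terms are of order ep |h| when the cost is of
   order h^2 *)
pose s := ep / `|h|; have s0 : 0 < s by rewrite divr_gt0.
pose E := (2 * s)^-1 * ep ^+ 2 + (s / 2 + C) * kappa.
have [mxi _] := L2xi.
have app gamma (cg : coupling lam (nu h) gamma) (cc : (cost 2 gamma <= kappa%:E)%E) :=
  coupling_approx lamB (nuB h1') cg mxi mz zZ mg C0 hC he cc s0.
pose A := fine (\int[nu h]_x (zeta x)%:E) - fine (\int[lam]_x (zeta x)%:E).
have hDA : h * D <= A + E.
  have [_] := app _ cgh costh; rewrite cghi.
  - rewrite (_ : (\int[mu]_w _)%E = (h * D)%:E) ?lee_fin//.
    rewrite EFinM -DE -integralZl//; apply: eq_integral => x _ /=.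
    by rewrite clipfh dotpZr.
  - apply/measurable_EFinP; apply: measurable_dotp.
      by apply: (measurableT_comp mxi); exact: measurable_fst.
    by apply: measurable_subB; [exact: measurable_snd|exact: measurable_fst].
  - rewrite (_ : (fun w => _) = (fun x => h%:E * (J xi x)%:E)%E); first exact: integrableZl.
    by apply/funext => x /=; rewrite clipfh dotpZr.
have inf_ge : ((h * D - 2 * E)%:E <= ereal_inf [set \int[gamma]_z
    (dotp (xi z.1) ((z.2 : 'rV[R]_d) - z.1))%:E | gamma in Gamma_o lam (nu h)])%E.
  apply: le_ereal_inf_tmp => _ [gamma [cg og] <-].
  have [ge _] := app _ cg (le_trans (og _ cgh) costh).
  apply: le_trans ge; rewrite lee_fin -/A -/E.
  by rewrite mulr_natl mulr2n opprD addrA lerD2r lerBlDr.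
have EE : 2 * E <= (e / 2) * `|h|.
  have -> : 2 * E = `|h| * (ep * (1 + M ^+ 2)) + 2 * C * M ^+ 2 * `|h| * `|h|.
    by rewrite /E /s /kappa; field; rewrite !gt_eqF.
  have -> : ep * (1 + M ^+ 2) = e / 4.
    by rewrite /ep; field; rewrite gt_eqF// ltr_pwDl// exprn_ge0.
  have : C * M ^+ 2 * `|h| <= e / 8.
    move: h3; rewrite ltr_pdivlMr ?mulr_gt0 ?ltr_wpDl// => h3.
    rewrite ler_pdivlMr//; apply: ltW; apply: le_lt_trans h3.
    have -> : C * M ^+ 2 * `|h| * 8 = `|h| * (8 * (C * M ^+ 2)) by ring.
    by rewrite ler_wpM2l// ler_wpM2l// lerDl.
  have -> : 2 * C * M ^+ 2 * `|h| * `|h| = 2 * (C * M ^+ 2 * `|h|) * `|h| by ring.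
  move=> hc; rewrite mulrC -mulrDl ler_wpM2r//.
  have -> : e / 2 = e / 4 + 2 * (e / 8) by field.
  by rewrite lerD2l ler_wpM2l.
have WE : e' * W 2 lam (nu h) <= e / 4 * `|h|.
  apply: le_trans (ler_wpM2l (ltW e'0) W2) _.
  rewrite /e' mulrCA [leRHS]mulrC ler_wpM2l//.
  rewrite mulrAC ler_pdivrMr ?mulr_gt0//.
  have -> : e / 4 * (4 * (M + 1)) = e * (M + 1) by field.
  by rewrite ler_wpM2l ?(ltW e0)// lerDl.
move=> hs; rewrite -lee_fin; apply: le_trans hs; rewrite EFinB.
apply: (@le_trans _ _ ((h * D - 2 * E)%:E - (e' * W 2 lam (nu h))%:E)%E).
  rewrite -!EFinB lee_fin -/D.
  rewrite -addrA lerD2l -opprD lerN2; apply: le_trans (lerD EE WE) _.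
  rewrite -mulrDl ler_wpM2r//; have -> : e / 2 + e / 4 = e - e / 4 by field.
  by rewrite gerBl divr_ge0// ltW.
by apply: leeB.
Qed.

(** The chain rule for local gradients: the lower bound comes from the
    subdifferential of [phi], and the upper bound from that of [- phi]. *)
Lemma gradient_expansion (phi : Pc R d -> R) xi : is_gradient phi lam xi ->
  expands (fun h => phi (nu h)) 0 (\int[mu]_(y in K) dotp (xi (f y)) (w y)).
Proof.
move=> [Txi /(_ xi Txi)[_ H]] e e0.
have [|sub sup] := H; first by apply/aeW.
have tay : taylor_approximable lam B xi := Tan_taylor B0 lamB Txi.
have [d1 d10 H1] := subdiff_lower sub tay e0.
have [d2 d20 H2] := subdiff_lower sup (taylor_approximableN tay) e0.
exists (Num.min d1 d2); first by rewrite lt_min d10.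
move=> h; rewrite lt_min add0r => /andP[/H1 h1 /H2 h2].
have n0 : nu 0 = lam.
  by rewrite /nu /fh (_ : (fun x => _) = f)//; apply/funext => x; rewrite scale0r addr0.
rewrite n0 ler_norml.
have iJ := integrable_J Txi.1.
have E : \int[mu]_(y in K) dotp (- xi (f y)) (w y) =
    - \int[mu]_(y in K) dotp (xi (f y)) (w y).
  rewrite /Rintegral (integral_J (fun x => - xi x)) integral_J.
  under eq_integral do rewrite /J dotpNl EFinN.
  by rewrite integralN ?fineN//; apply: integrable_add_def.
rewrite E in h2; apply/andP; split; lra.
Qed.

End DirectionalDerivative.

(** * Encoding points of R^N by reals *)

(** Base-4 expansions with digits 0 and 1: the gap left by the missing digits
    makes the digits continuous functions of the sum. *)
Section DigitSums.
Context {R : realType}.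
Implicit Types (b : nat -> bool) (y : R).

Definition weight (j : nat) : R := (4 ^+ j.+1)^-1.

Lemma weight_gt0 j : 0 < weight j.
Proof. by rewrite invr_gt0 exprn_gt0. Qed.

Lemma weightS j : weight j = 4 * weight j.+1.
Proof. by rewrite /weight [in RHS]exprS invfM mulrA divff// mul1r. Qed.

Lemma weight_le i j : (i <= j)%N -> weight j <= weight i.
Proof.
elim: j => [|j IH]; first by rewrite leqn0 => /eqP ->.
rewrite leq_eqVlt => /predU1P[->//|/IH h]; apply: le_trans h.
by rewrite (weightS j); have := weight_gt0 j.+1; lra.
Qed.

Definition digit_psum b (n : nat) : R := \sum_(j < n) (b j)%:R * weight j.

Lemma digit_psumS b n : digit_psum b n.+1 = digit_psum b n + (b n)%:R * weight n.
Proof. by rewrite /digit_psum big_ord_recr. Qed.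

Lemma digit_psum_nd b : nondecreasing_seq (digit_psum b).
Proof.
apply/nondecreasing_seqP => n; rewrite digit_psumS lerDl mulr_ge0//.
exact/ltW/weight_gt0.
Qed.

Lemma digit_psum_tail b n m : (n <= m)%N ->
  digit_psum b m <= digit_psum b n + 4 * weight n / 3.
Proof.
move=> nm; suff : digit_psum b m + 4 * weight m / 3 <= digit_psum b n + 4 * weight n / 3.
  by have := weight_gt0 m; lra.
elim: m nm => [|m IH]; first by rewrite leqn0 => /eqP ->.
rewrite leq_eqVlt => /predU1P[->//|/IH h]; apply: le_trans h.
rewrite digit_psumS (weightS m); have := weight_gt0 m.+1.
by case: (b m) => /=; lra.
Qed.

Definition digit_sum b : R := limn (digit_psum b).

Lemma digit_psum_cvg b : digit_psum b @ \oo --> digit_sum b.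
Proof.
apply: nondecreasing_is_cvgn; first exact: digit_psum_nd.
by exists (digit_psum b 0 + 4 * weight 0 / 3) => _ [n _ <-]; exact: digit_psum_tail.
Qed.

Lemma digit_sum_ge b n : digit_psum b n <= digit_sum b.
Proof.
apply: nondecreasing_cvgn_le; first exact: digit_psum_nd.
by apply/cvg_ex; exists (digit_sum b); exact: digit_psum_cvg.
Qed.

Lemma digit_sum_le b n : digit_sum b <= digit_psum b n + 4 * weight n / 3.
Proof.
apply: limr_le; first by apply/cvg_ex; exists (digit_sum b); exact: digit_psum_cvg.
by near=> m; apply: digit_psum_tail; near: m; exact: nbhs_infty_ge.
Unshelve. all: by end_near. Qed.

Lemma digit_sum_01 b : 0 <= digit_sum b <= 1.
Proof.
have := digit_sum_ge b 0; have := digit_sum_le b 0.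
rewrite /digit_psum big_ord0 /weight expr1 => h1 h2; apply/andP; split=> //.
by apply: le_trans h1 _; lra.
Qed.

Fixpoint remainder (n : nat) (y : R) : R :=
  if n is m.+1 then
    remainder m y - (if weight m <= remainder m y then weight m else 0)
  else y.

Definition digit (n : nat) (y : R) : bool := weight n <= remainder n y.

Lemma digit_sumK b n :
  remainder n (digit_sum b) = digit_sum b - digit_psum b n /\
  digit n (digit_sum b) = b n.
Proof.
have step m : remainder m (digit_sum b) = digit_sum b - digit_psum b m ->
    digit m (digit_sum b) = b m.
  move=> E; rewrite /digit E.
  have := digit_sum_ge b m.+1; have := digit_sum_le b m.+1.
  rewrite digit_psumS; have := weight_gt0 m.+1; have := weightS m.
  case: (b m) => /= ? ? ? ?; first by lra.
  by apply/negbTE; rewrite -ltNge; lra.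
suff h : remainder n (digit_sum b) = digit_sum b - digit_psum b n.
  by split=> //; exact: step.
elim: n => [|n IH] /=; first by rewrite /digit_psum big_ord0 subr0.
rewrite -/(digit n (digit_sum b)) step// IH digit_psumS.
by case: (b n); rewrite /= ?mul1r ?mul0r; ring.
Qed.

Lemma measurable_digit n : measurable_fun setT (digit n).
Proof.
have mr : measurable_fun setT (remainder n).
  elim: n => [|n IH] /=; first exact: measurable_id.
  apply: measurable_funB => //; apply: measurable_fun_ifT => //.
  exact: measurable_fun_ler.
exact: measurable_fun_ler.
Qed.

Lemma digit_sum_close b c n : `|digit_sum b - digit_sum c| < weight n / 2 ->
  forall j, (j <= n)%N -> b j = c j.
Proof.
move=> bc; elim/ltn_ind => j IH jn.
have E : digit_psum b j = digit_psum c j.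
  by apply: eq_bigr => i _; rewrite IH// (leq_trans (ltnW (ltn_ord i))).
have := weight_le jn; have := weight_gt0 j.+1; have := weightS j.
have := digit_sum_ge b j.+1; have := digit_sum_le b j.+1.
have := digit_sum_ge c j.+1; have := digit_sum_le c j.+1.
rewrite !digit_psumS E; move: bc; rewrite ltr_norml => /andP[].
by case: (b j); case: (c j) => //= *; exfalso; lra.
Qed.

End DigitSums.

(** The digits of the code of a point tell which rational half-spaces
    contain it. *)
Section Code.
Context {R : realType} {N : nat}.
Implicit Types x : 'rV[R]_N.

Definition halfspace x (j : nat) : bool :=
  if unpickle j is Some iq then x 0 (iq : 'I_N * rat).1 < ratr iq.2 else false.

Definition code x : R := digit_sum (halfspace x).

Lemma measurable_code : measurable_fun setT (code : Borel R N -> R).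
Proof.
apply: (@measurable_fun_cvg _ (Borel R N) R setT (fun m x => digit_psum (halfspace x) m)).
  move=> m; rewrite /digit_psum; apply: measurable_sum => j.
  apply: measurable_funM => //.
  rewrite (_ : (fun x => _) = (fun x : Borel R N => if halfspace x j then 1 else 0)); last first.
    by apply/funext => x; case: halfspace.
  apply: measurable_fun_ifT => //; rewrite /halfspace.
  case: unpickle => [[i q]|] //=.
  by apply: measurable_fun_ltr => //; exact: measurable_coord.
by move=> x _; exact: digit_psum_cvg.
Qed.

Variable n0 : nat.

(** A coordinate is the infimum of the rationals above it. The values are kept
    above - n0, which makes the infimum exist for any [y]; rationals that are
    not above the coordinate contribute n0. *)
Definition decode_seq (i : 'I_N) (j : nat) (y : R) : R :=
  if unpickle j is Some iq then
    if (iq.1 == i) && digit j y then Num.max (ratr iq.2) (- n0%:R) else n0%:R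
  else n0%:R.

Definition decode (y : R) : 'rV[R]_N := \row_i infs (decode_seq i ^~ y) 0.

Lemma decode_seq_lb i y : has_lbound (range (decode_seq i ^~ y)).
Proof.
exists (- n0%:R) => _ [j _ <-]; rewrite /decode_seq.
have h : - n0%:R <= n0%:R :> R by rewrite (@le_trans _ _ 0)// oppr_le0.
case: unpickle => [[i' q]|] //; case: ifP => // _.
by rewrite le_max lexx orbT.
Qed.

Lemma measurable_decode : measurable_fun setT (decode : R -> Borel R N).
Proof.
apply: measurable_fun_rowP => // i.
rewrite (_ : (fun t => _) = (fun y => infs (decode_seq i ^~ y) 0)); last first.
  by apply/funext => y; rewrite mxE.
apply: measurable_fun_infs; first by move=> y _; exact: decode_seq_lb.
move=> j; rewrite /decode_seq; case: unpickle => [[i' q]|] //=.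
case: eqP => //= _; apply: measurable_fun_ifT => //; exact: measurable_digit.
Qed.

Lemma codeK x : (forall i, `|x 0 i| <= n0%:R) -> decode (code x) = x.
Proof.
move=> xn; apply/rowP => i; rewrite mxE /infs /=.
have := xn i; rewrite ler_norml => /andP[xl xu].
set S := sdrop _ _.
have Sx : lbound S (x 0 i).
  move=> _ [j _ <-]; rewrite /decode_seq; case E: unpickle => [[i' q]|] //=.
  case: eqP => //= ii'; rewrite (digit_sumK (halfspace x) j).2 /halfspace E /= ii'.
  by case: ifP => // /ltW h; rewrite le_max h.
have S0 : S !=set0 by exists (decode_seq i 0 (code x)); exists 0%N.
apply/eqP; rewrite eq_le; apply/andP; split; last exact: lb_le_inf.
apply/ler_addgt0Pr => e e0.
have [q] := @rat_in_itvoo R (x 0 i) (x 0 i + e) ltac:(rewrite ltrDl//).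
rewrite in_itv /= => /andP[xq qe].
have Sq : S (ratr q).
  exists (pickle (i, q)) => //; rewrite /decode_seq pickleK /= eqxx /=.
  rewrite (digit_sumK (halfspace x) _).2 /halfspace pickleK /= xq.
  by apply/max_idPl; rewrite (le_trans xl)// ltW.
apply: le_trans (ltW qe); apply: ge_inf => //; by exists (x 0 i).
Qed.

End Code.

(** * Subsequences *)

Section Subsequences.
Context {R : realType}.

Definition extraction (phi : nat -> nat) : Prop :=
  forall m n, (m < n)%N -> (phi m < phi n)%N.

Lemma increasing_extraction (f : nat -> nat) : increasing_seq f -> extraction f.
Proof.
by move=> fi m n; rewrite !ltnNge; apply: contra; have := fi n m; rewrite !leEnat => ->.
Qed.

Lemma extraction_ge f : extraction f -> forall n, (n <= f n)%N.
Proof. by move=> fi; elim=> [//|n IH]; apply: leq_ltn_trans IH (fi _ _ _). Qed.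

Lemma extraction_comp f g : extraction f -> extraction g -> extraction (f \o g).
Proof. by move=> hf hg m n mn; apply: hf; exact: hg. Qed.

Lemma bounded_extraction (u : nat -> R) (M : R) : (forall n, `|u n| <= M) ->
  exists2 f, extraction f & cvgn (u \o f).
Proof.
move=> uM; have [|g gi cg] := bolzano_weierstrass (u_ := u).
  exists M; split; first exact: num_real.
  by move=> x Mx n _; exact: le_trans (uM _) (ltW Mx).
by exists g => //; exact: increasing_extraction.
Qed.

Lemma diagonal_subsequence (a : nat -> nat -> R) (M : R) :
  (forall n k, `|a n k| <= M) ->
  exists2 phi : nat -> nat, extraction phi & forall k, cvgn (fun n => a (phi n) k).
Proof.
move=> aM.
pose good (k : nat) (f : nat -> nat) := extraction f /\
  forall j, (j < k)%N -> cvgn (fun n => a (f n) j).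
have step k f : extraction f -> exists g : nat -> nat, extraction g /\
    cvgn (fun n => a (f (g n)) k).
  by move=> fi; have [g gi cg] := bounded_extraction (fun n => aM (f n) k); exists g.
pose nxt (kf : nat * (nat -> nat)) : nat -> nat :=
  match pselect (extraction kf.2) with
  | left h => projT1 (cid (step kf.1 kf.2 h)) | right _ => id end.
have nxtP k f : extraction f -> extraction (nxt (k, f)) /\
    cvgn (fun n => a (f (nxt (k, f) n)) k).
  by move=> fi; rewrite /nxt; case: pselect => // h; case: cid.
pose F := fix F (k : nat) : nat -> nat :=
  if k is k'.+1 then F k' \o nxt (k', F k') else id.
have Fi k : extraction (F k).
  elim: k => [//|k IH] /=; apply: extraction_comp => //.
  by have [] := nxtP k _ IH.
have Fc k : cvgn (fun n => a (F k.+1 n) k) by have [] := nxtP k _ (Fi k).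
have Fsub k m : exists2 h, extraction h & F (k + m)%N = F k \o h.
  elim: m => [|m [h hi E]]; first by exists id => //; rewrite addn0.
  exists (h \o nxt ((k + m)%N, F (k + m)%N)); last by rewrite addnS /= {1}E.
  by apply: extraction_comp => //; exact: (nxtP (k + m)%N _ (Fi (k + m)%N)).1.
pose phi n := F n n.
exists phi.
  have phiS n : (phi n < phi n.+1)%N.
    by apply: (Fi n); apply: (@leq_trans n.+1) => //; apply: extraction_ge; case: (nxtP n _ (Fi n)).
  move=> m n; elim: n => [//|n IH]; rewrite ltnS leq_eqVlt => /predU1P[->//|/IH h].
  exact: ltn_trans h _.
move=> k; have /cvg_ex[l Fl] := Fc k; apply/cvg_ex; exists l.
apply/cvgrPdist_lt => e e0; move/cvgrPdist_lt/(_ e e0): Fl => -[n0 _ H].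
exists (maxn n0 k.+1) => // n /=; rewrite geq_max => /andP[n0n kn].
have [h hi E] := Fsub k.+1 (n - k.+1)%N.
rewrite /phi -{1}(subnKC kn) E; apply: H => /=.
exact: leq_trans n0n (extraction_ge hi n).
Qed.

(** Helly's selection theorem. A diagonal subsequence converges at the
    rationals; monotonicity gives convergence at any point across which the
    limit on the rationals does not jump, and distinct jumps contain distinct
    rationals, so they are countably many. *)
Lemma helly (Q : nat -> R -> R) :
  (forall n u v, 0 < u -> u <= v -> v < 1 -> Q n u <= Q n v) ->
  (forall n u, 0 <= Q n u <= 1) ->
  exists phi : nat -> nat, extraction phi /\
    exists bad : set R, countable bad /\
    forall u, 0 < u < 1 -> ~ bad u -> cvgn (fun n => Q (phi n) u).
Proof.
move=> Qnd Q01.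
pose a n k : R := if unpickle k is Some q then Q n (ratr (q : rat)) else 0.
have [n k|phi phii phic] := @diagonal_subsequence a 1.
  rewrite /a; case: unpickle => [q|]; last by rewrite normr0.
  by have /andP[h0 h1] := Q01 n (ratr q); rewrite ger0_norm.
have Qc (q : rat) : cvgn (fun n => Q (phi n) (ratr q)).
  have := phic (pickle q); rewrite /a pickleK; exact.
pose G (q : rat) := limn (fun n => Q (phi n) (ratr q)).
have GQ q : (fun n => Q (phi n) (ratr q)) @ \oo --> G q by exact: Qc.
exists phi; split => //.
pose gap (u : R) (r : rat) := (forall q : rat, 0 < ratr q :> R -> ratr q < u -> G q < ratr r) /\
  (forall q : rat, u < ratr q -> ratr q < 1 :> R -> ratr r < G q).
pose bad := [set u : R | 0 < u < 1 /\ exists r, gap u r].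
exists bad; split.
  pose f u : rat := if pselect (exists r, gap u r) is left h then projT1 (cid h) else 0.
  apply/pcard_injP; exists (pickle \o f) => // u v.
  rewrite !inE /= => -[u01 hu] [v01 hv] /(pcan_inj pickleK).
  rewrite /f; case: pselect => // hu'; case: pselect => // hv'.
  case: cid => ru [u1 u2]; case: cid => rv [v1 v2] /= E.
  rewrite -{}E in v1 v2.
  move: u01 v01 => /andP[u0 u1'] /andP[v0 v1'].
  apply/eqP; case: ltgtP => // uv; exfalso; have [q] := rat_in_itvoo uv;
    rewrite in_itv /= => /andP[uq qv].
    have := lt_trans (u2 q uq (lt_trans qv v1')) (v1 q (lt_trans u0 uq) qv).
    by rewrite ltxx.
  have := lt_trans (v2 q uq (lt_trans qv u1')) (u1 q (lt_trans v0 uq) qv).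
  by rewrite ltxx.
move=> u u01 nbad; move: (u01) => /andP[u0 u1].
have Gle (p q : rat) : 0 < ratr p :> R -> ratr p < u -> u < ratr q -> ratr q < 1 :> R ->
    G p <= G q.
  move=> p0 pu uq q1; apply: ler_lim; [exact: Qc|exact: Qc|].
  by apply: nearW => n; apply: Qnd => //; exact: ltW (lt_trans pu uq).
pose S := [set G q | q in [set q : rat | 0 < ratr q :> R /\ ratr q < u]].
have [q0] := rat_in_itvoo u0; rewrite in_itv /= => /andP[q00 q0u].
have [p0] := rat_in_itvoo u1; rewrite in_itv /= => /andP[up0 p01].
have S0 : S !=set0 by exists (G q0), q0.
have Sub : has_ubound S by exists (G p0) => _ [q [? ?] <-]; exact: Gle.
have hS : has_sup S by [].
apply/cvg_ex; exists (sup S); apply/cvgrPdist_lt => e e0.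
have e2 : 0 < e / 2 by rewrite divr_gt0.
have [_ [q [q00' qu] <-] qS] := sup_adherent e2 hS.
have [p [up p1 pS]] : exists p : rat, [/\ u < ratr p, ratr p < 1 :> R & G p < sup S + e / 2].
  apply: contrapT => hn; apply: nbad; split => //.
  have [r] := @rat_in_itvoo R (sup S) (sup S + e / 2) ltac:(rewrite ltrDl//).
  rewrite in_itv /= => /andP[r1 r2]; exists r; split.
    by move=> p p0' pu; apply: le_lt_trans r1; apply: ub_le_sup => //; exists p.
  move=> p up p1; apply: lt_le_trans r2 _; rewrite leNgt; apply/negP => h.
  by apply: hn; exists p.
move/cvgrPdist_lt/(_ _ e2): (GQ q) => h1; move/cvgrPdist_lt/(_ _ e2): (GQ p) => h2.
near=> n.
have k1 : `|G q - Q (phi n) (ratr q)| < e / 2 by near: n.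
have k2 : `|G p - Q (phi n) (ratr p)| < e / 2 by near: n.
have l1 : Q (phi n) (ratr q) <= Q (phi n) u by apply: Qnd => //; exact: ltW.
have l2 : Q (phi n) u <= Q (phi n) (ratr p) by apply: Qnd => //; exact: ltW.
move: k1 k2; rewrite !ltr_norml => /andP[? ?] /andP[? ?].
by apply/andP; split; lra.
Unshelve. all: by end_near. Qed.

End Subsequences.

(** * Almost surely convergent representations *)

Section Quantile.
Context {R : realType} {dd} {Om : measurableType dd} (P : probability Om R).
Variable X : Om -> R.
Hypotheses (mX : measurable_fun setT X) (X01 : forall w, 0 <= X w <= 1).

Let iX := isMeasurableFun.Build _ _ _ _ X mX.
Let X' : {RV P >-> R} := HB.pack X iX.
Let F y := fine (P [set w | X w <= y]).

Let mle y : measurable [set w | X w <= y].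
Proof.
rewrite [X in measurable X](_ : _ = setT `&` X @^-1` `]-oo, y]); last first.
  by rewrite setTI; apply/seteqP; split=> w /=; rewrite in_itv.
exact: mX.
Qed.

Let FE y : cdf X' y = (F y)%:E.
Proof.
by rewrite /F fineK ?fin_num_measure.
Qed.

Let F_le y z : y <= z -> F y <= F z.
Proof. by move=> yz; rewrite -lee_fin -!FE; exact: cdf_nondecreasing. Qed.

Let F_lt0 y : y < 0 -> F y = 0.
Proof.
move=> y0; rewrite /F (_ : [set w | _] = set0) ?measure0//.
by apply/seteqP; split=> w //= h; have /andP[] := X01 w; lra.
Qed.

Let F1 : F 1 = 1.
Proof.
rewrite /F (_ : [set w | _] = setT) ?probability_setT//.
by apply/seteqP; split=> w //= _; have /andP[] := X01 w.
Qed.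

Let F_right y : forall e, 0 < e -> exists2 z, y < z & F z < F y + e.
Proof.
move=> e e0; have := @cdf_right_continuous _ _ _ _ X' y.
rewrite FE => h.
have {}h : fine (cdf X' z) @[z --> y^'+] --> F y by exact: fine_cvg.
move/cvgrPdist_lt/(_ e e0) : h => h.
near (y^'+) => z; exists z; first by near: z; exact: nbhs_right_gt.
have : `|F y - fine (cdf X' z)| < e by near: z.
by rewrite FE /= ltr_norml => /andP[]; lra.
Unshelve. all: by end_near. Qed.

Definition quantile (u : R) : R := inf [set y | u <= fine (P [set w | X w <= y])].

Lemma quantile_le u y : 0 < u -> u <= 1 -> (quantile u <= y) = (u <= F y).
Proof.
move=> u0 u1; set S := [set y | u <= F y].
have Slb : has_lbound S.
  exists 0 => z /= uz; rewrite leNgt; apply/negP => /F_lt0 z0.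
  by have : u <= F z by []; rewrite z0 leNgt u0.
have S0 : S !=set0 by exists 1; rewrite /S /= F1.
apply/idP/idP => [h|h]; last exact: ge_inf.
apply/ler_addgt0Pr => e /(F_right y)[z yz Fz].
have [w Sw wz] := @inf_lt _ S z S0 (le_lt_trans h yz).
by apply: le_trans Sw _; apply: le_trans (ltW Fz); apply: F_le; exact: ltW.
Qed.

Lemma quantile_01 u : 0 < u -> u <= 1 -> 0 <= quantile u <= 1.
Proof.
move=> u0 u1; rewrite quantile_le// F1 u1 andbT leNgt; apply/negP => h.
have := quantile_le (quantile u) u0 u1; rewrite lexx F_lt0// => /esym.
by rewrite leNgt u0.
Qed.

Lemma quantile_nd u v : 0 < u -> u <= v -> v <= 1 -> quantile u <= quantile v.
Proof.
move=> u0 uv v1; rewrite quantile_le//; last exact: le_trans v1.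
by have v0 := lt_le_trans u0 uv; apply: le_trans uv _; rewrite -quantile_le.
Qed.

Definition quantile_rv (u : R) : R := if (0 < u) && (u <= 1) then quantile u else 0.

Lemma quantile_rv_01 u : 0 <= quantile_rv u <= 1.
Proof.
rewrite /quantile_rv; case: ifP => [/andP[u0 u1]|_]; first exact: quantile_01.
by rewrite lexx ler01.
Qed.

Lemma measurable_quantile_rv :
  measurable_fun setT (quantile_rv : measurableTypeR R -> R).
Proof.
apply: (measurability _ (RGenOInfty.measurableE R)) => _ [_ [x ->] <-].
rewrite setTI.
have -> : quantile_rv @^-1` `]x, +oo[ = (`]0, 1] `&` `]F x, +oo[) `|`
    (~` `]0, 1] `&` (if x < 0 then setT else set0)).
  apply/seteqP; split=> [u|u] /=; rewrite /quantile_rv !in_itv /= !andbT.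
    case: ifP => [/andP[u0 u1]|h] hx; [left; split => //|right; split => //].
      by rewrite ltNge -quantile_le// -ltNge.
    by rewrite hx.
  case=> [[/andP[u0 u1] h]|[/negP/negbTE -> ]].
    by rewrite u0 u1 /= ltNge quantile_le// -ltNge.
  by case: ifP.
apply: measurableU; first by apply: measurableI.
by apply: measurableI; [exact: measurableC|case: ifP].
Qed.

Notation U01 := (uniform_prob (@ltr01 R)).

Lemma uniform_itv (x : R) : 0 <= x <= 1 -> U01 `]x, 1] = (1 - x)%:E.
Proof.
move=> /andP[x0 x1]; rewrite /uniform_prob (eq_integral (cst 1%:E)).
  rewrite integral_cst// mul1e; have := lebesgue_measure_itv `]x, 1]; rewrite /= lte_fin => ->.
  by case: ltP => // h; rewrite (_ : x = 1) ?subrr//; apply/eqP; rewrite eq_le x1.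
move=> u; rewrite inE /= in_itv /= => /andP[xu u1].
by rewrite /uniform_pdf (ltW (le_lt_trans x0 xu)) u1 subr0 invr1.
Qed.

(** By [quantile_le] the two laws agree on half-lines, which generate the Borel
    sets. *)
Lemma quantile_rv_law (A : set R) : measurable A ->
  U01 (quantile_rv @^-1` A) = P (X @^-1` A).
Proof.
pose iQ := isMeasurableFun.Build _ _ _ _ (quantile_rv : measurableTypeR R -> R)
  measurable_quantile_rv.
pose Q' : {RV U01 >-> R} := HB.pack (quantile_rv : measurableTypeR R -> R) iQ.
move=> mA; have : distribution U01 Q' A = distribution P X' A; last by [].
have unique := @measure_unique _ R R (@RGenOInfty.G R)
  (fun n => `]- n%:R, +oo[%classic) (RGenOInfty.measurableE R).
apply: (unique _ _ _ (distribution U01 Q') (distribution P X') _ _ A mA).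
- move=> _ _ [x ->] [y ->]; exists (Num.max x y).
  by apply/seteqP; split=> z /=; rewrite !in_itv /= !andbT gt_max;
    [move=> [-> ->]|move=> /andP[-> ->]].
- by move=> n; exists (- n%:R).
- apply/seteqP; split=> // x _; exists (Num.truncn `|x|).+1 => //=.
  rewrite in_itv /= andbT; have := truncnS_gt `|x|; have := ler_norm (- x).
  by rewrite normrN; lra.
- move=> _ [x ->]; rewrite /distribution /pushforward /=.
  have mQx : measurable (quantile_rv @^-1` `]x, +oo[).
    by rewrite -[X in measurable X]setTI; exact: measurable_quantile_rv.
  have m01 : measurable (~` `]0, 1] : set R) by apply: measurableC.
  have F01 : 0 <= F x <= 1.
    by rewrite /F -!lee_fin fineK ?fin_num_measure// measure_ge0 probability_le1.
  have U0 : U01 (~` `]0, 1]) = 0%E.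
    have U1 : U01 `]0, 1] = 1%E by rewrite uniform_itv ?lexx ?ler01// subr0.
    have := @probability_setC _ _ _ U01 `]0, 1]%classic ltac:(by []).
    by rewrite [X in (_ - X)%E]U1 subee.
  have -> : quantile_rv @^-1` `]x, +oo[ = `]F x, 1] `|` (quantile_rv @^-1` `]x, +oo[ `&` ~` `]0, 1]).
    apply/seteqP; split=> [u hu|u [hu|[]//]].
      have [h01|h01] := pselect (`]0, 1]%classic u); last by right.
      left; move: h01 hu; rewrite /= !in_itv /= andbT => /andP[u0 u1].
      by rewrite /quantile_rv u0 u1 /= ltNge quantile_le// -ltNge => ->.
    move: hu; rewrite /= !in_itv /= andbT => /andP[hu u1].
    have u0 : 0 < u by move: F01 => /andP[? ?]; exact: le_lt_trans hu.
    by rewrite /quantile_rv u0 u1 /= ltNge quantile_le// -ltNge.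
  rewrite measureU0//; first last.
  - apply/eqP; rewrite eq_le measure_ge0 andbT -U0.
    by apply: le_measure; rewrite ?inE//; exact: measurableI.
  - exact: measurableI.
  have UF : U01 `]F x, 1] = (1 - F x)%:E by exact: uniform_itv.
  rewrite [LHS]UF EFinB /F fineK ?fin_num_measure// -probability_setC//.
  by congr (P _); apply/seteqP; split=> w /=; rewrite in_itv /= andbT ltNge => /negP.
- by move=> k; rewrite (le_lt_trans (probability_le1 _ _)) ?ltry.
Qed.

End Quantile.

Section Representation.
Context {R : realType} {N : nat}.
Notation U01 := (uniform_prob (@ltr01 R)).

Lemma probability_setI1 dd (Om : measurableType dd) (P : probability Om R) (A C : set Om) :
  measurable A -> measurable C -> P C = 1%E -> P (A `&` C) = P A.
Proof.
move=> mA mC C1; rewrite -[in RHS](setIT A) -(setUv C) setIUr measureU0//.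
- exact: measurableI.
- by apply: measurableI => //; exact: measurableC.
- apply/eqP; rewrite eq_le measure_ge0 andbT.
  apply: (@le_trans _ _ (P (~` C))); last by rewrite probability_setC// C1 subee.
  by apply: le_measure; rewrite ?inE//; [apply: measurableI|]; try exact: measurableC.
Qed.

Definition seq_cvg (x : nat -> 'rV[R]_N) (l : 'rV[R]_N) : Prop :=
  forall e, 0 < e -> exists n0, forall n, (n0 <= n)%N -> enorm (x n - l) < e.

Lemma seq_cvg_coord (x : nat -> 'rV[R]_N) (l : 'rV[R]_N) :
  (forall i, (fun n => x n 0 i) @ \oo --> l 0 i) -> seq_cvg x l.
Proof.
move=> h e e0; have e1 : 0 < e / N.+1%:R by rewrite divr_gt0.
have : \forall n \near \oo, forall i, `|x n 0 i - l 0 i| < e / N.+1%:R.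
  apply: (@filter_forall _ _ (fun i n => `|x n 0 i - l 0 i| < e / N.+1%:R)) => i.
  have /cvgrPdist_lt/(_ _ e1) := h i.
  by apply: filterS => n; rewrite distrC.
move=> [n0 _ H]; exists n0 => n /H {}H.
apply: (@le_lt_trans _ _ (N%:R * (e / N.+1%:R))).
  by apply: enorm_rV_le => i; rewrite !mxE ltW.
by rewrite mulrCA gtr_pMr// ltr_pdivrMr// mul1r ltr_nat.
Qed.

Lemma seq_cvg_ball (x : nat -> 'rV[R]_N) l rho :
  (forall n, cball rho (x n)) -> seq_cvg x l -> cball rho l.
Proof.
move=> xr h; rewrite /cball /=; apply/ler_addgt0Pr => e /h[n0 /(_ n0 (leqnn _))].
have := xr n0; rewrite /cball /= => h1 h2.
by have := enorm_subl l (x n0); rewrite enormB; lra.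
Qed.

(** Where the codes converge, every digit is eventually constant; hence each
    coordinate is eventually on a fixed side of any rational. *)
Lemma code_cvg (x : nat -> 'rV[R]_N) (n0 : nat) :
  (forall n i, `|x n 0 i| <= n0%:R) -> cvgn (fun n => code (x n)) ->
  forall i, cvgn (fun n => x n 0 i).
Proof.
move=> xb /cvg_ex[l cl] i.
have side (q : rat) : exists b, exists m, forall n, (m <= n)%N -> (x n 0 i < ratr q) = b.
  pose j := pickle (i, q).
  have w0 : 0 < weight j / 4 :> R by rewrite divr_gt0// weight_gt0.
  have /cvgrPdist_lt/(_ _ w0)[m _ H] := cl.
  exists (x m 0 i < ratr q), m => n mn.
  have := @digit_sum_close R (halfspace (x n)) (halfspace (x m)) j.
  rewrite /halfspace => /(_ _ j (leqnn _)); rewrite /j pickleK; apply.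
  have := H n mn; have := H m (leqnn m); rewrite /= -/(code _) -/(code (x m)) -/j.
  rewrite !ltr_norml => /andP[? ?] /andP[? ?]; apply/andP; split; lra.
pose S : set R := [set ratr q | q in [set q : rat |
  exists m, forall n, (m <= n)%N -> ratr q <= x n 0 i]].
have S0 : S !=set0.
  exists (ratr (- n0%:R)); exists (- n0%:R) => //; exists 0%N => n _.
  by rewrite rmorphN /= ratr_nat; have := xb n i; rewrite ler_norml => /andP[].
have Sub : has_ubound S.
  exists n0%:R => _ [q [m H] <-]; apply: le_trans (H m (leqnn _)) _.
  by have := xb m i; rewrite ler_norml => /andP[].
apply/cvg_ex; exists (sup S); apply/cvgrPdist_lt => e e0.
have [_ [q [m H] <-] qS] := sup_adherent e0 (conj S0 Sub).
have [p] := @rat_in_itvoo R (sup S) (sup S + e) ltac:(rewrite ltrDl//).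
rewrite in_itv /= => /andP[p1 p2].
have [b [k Hb]] := side p.
have bT : b.
  apply/negPn/negP => nb; have : ratr p <= sup S.
    apply: ub_le_sup => //; exists p => //; exists k => n kn.
    by rewrite leNgt Hb.
  by rewrite leNgt p1.
exists (maxn m k) => // n /=; rewrite geq_max => /andP[mn kn].
have := H n mn; have := Hb n kn; rewrite bT => h1 h2.
by rewrite ltr_norml; apply/andP; split; lra.
Qed.

(** Prokhorov's and Skorokhod's theorems in a ball. The codes transport the
    measures to the line, where they have quantile functions; Helly's theorem
    extracts an almost everywhere convergent subsequence from these, and
    [code_cvg] decodes its convergence. *)
Lemma skorokhod (rho : R) (P : nat -> probability (Borel R N) R) :
  0 <= rho -> (forall n, P n (cball rho) = 1%E) ->
  exists2 phi, extraction phi &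
  exists X_ : nat -> R -> 'rV[R]_N, exists X : R -> 'rV[R]_N,
  [/\ forall n, has_law U01 (X_ n) (P (phi n)),
      measurable_fun setT (X : measurableTypeR R -> Borel R N),
      forall u, cball rho (X u), forall n u, cball rho (X_ n u) &
      U01.-negligible [set u | ~ seq_cvg (X_ ^~ u) (X u)]].
Proof.
move=> rho0 P1.
pose n0 := (Num.truncn rho).+1.
have n0P : rho <= n0%:R by apply/ltW/truncnS_gt.
have c01 (w : Borel R N) : 0 <= code w <= 1 by exact: digit_sum_01.
have mcode := @measurable_code R N.
pose Q n := quantile_rv (P n) code.
have mQ n : measurable_fun setT (Q n : measurableTypeR R -> R).
  exact: measurable_quantile_rv.
have [||phi [ephi [bad [cbad Hcv]]]] := @helly R Q.
- move=> n u v u0 uv v1; have u1 := le_trans uv (ltW v1).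
  rewrite /Q /quantile_rv u0 (lt_le_trans u0 uv) u1 (ltW v1) /=.
  by apply: quantile_nd => //; exact: ltW.
- by move=> n u; exact: quantile_rv_01.
exists phi => //.
pose dec y : 'rV[R]_N := if enorm (decode n0 y : 'rV[R]_N) <= rho then decode n0 y else 0.
have decE x : cball rho x -> dec (code x) = x.
  move=> xr; have E : decode n0 (code x) = x.
    by apply: codeK => i; apply: le_trans (coord_le_enorm _ _ _) (le_trans xr n0P).
  by rewrite /dec E; move: xr; rewrite /cball /= => ->.
have mdec : measurable_fun setT (dec : R -> Borel R N).
  apply: measurable_fun_ifT => //; last exact: measurable_decode.
  by apply: measurable_fun_ler => //; apply: measurable_enorm_comp; exact: measurable_decode.
have decB y : cball rho (dec y) by rewrite /cball /= /dec; case: ifP => //; rewrite enorm0.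
pose X_ n u := dec (Q (phi n) u).
have mX_ n : measurable_fun setT (X_ n : measurableTypeR R -> Borel R N).
  exact: (measurableT_comp mdec (mQ _)).
have mC : measurable (cball rho : set (Borel R N)) by exact: measurable_cball.
have mpre (A : set R) : measurable A -> measurable ((code : Borel R N -> R) @^-1` A).
  by move=> mA; rewrite -[X in measurable X]setTI; exact: mcode.
have law_ n : has_law U01 (X_ n) (P (phi n)).
  split => // A mA.
  have mdA : measurable (dec @^-1` A) by rewrite -[X in measurable X]setTI; exact: mdec.
  have qE : U01 (X_ n @^-1` A) = P (phi n) (code @^-1` (dec @^-1` A)).
    have := @quantile_rv_law R _ _ (P (phi n)) code mcode c01 (dec @^-1` A) mdA.
    exact.
  transitivity (P (phi n) (code @^-1` (dec @^-1` A))); last exact: esym qE.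
  rewrite -(probability_setI1 mA mC (P1 _)).
  rewrite -(probability_setI1 (mpre _ mdA) mC (P1 _)).
  by congr (P _ _); apply/seteqP; split=> x [Ax xr]; split => //; move: Ax => /=; rewrite decE.
have codeX n : U01.-negligible [set u | code (X_ n u) != Q (phi n) u].
  pose A := [set y : R | code (dec y) == y].
  have mA : measurable A.
    have mE : measurable_fun setT (fun y : R => code (dec y) == y).
      by apply: measurable_fun_eqr => //; exact: (measurableT_comp mcode mdec).
    by rewrite (_ : A = setT `&` (fun y => code (dec y) == y) @^-1` [set true]);
      [exact: mE|rewrite setTI; apply/seteqP; split].
  exists (Q (phi n) @^-1` (~` A)); split.
  - by rewrite -[X in measurable X]setTI; apply: mQ => //; exact: measurableC.
  - have qE : U01 (Q (phi n) @^-1` (~` A)) = P (phi n) (code @^-1` (~` A)).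
      have := @quantile_rv_law R _ _ (P (phi n)) code mcode c01 (~` A) (measurableC mA).
      exact.
    apply: (etrans qE).
    apply/eqP; rewrite eq_le measure_ge0 andbT.
    apply: (@le_trans _ _ (P (phi n) (~` cball rho))).
      apply: le_measure; rewrite ?inE; [|exact: measurableC|].
        by apply: mpre; exact: measurableC.
      by move=> x nA xr; apply: nA; rewrite /A /preimage /= decE.
    by rewrite (probability_setC (P (phi n)) mC) P1 subee.
  - by move=> u /= /negP.
have cX_ n u i : `|X_ n u 0 i| <= n0%:R.
  by apply: le_trans (coord_le_enorm _ _ _) (le_trans (decB _) n0P).
pose X0 u : 'rV[R]_N := \row_i limn_sup (fun n => X_ n u 0 i).
have mX0 : measurable_fun setT (X0 : measurableTypeR R -> Borel R N).
  apply: measurable_fun_rowP => // i.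
  rewrite (_ : (fun t => _) = (fun u => limn_sup (fun n => X_ n u 0 i))); last first.
    by apply/funext => u; rewrite mxE.
  apply: (@measurable_fun_limn_sup _ (measurableTypeR R) R setT (fun n u => X_ n u 0 i)).
  - by move=> u _; exists n0%:R => _ [n _ <-]; have := cX_ n u i; rewrite ler_norml => /andP[].
  - by move=> u _; exists (- n0%:R) => _ [n _ <-]; have := cX_ n u i; rewrite ler_norml => /andP[].
  - by move=> n; exact: (measurableT_comp (measurable_coord i)).
pose X u : 'rV[R]_N := if enorm (X0 u) <= rho then X0 u else 0.
exists X_, X; split => //.
- apply: measurable_fun_ifT => //.
  by apply: measurable_fun_ler => //; exact: measurable_enorm_comp.
- by move=> u; rewrite /cball /= /X; case: ifP => //; rewrite enorm0.
- by move=> n u; exact: decB.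
have lebU (A : set R) : countable A -> U01.-negligible A.
  move=> cA; exists A; split => //; first exact: countable_measurable.
  apply: null_set_integral; first exact: countable_measurable.
    by apply/measurable_EFinP/measurable_funTS; exact: measurable_uniform_pdf.
  exact: countable_lebesgue_measure0.
have N1 : U01.-negligible (~` `]0, 1] : set R).
  exists (~` `]0, 1]); split => //; first exact: measurableC.
  have U1 : U01 `]0, 1] = 1%E by rewrite uniform_itv ?lexx ?ler01// subr0.
  have := @probability_setC _ _ _ U01 `]0, 1]%classic ltac:(by []).
  by rewrite [X in (_ - X)%E]U1 subee.
have N2 := negligible_bigcup codeX.
have N3 := negligibleU (lebU _ cbad) (lebU _ (countable1 1)).
apply: negligibleS (negligibleU (negligibleU N1 N2) N3) => u /= nu.
apply: contrapT => h; apply: nu.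
have u01 : 0 < u <= 1 by apply: contrapT => h'; apply: h; left; left; rewrite /= in_itv.
have cu n : code (X_ n u) = Q (phi n) u.
  by apply/eqP/negPn/negP => h'; apply: h; left; right; exists n.
have u1 : u < 1.
  have /andP[u0 u1] := u01; rewrite lt_neqAle u1 andbT; apply/eqP => E.
  by apply: h; right; right.
have nbad : ~ bad u by move=> b; apply: h; right; left.
have {}Hcv : cvgn (fun n => code (X_ n u)).
  under eq_fun do rewrite cu.
  by apply: Hcv => //; have /andP[-> _] := u01.
have cc := @code_cvg (X_ ^~ u) n0 (fun n i => cX_ n u i) Hcv.
have c0 : seq_cvg (X_ ^~ u) (X0 u).
  apply: seq_cvg_coord => i; rewrite mxE cvg_limn_supE; exact: cc.
have := seq_cvg_ball (fun n => decB _) c0; rewrite /X /cball /= => ->.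
exact: c0.
Qed.

End Representation.

(** * Uniform continuity on the space of measures *)

Lemma dominated_to0 {R : realType} {dd} {Om : measurableType dd}
    (P : {measure set Om -> \bar R}) (D : set Om) (f_ : nat -> Om -> R) (g : Om -> R) :
  measurable D -> (forall n, measurable_fun D (f_ n)) ->
  P.-integrable D (EFin \o g) ->
  (forall n, {ae P, forall w, D w -> 0 <= f_ n w <= g w}) ->
  {ae P, forall w, D w -> forall e, 0 < e -> exists n0, forall n, (n0 <= n)%N -> f_ n w < e} ->
  forall e, 0 < e -> exists n0, forall n, (n0 <= n)%N ->
    (\int[P]_(w in D) (f_ n w)%:E <= e%:E)%E.
Proof.
move=> mD mf ig hb hc e e0.
have hb' : {ae P, forall w, D w -> forall n, 0 <= f_ n w <= g w}.
  apply: filterS (ae_foralln hb) => w h Dw n; exact: h.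
have [|||||_ _] := @dominated_convergence _ _ R P D mD
    (fun n w => (f_ n w)%:E) (cst 0%E) (EFin \o g).
- by move=> n; exact/measurable_EFinP.
- exact: measurable_cst.
- apply: filterS2 hb' hc => w h1 h2 Dw.
  apply: cvg_EFin; first by near=> n.
  apply/cvgrPdist_lt => e' /(h2 Dw)[n0 H]; exists n0 => // n /= /H.
  by rewrite sub0r normrN ger0_norm//; have /andP[] := h1 Dw n.
- exact: ig.
- apply: filterS hb' => w h n Dw; have /andP[a b] := h Dw n.
  by rewrite /= lee_fin ger0_norm.
rewrite integral0 => /fine_cvgP[] [n1 _ fin] /cvgrPdist_lt/(_ _ e0)[n2 _ H].
exists (maxn n1 n2) => n; rewrite geq_max => /andP[/fin fn /H].
rewrite /= sub0r normrN => hn; rewrite -[leLHS]fineK// lee_fin.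
exact: le_trans (ler_norm _) (ltW hn).
Unshelve. all: by end_near. Qed.

Section UniformOnMeasures.
Context {R : realType} {d : nat}.

(** Bounded random vectors that converge almost surely have converging expected
    distances, and these bound the distances of the laws. *)
Lemma W1_cvg {dd} {Om : measurableType dd} (P : probability Om R)
    (X_ : nat -> Om -> 'rV[R]_d) X (nu_ : nat -> Pc R d) (lam : Pc R d) c :
  (forall n, has_law P (X_ n) (nu_ n)) -> has_law P X lam ->
  (forall n w, enorm (X_ n w - X w) <= c) ->
  P.-negligible [set w | ~ seq_cvg (X_ ^~ w) (X w)] ->
  forall e, 0 < e -> exists n0, forall n, (n0 <= n)%N -> W 1 lam (nu_ n) <= e.
Proof.
move=> lX_ lX hc hn e e0.
have [||||n0 H] := @dominated_to0 R _ _ P setT (fun n w => enorm (X_ n w - X w)) (cst c)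
  measurableT _ _ _ _ e e0.
- by move=> n; apply: measurable_enorm_comp; apply: measurable_subB; [case: (lX_ n)|case: lX].
- exact: finite_measure_integrable_cst.
- by move=> n; apply: aeW => w _; rewrite enorm_ge0 hc.
- apply: negligibleS hn => w /= nh /= hw; apply: nh => _ e' e'0.
  by have [n0 H] := hw e' e'0; exists n0.
by exists n0 => n /H; exact: (W1_le lX (lX_ n)).
Qed.

Lemma cball_extraction (z : nat -> 'rV[R]_d) (rho : R) :
  (forall n, cball rho (z n)) ->
  exists2 f, extraction f & exists2 l, cball rho l & seq_cvg (z \o f) l.
Proof.
move=> zr.
pose a n k := if insub k is Some i then z n 0 (i : 'I_d) else 0.
have rho0 : 0 <= rho by apply: le_trans (enorm_ge0 (z 0%N)) (zr 0%N).
have [|f ef cf] := @diagonal_subsequence R a rho.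
  move=> n k; rewrite /a; case: insubP => [i _ _|_]; last by rewrite normr0.
  exact: le_trans (coord_le_enorm _ _ _) (zr n).
exists f => //.
pose l : 'rV[R]_d := \row_i limn (fun n => z (f n) 0 i).
have cl : seq_cvg (z \o f) l.
  apply: seq_cvg_coord => i; rewrite mxE.
  by have := cf i; rewrite /a /= valK.
by exists l => //; apply: seq_cvg_ball cl => n; exact: zr.
Qed.

Lemma enorm_row_mx n p (x : 'rV[R]_n) (y : 'rV[R]_p) :
  enorm (row_mx x y) <= enorm x + enorm y.
Proof.
have -> : row_mx x y = row_mx x 0 + row_mx 0 y by rewrite add_row_mx addr0 add0r.
apply: le_trans (enormD _ _) _; apply: lerD; rewrite /enorm !big_ord1 big_split_ord /=.
  rewrite [X in _ + X]big1 ?addr0; last by move=> i _; rewrite row_mxEr mxE expr0n.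
  by under eq_bigr do rewrite row_mxEl.
rewrite [X in X + _]big1 ?add0r; last by move=> i _; rewrite row_mxEl mxE expr0n.
by under eq_bigr do rewrite row_mxEr.
Qed.

Lemma enorm_lsubmx n p (z : 'rV[R]_(n + p)) : enorm (lsubmx z) <= enorm z.
Proof.
rewrite /enorm !big_ord1 big_split_ord /=; apply: ler_wsqrtr.
under eq_bigr do rewrite mxE; rewrite lerDl; apply: sumr_ge0 => i _; exact: sqr_ge0.
Qed.

Lemma enorm_rsubmx n p (z : 'rV[R]_(n + p)) : enorm (rsubmx z) <= enorm z.
Proof.
rewrite /enorm !big_ord1 big_split_ord /=; apply: ler_wsqrtr.
under eq_bigr do rewrite mxE; rewrite lerDr; apply: sumr_ge0 => i _; exact: sqr_ge0.
Qed.

Lemma has_law_comp {dd} {Om : measurableType dd} (P : probability Om R) n p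
    (X : Om -> 'rV[R]_n) mu (g : 'rV[R]_n -> 'rV[R]_p) nu :
  has_law P X mu -> has_law mu g nu -> has_law P (fun w => g (X w)) nu.
Proof.
move=> [mX lX] [mg lg]; split; first exact: measurableT_comp mg mX.
move=> A mA; rewrite lg// lX//.
by rewrite -[X in measurable X]setTI; exact: mg.
Qed.

Lemma has_law_factor {dd} {Om : measurableType dd} (P : probability Om R) n p
    (X : Om -> 'rV[R]_n) mu (g : 'rV[R]_n -> 'rV[R]_p) nu :
  has_law P X mu -> measurable_fun setT (g : Borel R n -> Borel R p) ->
  has_law P (fun w => g (X w)) nu -> has_law mu g nu.
Proof.
move=> [mX lX] mg [_ lg]; split => // A mA; rewrite lg// lX//.
by rewrite -[X in measurable X]setTI; exact: mg.
Qed.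

Lemma measurable_row_mx dd (Om : measurableType dd) n p
    (f : Om -> 'rV[R]_n) (g : Om -> 'rV[R]_p) :
  measurable_fun setT (f : Om -> Borel R n) -> measurable_fun setT (g : Om -> Borel R p) ->
  measurable_fun setT ((fun w => row_mx (f w) (g w)) : Om -> Borel R (n + p)).
Proof.
move=> mf mg; apply: measurable_fun_rowP => // k.
case: (split_ordP k) => i ->.
  under eq_fun do rewrite row_mxEl; exact: (measurableT_comp (measurable_coord i) mf).
under eq_fun do rewrite row_mxEr; exact: (measurableT_comp (measurable_coord i) mg).
Qed.

Lemma measurable_lsubmx n p :
  measurable_fun setT ((fun z => lsubmx z) : Borel R (n + p) -> Borel R n).
Proof.
apply: measurable_fun_rowP => // i.
under eq_fun do rewrite mxE; exact: measurable_coord.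
Qed.

Lemma measurable_rsubmx n p :
  measurable_fun setT ((fun z => rsubmx z) : Borel R (n + p) -> Borel R p).
Proof.
apply: measurable_fun_rowP => // i.
under eq_fun do rewrite mxE; exact: measurable_coord.
Qed.

Lemma seq_cvg_lsubmx n p (z : nat -> 'rV[R]_(n + p)) l :
  seq_cvg z l -> seq_cvg (fun k => lsubmx (z k)) (lsubmx l).
Proof.
move=> h e /h[n0 H]; exists n0 => k /H; apply: le_lt_trans.
by rewrite -raddfB; exact: enorm_lsubmx.
Qed.

(** A function which is continuous on the measures and points of a ball is
    uniformly continuous there, in the following sense: measures which are
    images of the same measure under uniformly close maps have close values.
    If not, the joint laws of the pairs of maps have an almost surely
    convergent representation, whose limit charges the diagonal only. *)
Lemma C0_uniform p1 p2 (rho r : R) (G : Pc R d -> 'rV[R]_d -> 'rV[R]_d -> 'M[R]_(p1, p2)) :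
  0 <= rho ->
  C0 dist3 (PP (cball rho) `*` cball rho `*` cball rho)
    (fun z => G z.1.1 z.1.2 z.2) ->
  forall e, 0 < e -> exists2 delta, 0 < delta &
  forall mu f g x x' y y', PP (cball r) mu -> ucont r f -> ucont r g ->
    (forall z, cball r z -> cball rho (f z)) -> (forall z, cball r z -> cball rho (g z)) ->
    (forall z, cball r z -> enorm (g z - f z) <= delta) ->
    cball rho x -> cball rho x' -> cball rho y -> cball rho y' ->
    enorm (x' - x) <= delta -> enorm (y' - y) <= delta ->
    enorm (G (push (cball r) g mu) x' y' - G (push (cball r) f mu) x y) <= e.
Proof.
move=> rho0 CG e e0; apply: contrapT => H.
pose bad (n : nat) (q : (Pc R d * ('rV[R]_d -> 'rV[R]_d) * ('rV[R]_d -> 'rV[R]_d)) *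
    ('rV[R]_d * 'rV[R]_d * 'rV[R]_d * 'rV[R]_d)) :=
  let: ((mu, f, g), (x, x', y, y')) := q in
  [/\ PP (cball r) mu, ucont r f /\ ucont r g,
    (forall z, cball r z -> cball rho (f z)) /\ (forall z, cball r z -> cball rho (g z)),
    (forall z, cball r z -> enorm (g z - f z) <= n.+1%:R^-1) &
    [/\ [/\ cball rho x, cball rho x', cball rho y & cball rho y'],
    enorm (x' - x) <= n.+1%:R^-1, enorm (y' - y) <= n.+1%:R^-1 &
    e < enorm (G (push (cball r) g mu) x' y' - G (push (cball r) f mu) x y)]].
have /choice[q qP] : forall n, exists p, bad n p.
  move=> n; apply: contrapT => h; apply: H.
  exists n.+1%:R^-1; first by rewrite invr_gt0.
  move=> mu f g x x' y y' h1 h2 h3 h4 h5 h6 h7 h8 h9 h10 h11 h12.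
  rewrite leNgt; apply/negP => h13; apply: h.
  by exists ((mu, f, g), (x, x', y, y')); split.
clear H.
pose mu n := (q n).1.1.1; pose f n := (q n).1.1.2; pose g n := (q n).1.2.
pose x n := (q n).2.1.1.1; pose x' n := (q n).2.1.1.2.
pose y n := (q n).2.1.2; pose y' n := (q n).2.2.
have {qP} P n : [/\ PP (cball r) (mu n), ucont r (f n) /\ ucont r (g n),
    (forall z, cball r z -> cball rho (f n z)) /\ (forall z, cball r z -> cball rho (g n z)),
    (forall z, cball r z -> enorm (g n z - f n z) <= n.+1%:R^-1) &
    [/\ [/\ cball rho (x n), cball rho (x' n), cball rho (y n) & cball rho (y' n)],
    enorm (x' n - x n) <= n.+1%:R^-1, enorm (y' n - y n) <= n.+1%:R^-1 &
    e < enorm (G (push (cball r) (g n) (mu n)) (x' n) (y' n)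
      - G (push (cball r) (f n) (mu n)) (x n) (y n))]].
  by have := qP n; rewrite /mu /f /g /x /x' /y /y'; move: (q n) => [[[? ?] ?] [[[? ?] ?] ?]].
have small : forall eta, 0 < eta -> exists n0, forall n, (n0 <= n)%N -> n.+1%:R^-1 < eta :> R.
  move=> eta eta0; have := near_infty_natSinv_lt (PosNum eta0).
  by move=> [n0 _ h]; exists n0 => n /h.
(* convergence of the points *)
have [f1 ef1 [xl xlr cx]] := @cball_extraction x rho (fun n => let: And5 _ _ _ _ (And4 (And4 h _ _ _) _ _ _) := P n in h).
have [f2 ef2 [yl ylr cy]] := @cball_extraction (y \o f1) rho
  (fun n => let: And5 _ _ _ _ (And4 (And4 _ _ h _) _ _ _) := P (f1 n) in h).
pose f12 n := f1 (f2 n).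
(* convergence of the joint laws *)
pose X n (w : Borel R d) := row_mx (clip r (f n) w) (clip r (g n) w).
have mX n : measurable_fun setT (X n : Borel R d -> Borel R (d + d)).
  by have [_ [? ?] _ _ _] := P n; apply: measurable_row_mx; exact: measurable_clip.
have clipB h : (forall z, cball r z -> cball rho (h z)) ->
    forall w : 'rV[R]_d, cball rho (clip r h w : 'rV[R]_d).
  by move=> hr w; rewrite /clip; case: ifPn => [/hr//|_]; exact: cball0.
have XB n w : cball (rho + rho) (X n w).
  have [_ _ [hf hg] _ _] := P n.
  by apply: le_trans (enorm_row_mx _ _) _; apply: lerD; exact: clipB.
have /choice[nu_ nuP] : forall n, exists nu : Pc R (d + d),
    has_law (mu n) (X n) nu /\ PP (cball (rho + rho)) nu.
  by move=> n; have [nu ? ?] := law_exists (Pc_measure (mu n)) (mX n) (XB n); exists nu.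
have r2 : 0 <= rho + rho by exact: addr_ge0.
have [f3 ef3 [Y_ [Y [lY mY YB Y_B cY]]]] := @skorokhod R _ _ (fun n => Pc_measure (nu_ (f12 n))) r2
  (fun n => PP_full (nuP _).2).
pose s n := f12 (f3 n).
have es n : (n <= s n)%N.
  apply: leq_trans (extraction_ge ef3 n) _; apply: leq_trans (extraction_ge ef2 _) _.
  exact: extraction_ge.
pose U01 := uniform_prob (@ltr01 R).
pose Z u : 'rV[R]_d := if enorm (lsubmx (Y u)) <= rho then lsubmx (Y u) else 0.
have mlY : measurable_fun setT ((fun u => lsubmx (Y u)) : measurableTypeR R -> Borel R d).
  exact: measurableT_comp (@measurable_lsubmx d d) mY.
have mZ : measurable_fun setT (Z : measurableTypeR R -> Borel R d).
  apply: measurable_fun_ifT => //.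
  by apply: measurable_fun_ler => //; exact: measurable_enorm_comp.
have ZB u : cball rho (Z u).
  by rewrite /cball /= /Z; case: ifP => //; rewrite enorm0.
have [lam lZ lamP] := @law_exists R _ _ U01 _ Z rho mZ ZB.
have lf n : has_law U01 (fun u => lsubmx (Y_ n u)) (push (cball r) (f (s n)) (mu (s n))).
  have [muP [uf ug] _ _ _] := P (s n).
  apply: (has_law_comp (lY n)).
  apply: (has_law_factor (nuP (s n)).1 (@measurable_lsubmx d d)).
  by under eq_fun do rewrite row_mxKl; exact: push_law.
have lg n : has_law U01 (fun u => rsubmx (Y_ n u)) (push (cball r) (g (s n)) (mu (s n))).
  have [muP [uf ug] _ _ _] := P (s n).
  apply: (has_law_comp (lY n)).
  apply: (has_law_factor (nuP (s n)).1 (@measurable_rsubmx d d)).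
  by under eq_fun do rewrite row_mxKr; exact: push_law.
have pf n : PP (cball rho) (push (cball r) (f (s n)) (mu (s n))).
  by have [muP [uf ug] [fB gB] _ _] := P (s n); exact: push_PP.
have pg n : PP (cball rho) (push (cball r) (g (s n)) (mu (s n))).
  by have [muP [uf ug] [fB gB] _ _] := P (s n); exact: push_PP.
have N1 : U01.-negligible [set u | exists n, ~ cball rho (lsubmx (Y_ n u))].
  have -> : [set u | exists n, ~ cball rho (lsubmx (Y_ n u))] =
      \bigcup_n [set u | ~ cball rho (lsubmx (Y_ n u))].
    by apply/seteqP; split => [u [n h]|u [n _ h]]; exists n.
  by apply: negligible_bigcup => n; exact: (law_negligible (lf n) (pf n)).
have N2 : U01.-negligible [set u | exists n, (s n).+1%:R^-1 < enorm (rsubmx (Y_ n u) - lsubmx (Y_ n u))].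
  have -> : [set u | exists n, (s n).+1%:R^-1 < enorm (rsubmx (Y_ n u) - lsubmx (Y_ n u))] =
      \bigcup_n [set u | (s n).+1%:R^-1 < enorm (rsubmx (Y_ n u) - lsubmx (Y_ n u))].
    by apply/seteqP; split => [u [n h]|u [n _ h]]; exists n.
  apply: negligible_bigcup => n.
  pose A : set (Borel R (d + d)) := [set z | (s n).+1%:R^-1 < enorm (rsubmx z - lsubmx z)].
  have mA : measurable A.
    have mE : measurable_fun setT (fun z : Borel R (d + d) => (s n).+1%:R^-1 < enorm (rsubmx z - lsubmx z)).
      apply: measurable_fun_ltr => //; apply: measurable_enorm_comp; apply: measurable_subB.
        exact: measurable_rsubmx.
      exact: measurable_lsubmx.
    rewrite (_ : A = setT `&` (fun z => (s n).+1%:R^-1 < enorm (rsubmx z - lsubmx z)) @^-1` [set true]).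
      exact: mE.
    by rewrite setTI; apply/seteqP; split.
  have [mYn lYn] := lY n.
  exists (Y_ n @^-1` A); split => //.
    by rewrite -[X in measurable X]setTI; exact: mYn.
  apply: (etrans (esym (lYn A mA))).
  have [mXn lXn] := (nuP (s n)).1.
  rewrite [LHS]lXn//.
  have [muP [uf ug] [fB gB] fg _] := P (s n).
  have /negligibleP : (mu (s n)).-negligible (X (s n) @^-1` A).
    apply: negligibleS (PP_ae muP fg) => z; rewrite /A /X /preimage /= row_mxKl row_mxKr => h h'.
    move: h; rewrite ltNge => /negP; apply; move: h'; rewrite /clip; case: ifP => // _ _.
    by rewrite subrr enorm0 invr_ge0.
  by apply; rewrite -[X in measurable X]setTI; exact: mXn.
have cZ : U01.-negligible [set u | ~ (seq_cvg (fun n => lsubmx (Y_ n u)) (Z u) /\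
     seq_cvg (fun n => rsubmx (Y_ n u)) (Z u))].
  apply: negligibleS (negligibleU (negligibleU N1 N2) cY) => u /= nh.
  apply: contrapT => h; apply: nh.
  have h1 n : cball rho (lsubmx (Y_ n u)).
    by apply: contrapT => h'; apply: h; left; left; exists n.
  have h2 n : enorm (rsubmx (Y_ n u) - lsubmx (Y_ n u)) <= (s n).+1%:R^-1.
    by rewrite leNgt; apply/negP => h'; apply: h; left; right; exists n.
  have h3 : seq_cvg (Y_ ^~ u) (Y u) by apply: contrapT => h'; apply: h; right.
  have c1 := seq_cvg_lsubmx h3.
  have ZE : Z u = lsubmx (Y u).
    by have := seq_cvg_ball h1 c1; rewrite /Z /cball /= => ->.
  rewrite ZE; split => // eta eta0.
  have eta2 : 0 < eta / 2 by rewrite divr_gt0.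
  have [n1 H1] := c1 _ eta2; have [n2 H2] := small _ eta2.
  exists (maxn n1 n2) => n; rewrite geq_max => /andP[/H1 a1 n2n].
  have a2 := H2 _ (leq_trans n2n (es n)).
  have a3 := enorm_trans (lsubmx (Y_ n u)) (rsubmx (Y_ n u)) (lsubmx (Y u)).
  rewrite (splitr eta); apply: le_lt_trans a3 _; apply: ltrD => //.
  exact: le_lt_trans (h2 n) a2.
have e2 : 0 < e / 2 by rewrite divr_gt0.
have [delta delta0 Hd] := CG (lam, xl, yl) (conj (conj lamP xlr) ylr) _ e2.
have d4 : 0 < delta / 4 by rewrite divr_gt0.
have bd n u (Q : 'rV[R]_d) : enorm Q <= enorm (Y_ n u) -> enorm (Q - Z u) <= rho + rho + rho.
  move=> h; apply: le_trans (enormD _ _) _; rewrite enormN; apply: lerD; last exact: ZB.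
  exact: le_trans h (Y_B n u).
have [n1 H1] : exists n0, forall n, (n0 <= n)%N -> W 1 lam (push (cball r) (f (s n)) (mu (s n))) <= delta / 4.
  apply: (W1_cvg lf lZ (c := rho + rho + rho)) => //.
    by move=> n u; apply: (bd n); exact: enorm_lsubmx.
  by apply: negligibleS cZ => u /= nh [h _].
have [n2 H2] : exists n0, forall n, (n0 <= n)%N -> W 1 lam (push (cball r) (g (s n)) (mu (s n))) <= delta / 4.
  apply: (W1_cvg lg lZ (c := rho + rho + rho)) => //.
    by move=> n u; apply: (bd n); exact: enorm_rsubmx.
  by apply: negligibleS cZ => u /= nh [_ h].
have d8 : 0 < delta / 8 by rewrite divr_gt0.
have [n3 H3] := cx _ d8; have [n4 H4] := cy _ d8; have [n5 H5] := small _ d8.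
pose n := (n1 + n2 + n3 + n4 + n5)%N.
have f3n := extraction_ge ef3 n; have f2n := extraction_ge ef2 (f3 n).
have a1 := H1 n ltac:(rewrite /n -!addnA leq_addr//).
have a2 := H2 n ltac:(rewrite /n -!addnA addnCA leq_addr//).
have a3 : enorm (x (s n) - xl) < delta / 8.
  apply: H3; apply: leq_trans f2n; apply: leq_trans f3n.
  by rewrite /n (addnC (n1 + n2)) -!addnA leq_addr.
have a4 : enorm (y (s n) - yl) < delta / 8.
  by apply: H4; apply: leq_trans f3n; rewrite /n addnAC leq_addl.
have a5 := H5 (s n) (leq_trans (leq_addl _ _ : (n5 <= n)%N) (es n)).
have [_ _ _ _ [[xB x'B yB y'B] xx yy eG]] := P (s n).
have {}xx := le_lt_trans xx a5; have {}yy := le_lt_trans yy a5.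
have b1 := Hd (_, x (s n), y (s n)) (conj (conj (pf n) xB) yB).
have b2 := Hd (_, x' (s n), y' (s n)) (conj (conj (pg n) x'B) y'B).
move: b1 b2; rewrite /dist3 /dist2 /= => b1 b2.
have E8 : delta / 4 = delta / 8 + delta / 8 by field.
have E4 : delta = delta / 4 + delta / 4 + delta / 4 + delta / 4 by field.
have c1 : enorm (xl - x' (s n)) < delta / 4.
  by rewrite enormB E8; apply: le_lt_trans (enorm_trans (x (s n)) _ _) _; exact: ltrD.
have c2 : enorm (yl - y' (s n)) < delta / 4.
  by rewrite enormB E8; apply: le_lt_trans (enorm_trans (y (s n)) _ _) _; exact: ltrD.
have d84 : delta / 8 < delta / 4 by rewrite E8 ltrDl.
have sum4 a b c : a <= delta / 4 -> b < delta / 4 -> c < delta / 4 -> a + b + c < delta.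
  clear -d4 E4; lra.
have {}b1 := b1 (sum4 _ _ _ a1 _ _); have {}b2 := b2 (sum4 _ _ _ a2 c1 c2).
rewrite !(enormB xl, enormB yl) in b1.
have {}b1 := b1 (lt_trans a3 d84) (lt_trans a4 d84).
move: eG; apply/negP; rewrite -leNgt [leRHS]splitr.
apply: le_trans (enorm_trans (G lam xl yl) _ _) _; apply: lerD; first exact: ltW b2.
by rewrite enormB; exact: ltW b1.
Qed.

End UniformOnMeasures.

(** * Integration in time *)

Section AlmostEverywhere.
Context {dd} {Om : measurableType dd} {R : realType} (P : {measure set Om -> \bar R}).

(** The integral of a nonnegative function is its lower integral; monotonicity
    is needed for suprema over a space of measures, whose measurability in
    time is unclear. *)
Lemma lower_integral_le (D : set Om) (f g : Om -> \bar R) :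
  (forall x, D x -> (0 <= f x)%E) -> (forall x, D x -> (f x <= g x)%E) ->
  (\int[P]_(x in D) f x <= \int[P]_(x in D) g x)%E.
Proof.
move=> f0 fg.
rewrite !ge0_integralE//; last by move=> x Dx; exact: le_trans (f0 x Dx) (fg x Dx).
apply: ereal_sup_le => _ [h hf <-]; exists h => // x; apply: le_trans (hf x) _.
by rewrite /patch; case: ifPn => //; rewrite inE => /fg.
Qed.

(** Redefining [g] as 0, or as +oo, on the null set where the functions differ
    bounds the lower integral of [f] from both sides. *)
Lemma ge0_ae_eq_lower_integral (D : set Om) (f g : Om -> \bar R) :
  measurable D -> measurable_fun D g ->
  (forall x, D x -> (0 <= f x)%E) -> (forall x, D x -> (0 <= g x)%E) ->
  {ae P, forall x, D x -> f x = g x} ->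
  (\int[P]_(x in D) f x = \int[P]_(x in D) g x)%E.
Proof.
move=> mD mg f0 g0 [N [mN N0 sN]].
have mNc : measurable (~` N) by exact: measurableC.
have fgE x : D x -> ~ N x -> f x = g x.
  by move=> Dx nN; apply: contrapT => h; apply: nN; apply: sN => /(_ Dx).
pose lo x := if x \in N then 0%E else g x.
pose hi x := if x \in N then +oo%E else g x.
have mif c : measurable_fun D (fun x => if x \in N then c else g x).
  apply: measurable_fun_if => //; last by apply: measurable_funS mg => // x [].
  apply: (@measurable_fun_bool _ _ D _ true).
  rewrite (_ : _ @^-1` _ = N) ?setTI; first exact: measurableI.
  by apply/seteqP; split=> x /=; [move/set_mem|move/mem_set].
have elo : (\int[P]_(x in D) lo x = \int[P]_(x in D) g x)%E.
  apply: ge0_ae_eq_integral => //; first exact: mif.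
    by move=> x Dx; rewrite /lo; case: ifP => // _; exact: g0.
  exists N; split=> // x /= h; apply: contrapT => nN; apply: h => Dx.
  by rewrite /lo memNset.
have ehi : (\int[P]_(x in D) hi x = \int[P]_(x in D) g x)%E.
  apply: ge0_ae_eq_integral => //; first exact: mif.
    by move=> x Dx; rewrite /hi; case: ifP => // _; exact: g0.
  exists N; split=> // x /= h; apply: contrapT => nN; apply: h => Dx.
  by rewrite /hi memNset.
apply/eqP; rewrite eq_le; apply/andP; split.
  rewrite -ehi; apply: lower_integral_le => // x Dx; rewrite /hi.
  by case: ifPn => [_|/negP nN]; rewrite ?leey// fgE// => /mem_set.
rewrite -elo; apply: lower_integral_le => x Dx; rewrite /lo.
  by case: ifP => // _; exact: g0.
by case: ifPn => [_|/negP nN]; [exact: f0|rewrite fgE// => /mem_set].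
Qed.

Lemma ae_eq_integral_rep (D : set Om) (f g : Om -> R) :
  measurable D -> measurable_fun D g -> {ae P, forall x, D x -> f x = g x} ->
  \int[P]_(x in D) f x = \int[P]_(x in D) g x.
Proof.
move=> mD mg fg; rewrite /Rintegral integralE [in RHS]integralE; congr (fine (_ - _)%E).
- apply: ge0_ae_eq_lower_integral => //.
  + by apply: measurable_funepos; exact/measurable_EFinP.
  + by apply: filterS fg => x h /h; rewrite !funeposE => ->.
- apply: ge0_ae_eq_lower_integral => //.
  + by apply: measurable_funeneg; exact/measurable_EFinP.
  + by apply: filterS fg => x h /h; rewrite !funenegE => ->.
Qed.

End AlmostEverywhere.

Lemma ae_imp {R : realType} (P Q : R -> Prop) :
  {ae leb, forall t, P t} -> (forall t, P t -> Q t) -> {ae leb, forall t, Q t}.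
Proof. by move=> h PQ; apply: negligibleS h => t /= nQ /PQ. Qed.

Lemma ae_and {R : realType} (P Q : R -> Prop) :
  {ae leb, forall t, P t} -> {ae leb, forall t, Q t} ->
  {ae leb, forall t, P t /\ Q t}.
Proof.
move=> h1 h2; apply: negligibleS (negligibleU h1 h2) => t /= n.
by apply: contrapT => h; apply: n; split; apply: contrapT => h'; apply: h; [left|right].
Qed.

Section Primitive.
Context {R : realType}.
Implicit Types (f g : R -> R) (a b t T : R).

Notation integrableR g := (leb.-integrable setT (EFin \o g)).

Definition prim g t : R := \int[leb]_(s in `[0, t]) g s.

(** An integrable representative, extended to the whole line. *)
Definition represents T f g : Prop :=
  integrableR g /\ {ae leb, forall t, t \in `[0, T] -> f t = g t}.

Lemma integrable_itv g (i : interval R) : integrableR g ->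
  leb.-integrable [set` i] (EFin \o g).
Proof. by apply: integrableS => //; exact: measurable_itv. Qed.

Lemma primB g a b : integrableR g -> 0 <= a -> a <= b ->
  prim g b - prim g a = \int[leb]_(s in `[a, b]) g s.
Proof.
move=> ig a0 ab; rewrite /prim Rintegral_itvB//; last exact: integrable_itv.
by apply: Rintegral_itv_obnd_cbnd; exact: integrable_itv.
Qed.

Lemma oriented_int_prim g a b : integrableR g -> 0 <= a -> 0 <= b ->
  oriented_int a b g = prim g b - prim g a.
Proof.
move=> ig a0 b0; rewrite /oriented_int; case: ifPn => [ab|]; first by rewrite primB.
by rewrite -ltNge => /ltW ba; rewrite -primB// opprB.
Qed.

Lemma oriented_int_rep T f g a b : represents T f g ->
  a \in `[0, T] -> b \in `[0, T] -> oriented_int a b f = prim g b - prim g a.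
Proof.
move=> [ig fg]; rewrite !in_itv /= => /andP[a0 aT] /andP[b0 bT].
rewrite -oriented_int_prim// /oriented_int.
have mg D : measurable_fun D g.
  by apply: measurable_funTS; move/integrableP: ig => [/measurable_EFinP].
case: ifP => _; [|congr (- _)];
  (apply: ae_eq_integral_rep; [exact: measurable_itv|exact: mg|]).
  apply: (ae_imp fg) => t {}h /=; rewrite in_itv /= => /andP[h1 h2].
  by apply: h; rewrite in_itv /= (le_trans a0 h1) (le_trans h2 bT).
apply: (ae_imp fg) => t {}h /=; rewrite in_itv /= => /andP[h1 h2].
by apply: h; rewrite in_itv /= (le_trans b0 h1) (le_trans h2 aT).
Qed.

Lemma integrable_lincomb g1 g2 a b : integrableR g1 -> integrableR g2 ->
  integrableR (fun t => a * g1 t + b * g2 t).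
Proof.
move=> i1 i2; have := integrableD measurableT (integrableZl measurableT a i1)
  (integrableZl measurableT b i2).
by congr (_.-integrable _ _); apply/funext => t /=.
Qed.

Lemma integrable_normR g : integrableR g -> integrableR (fun t => `|g t|).
Proof. by move=> /integrable_norm. Qed.

Lemma prim_lincomb g1 g2 a b t : integrableR g1 -> integrableR g2 ->
  prim (fun s => a * g1 s + b * g2 s) t = a * prim g1 t + b * prim g2 t.
Proof.
move=> i1 i2; have j1 := integrable_itv `[0, t] i1; have j2 := integrable_itv `[0, t] i2.
have iZ c g : integrableR g -> integrableR (fun s => c * g s).
  move=> ig; have := integrableZl measurableT c ig.
  by congr (_.-integrable _ _); apply/funext => s /=.
rewrite /prim RintegralD//=; first by rewrite !RintegralZl.
- exact: (integrable_itv _ (iZ a _ i1)).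
- exact: (integrable_itv _ (iZ b _ i2)).
Qed.

Lemma prim_le g1 g2 a b : integrableR g1 -> integrableR g2 -> 0 <= a -> a <= b ->
  {ae leb, forall t, a <= t <= b -> g1 t <= g2 t} ->
  prim g1 b - prim g1 a <= prim g2 b - prim g2 a.
Proof.
move=> i1 i2 a0 ab h; rewrite -subr_ge0.
pose g t := 1 * g2 t + (-1) * g1 t.
have ig : integrableR g by exact: integrable_lincomb.
have mg D : measurable_fun D (fun t => `|g t|).
  apply: measurable_funTS; apply: measurableT_comp => //.
  by move/integrableP: ig => [/measurable_EFinP].
have -> : prim g2 b - prim g2 a - (prim g1 b - prim g1 a) = prim g b - prim g a.
  by rewrite !prim_lincomb//; ring.
rewrite primB//.
have -> : \int[leb]_(s in `[a, b]) g s = \int[leb]_(s in `[a, b]) `|g s|; last first.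
  by apply: Rintegral_ge0 => t _; exact: normr_ge0.
apply: ae_eq_integral_rep; [exact: measurable_itv|exact: mg|].
apply: (ae_imp h) => t {}h /=; rewrite in_itv /= => /h; rewrite /g => ?.
by rewrite ger0_norm//; lra.
Qed.

Lemma prim_norm_le g k a b : integrableR g -> integrableR k -> 0 <= a -> a <= b ->
  {ae leb, forall t, a <= t <= b -> `|g t| <= k t} ->
  `|prim g b - prim g a| <= prim k b - prim k a.
Proof.
move=> ig ik a0 ab h; rewrite ler_norml; apply/andP; split.
  have := @prim_le (fun t => (-1) * k t + 0 * k t) g a b (integrable_lincomb _ _ ik ik) ig a0 ab.
  rewrite !prim_lincomb// => h1.
  suff : -1 * prim k b + 0 * prim k b - (-1 * prim k a + 0 * prim k a) <= prim g b - prim g a.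
    by lra.
  apply: h1; apply: (ae_imp h) => t {}h /h; rewrite ler_norml => /andP[? _]; lra.
apply: prim_le => //; apply: (ae_imp h) => t {}h /h.
by rewrite ler_norml => /andP[].
Qed.

Lemma prim_ge0 k a b : integrableR k -> 0 <= a -> a <= b ->
  {ae leb, forall t, a <= t <= b -> 0 <= k t} -> 0 <= prim k b - prim k a.
Proof.
move=> ik a0 ab h.
have := @prim_le (fun t => 0 * k t + 0 * k t) k a b (integrable_lincomb _ _ ik ik) ik a0 ab.
rewrite !prim_lincomb// => h1.
suff : 0 * prim k b + 0 * prim k b - (0 * prim k a + 0 * prim k a) <= prim k b - prim k a by lra.
by apply: h1; apply: (ae_imp h) => t {}h /h; rewrite !mul0r addr0.
Qed.

(** Absolute continuity of the integral, over finitely many intervals. *)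
Lemma prim_sum_small g : integrableR g -> forall e, 0 < e ->
  exists2 delta, 0 < delta & forall (n : nat) (a b : 'I_n -> R),
    (forall k, 0 <= a k /\ a k <= b k) ->
    trivIset setT (fun k : 'I_n => [set` `]a k, b k[]) ->
    \sum_k (b k - a k) < delta ->
    \sum_k (prim (fun t => `|g t|) (b k) - prim (fun t => `|g t|) (a k)) < e.
Proof.
move=> ig e e0; have [delta [delta0 H]] := integral_normr_continuous ig e0.
exists delta => // n a b ab tI sd.
pose F (k : 'I_n) := `]a k, b k[%classic : set R.
have mF k : measurable (F k) by exact: measurable_itv.
pose A := \big[setU/set0]_k F k.
have mA : measurable A by exact: bigsetU_measurable.
have iN := integrable_normR ig.
have lA : (leb A < delta%:E)%E.
  have -> : leb A = (\sum_k leb (F k))%E.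
    have := @measure_bigsetU_ord _ _ _ (leb : {measure set _ -> \bar R}) n xpredT F mF tI.
    exact.
  rewrite (eq_bigr (fun k => (b k - a k)%:E)) ?sumEFin ?lte_fin//.
  move=> k _; have [a0 akb] := ab k; rewrite /F.
  have := lebesgue_measure_itv `]a k, b k[; rewrite /= lte_fin => ->.
  by case: ltP => // h; rewrite (_ : b k = a k) ?subrr//; apply/eqP; rewrite eq_le akb h.
apply: le_lt_trans (H A mA lA).
rewrite /Rintegral /A ge0_integral_bigsetU//=; first last.
- apply: measurable_funTS; move/integrableP: iN => [//].
- by apply: sub_trivIset tI.
- exact: index_enum_uniq.
rewrite (eq_bigr (fun k => (prim (fun t => `|g t|) (b k) - prim (fun t => `|g t|) (a k))%:E)).
  by rewrite sumEFin.
move=> k _; have [a0 akb] := ab k; rewrite primB//.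
have ik D : measurable D -> leb.-integrable D (EFin \o (fun t => `|g t|)).
  by move=> mD; exact: integrableS iN.
rewrite -Rintegral_itv_obnd_cbnd; last exact: ik.
rewrite -Rintegral_itv_bndo_bndc; last exact: ik.
by rewrite /Rintegral fineK//; apply: integrable_fin_num => //; exact: ik.
Qed.

Lemma prim_small g : integrableR g -> forall e, 0 < e ->
  exists2 delta, 0 < delta & forall a b, 0 <= a -> a <= b -> b - a < delta ->
    prim (fun t => `|g t|) b - prim (fun t => `|g t|) a < e.
Proof.
move=> ig e /(prim_sum_small ig)[delta d0 H]; exists delta => // a b a0 ab h.
have := H 1%N (fun=> a) (fun=> b); rewrite !big_ord1; apply => //.
by move=> i j _ _ _; rewrite (ord1 i) (ord1 j).
Qed.

Lemma prim_derive T g : 0 < T -> integrableR g ->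
  {ae leb, forall t, t \in `]0, T[ -> is_derive t 1 (prim g) (g t)}.
Proof.
move=> T0 ig.
have /lebesgue_differentiation := open_integrable_locally openT ig.
move/ae_imp; apply => t lt; rewrite in_itv /= => /andP[t0 tT].
have [||] := @FTC1_lebesgue_pt R g (BLeft 0) t T tT _ _ lt.
- exact: integrable_itv.
- by rewrite lte_fin.
move=> h1 h2; apply: DeriveDef; first exact: h1.
by rewrite -derive1E; exact: h2.
Qed.

End Primitive.

(** * Absolutely continuous functions and integral inequalities *)

Section Monotonicity.
Context {R : realType}.

Lemma sum_itv_le (U : set R) n (a b : 'I_n -> R) : measurable U ->
  (forall k, a k <= b k) -> (forall k, `]a k, b k[ `<=` U) ->
  trivIset setT (fun k => `]a k, b k[%classic) ->
  ((\sum_k (b k - a k))%:E <= leb U)%E.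
Proof.
move=> mU ab abU tI.
pose F (k : 'I_n) := `]a k, b k[%classic : set R.
have mF k : measurable (F k) by exact: measurable_itv.
have E : leb (\big[setU/set0]_k F k) = (\sum_k leb (F k))%E.
  have := @measure_bigsetU_ord _ _ _ (leb : {measure set _ -> \bar R}) n xpredT F mF tI.
  exact.
rewrite -sumEFin (eq_bigr (fun k => leb (F k))) -?E.
  have mA : measurable (\big[setU/set0]_k F k) by exact: bigsetU_measurable.
  apply: le_measure; [by rewrite inE; exact: mA|by rewrite inE|].
  apply: (big_ind (fun B : set R => B `<=` U)) => //.
  - by move=> B1 B2 h1 h2 x [/h1|/h2].
  - by move=> k _; exact: abU.
move=> k _; rewrite /F.
have := lebesgue_measure_itv `]a k, b k[; rewrite /= lte_fin => ->.
by case: ltP => // h; rewrite (_ : b k = a k) ?subrr//; apply/eqP; rewrite eq_le ab h.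
Qed.

(** The points where [f] may fail to be differentiable are covered by an open
    set of small measure. From any point one can move right, either by the
    derivative, losing little, or inside the open set, where the total
    variation of [f] is small by absolute continuity. *)
Lemma ac_nondecreasing (a b : R) (f : R -> R) : a <= b ->
  (forall e, 0 < e -> exists2 delta, 0 < delta & forall n (x y : 'I_n -> R),
     (forall k, a <= x k /\ x k <= y k /\ y k <= b) ->
     trivIset setT (fun k : 'I_n => `]x k, y k[%classic) ->
     \sum_k (y k - x k) < delta -> \sum_k `|f (y k) - f (x k)| < e) ->
  {ae leb, forall t, t \in `]a, b[ -> exists2 l, 0 <= l & expands f t l} ->
  f a <= f b.
Proof.
move=> ab ac [N0 [mN0 N00 sN0]].
apply/ler_addgt0Pr => e' e'0.
pose e := e' / (b - a + 1).
have ba1 : 0 < b - a + 1 by rewrite ltr_wpDl// subr_ge0.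
have e0 : 0 < e by rewrite divr_gt0.
have eE : e * (b - a) + e = e' by rewrite /e; field; rewrite gt_eqF.
have [delta delta0 Hac] := ac e e0.
pose N := N0 `|` ([set a] `|` [set b]).
have mN : measurable N by apply: measurableU => //; exact: measurableU.
have N1 : leb N = 0%E.
  apply/null_set_setU => //; first exact: measurableU.
  by apply/null_set_setU => //; exact: lebesgue_measure_set1.
have Nfin : (leb N < +oo)%E by rewrite N1 ltry.
have [U [oU NU lU]] := lebesgue_regularity_outer mN Nfin delta0.
have mU : measurable U by exact: open_measurable.
have {}lU : (leb U < delta%:E)%E.
  apply: le_lt_trans lU; rewrite -[in leLHS](setDUK NU) setUC measureU0//.
  exact: measurableD.
pose chain t n (x y : nat -> R) := [/\
  forall k, (k < n)%N -> a <= x k /\ x k <= y k /\ y k <= t,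
  forall k, (k < n)%N -> `]x k, y k[ `<=` U,
  forall i j, (i < j)%N -> (j < n)%N -> y i <= x j &
  f a - f t <= e * (t - a) + \sum_(k < n) `|f (y k) - f (x k)|].
pose C t := exists n x y, chain t n x y.
have Ca : C a.
  by exists 0%N, (fun=> 0), (fun=> 0); split => //; rewrite big_ord0 !subrr mulr0 addr0.
have C1 t s : C t -> t <= s -> f t - f s <= e * (s - t) -> C s.
  move=> [n [x [y [h1 h2 h3 h4]]]] ts hf; exists n, x, y; split => //.
    by move=> k /h1[? [? h]]; do 2 split => //; exact: le_trans h ts.
  by clear -h4 hf; lra.
have C2 t s : C t -> a <= t -> t <= s -> `]t, s[ `<=` U -> C s.
  move=> [n [x [y [h1 h2 h3 h4]]]] at_ ts hU.
  exists n.+1, (fun k => if (k < n)%N then x k else t), (fun k => if (k < n)%N then y k else s).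
  split.
  - move=> k _; case: ifP => [/h1[? [? h]]|_] //.
    by do 2 split => //; exact: le_trans h ts.
  - by move=> k _; case: ifP => [/h2|].
  - move=> i j ij; rewrite ltnS leq_eqVlt => /predU1P[E|jn].
      by rewrite E ltnn -E ij; have [? []] := h1 i (leq_trans ij (eq_leq E)).
    by rewrite jn (ltn_trans ij jn); exact: h3.
  - rewrite big_ord_recr /= ltnn (eq_bigr (fun k : 'I_n => `|f (y k) - f (x k)|)); last first.
      by move=> k _; rewrite ltn_ord.
    have := ler_norm (f t - f s); rewrite distrC => h5.
    have : e * (t - a) <= e * (s - a) by rewrite ler_pM2l// lerD2r.
    by clear -h4 h5; lra.
pose S := [set t | a <= t <= b /\ C t].
have S0 : S !=set0 by exists a; rewrite /S /= lexx ab.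
have Sub : has_ubound S by exists b => t [/andP[]].
pose s := sup S.
have as_ : a <= s by apply: ub_le_sup => //; split => //; rewrite lexx ab.
have sb : s <= b by apply: ge_sup => // t [/andP[]].
have [eta eta0 loc] : exists2 eta, 0 < eta & forall t t', a <= t -> s - eta < t -> t <= s ->
    C t -> s <= t' -> t' < s + eta -> C t'.
  have [sN|sN] := pselect (N s).
    have /nbhs_ballP[eta eta0 hU] : nbhs s U by apply: open_nbhs_nbhs; split => //; exact: NU.
    exists eta => // t t' at_ t1 t2 Ct t3 t4.
    have Cs : C s.
      apply: (C2 _ _ Ct at_ t2) => z /=; rewrite in_itv /= => /andP[z1 z2].
      by apply: hU; rewrite /ball /= ltr_norml; apply/andP; split; clear -t1 z1 z2; lra.
    apply: (C2 _ _ Cs as_ t3) => z /=; rewrite in_itv /= => /andP[z1 z2].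
    by apply: hU; rewrite /ball /= ltr_norml; apply/andP; split; clear -t4 z1 z2; lra.
  have s0T : s \in `]a, b[.
    rewrite in_itv /= !lt_neqAle as_ sb !andbT.
    by apply/andP; split; apply/eqP => E; apply: sN; right; [left|right].
  have [l l0 hl] : exists2 l, 0 <= l & expands f s l.
    by apply: contrapT => h; apply: sN; left; apply: sN0 => /(_ s0T).
  have [eta eta0 H] := hl e e0; exists eta => // t t' at_ t1 t2 Ct t3 t4.
  have Cs : C s.
    apply: (C1 _ _ Ct t2); have := H (t - s).
    have -> : `|t - s| = s - t by rewrite distrC ger0_norm ?subr_ge0.
    rewrite (_ : s + (t - s) = t); last by rewrite addrC subrK.
    move=> /(_ ltac:(clear -t1; lra)); rewrite ler_norml => /andP[_].
    have : 0 <= (s - t) * l by rewrite mulr_ge0 ?subr_ge0.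
    by clear; lra.
  apply: (C1 _ _ Cs t3); have := H (t' - s).
  have -> : `|t' - s| = t' - s by rewrite ger0_norm ?subr_ge0.
  rewrite (_ : s + (t' - s) = t'); last by rewrite addrC subrK.
  move=> /(_ ltac:(clear -t4; lra)); rewrite ler_norml => /andP[+ _].
  have : 0 <= (t' - s) * l by rewrite mulr_ge0 ?subr_ge0.
  by clear; lra.
have [t [/andP[at_ tb] Ct] st] := sup_adherent eta0 (conj S0 Sub).
have ts : t <= s by apply: ub_le_sup => //; split => //; rewrite at_.
have sbE : s = b.
  apply/eqP; rewrite eq_le sb leNgt; apply/negP => lt_sb.
  pose t' := Num.min b (s + eta / 2).
  have st' : s < t' by rewrite lt_min lt_sb ltrDl divr_gt0.
  have : t' <= s.
    apply: ub_le_sup => //; split.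
      by rewrite (le_trans as_ (ltW st')) ge_min lexx.
    apply: (loc t) => //; first exact: ltW.
    rewrite gt_min; apply/orP; right; rewrite ltrD2l; clear -eta0; lra.
  by rewrite leNgt st'.
have [n [x [y [h1 h2 h3 h4]]]] : C b.
  by rewrite -sbE; apply: (loc t) => //; rewrite ltrDl.
have tI : trivIset setT (fun k : 'I_n => `]x k, y k[%classic).
  move=> i j _ _ [z []] /=; rewrite !in_itv /= => /andP[z1 z2] /andP[z3 z4].
  apply/val_inj/eqP; case: ltngtP => // ij.
    by have := h3 _ _ ij (ltn_ord j); rewrite leNgt (lt_trans z3 z2).
  by have := h3 _ _ ij (ltn_ord i); rewrite leNgt (lt_trans z1 z4).
have hs : \sum_(k < n) (y k - x k) < delta.
  rewrite -lte_fin; apply: le_lt_trans lU; apply: sum_itv_le => // k.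
    by have [_ []] := h1 k (ltn_ord k).
  exact: h2.
have := Hac n (fun k => x k) (fun k => y k) _ tI hs.
move=> /(_ (fun k => h1 k (ltn_ord k))) hfin; move: h4 hfin eE; set sg := \sum_(k < n) _.
by clear; lra.
Qed.

End Monotonicity.

Section Gronwall.
Context {R : realType}.

Fixpoint gronwall_cst (I : R) (n : nat) : R :=
  if n is m.+1 then 2 * (1 + gronwall_cst I m * I) + gronwall_cst I m else 2.

Lemma gronwall_cst_ge0 I n : 0 <= I -> 0 <= gronwall_cst I n.
Proof.
move=> I0; elim: n => //= n IH; apply: addr_ge0 => //; apply: mulr_ge0 => //.
by apply: addr_ge0 => //; exact: mulr_ge0.
Qed.

(** Over a time step on which the kernel has mass at most 1/2, the supremum of
    the solution is controlled by the previous bound. *)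
Lemma gronwall_steps (X : Type) (D : X -> Prop) (w : R -> X -> R) (J : R -> R)
    (L delta I A Mb : R) :
  0 < delta -> 0 <= I -> 0 <= A -> J 0 = 0 -> (forall p, 0 <= J p) ->
  (forall p, 0 <= p -> p <= L -> J p <= I) ->
  (forall s x, 0 <= s -> s <= L -> D x -> w s x <= Mb) ->
  (forall p t M1 M2, 0 <= p -> p <= t -> t <= L -> t - p <= delta ->
    0 <= M1 -> 0 <= M2 ->
    (forall s x, 0 <= s -> s <= p -> D x -> w s x <= M1) ->
    (forall s x, p <= s -> s <= t -> D x -> w s x <= M2) ->
    forall x, D x -> w t x <= A + M1 * J p + M2 / 2) ->
  forall n s x, 0 <= s -> s <= L -> s <= n%:R * delta -> D x ->
    w s x <= gronwall_cst I n * A.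
Proof.
move=> delta0 I0 A0 J0 J_ge0 JI wMb H.
have step p M1 : 0 <= p -> p <= L -> 0 <= M1 ->
    (forall s x, 0 <= s -> s <= p -> D x -> w s x <= M1) ->
    forall t x, p <= t -> t <= L -> t - p <= delta -> D x -> w t x <= 2 * (A + M1 * J p).
  move=> p0 pL M10 hM1 t x pt tL tp Dx.
  pose S := [set u | u = 0 \/ exists s y, [/\ p <= s, s <= t, D y & u = w s y]].
  have S0 : S !=set0 by exists 0; left.
  have Sub : has_ubound S.
    exists (Num.max 0 Mb) => u [->|[s [y [ps st Dy ->]]]]; rewrite le_max ?lexx//.
    by rewrite (wMb s)// ?orbT// ?(le_trans p0)// (le_trans st).
  have SM s y : p <= s -> s <= t -> D y -> w s y <= sup S.
    by move=> ps st Dy; apply: ub_le_sup => //; right; exists s, y.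
  have S00 : 0 <= sup S by apply: ub_le_sup => //; left.
  have hS s y : p <= s -> s <= t -> D y -> w s y <= A + M1 * J p + sup S / 2.
    move=> ps st Dy; apply: (H p s M1 (sup S)) => //.
    - exact: le_trans tL.
    - by apply: le_trans tp; rewrite lerD2r.
    - by move=> s' y' ps' s's; apply: SM => //; exact: le_trans st.
  have Jp_ge0 : 0 <= A + M1 * J p + sup S / 2.
    by apply: addr_ge0; [apply: addr_ge0 => //; apply: mulr_ge0 => //; exact: J_ge0|exact: divr_ge0].
  have wt := hS t x pt (lexx _) Dx.
  have : sup S <= A + M1 * J p + sup S / 2.
    by apply: ge_sup => // u [->//|[s [y [ps st Dy ->]]]]; exact: hS.
  by move: wt; clear; lra.
elim=> [|n IH] s x s0 sL sn Dx.
  have E : s = 0 by apply/eqP; rewrite eq_le s0 andbT; move: sn; rewrite mul0r.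
  have L0 := le_trans s0 sL.
  have := step 0 (Num.max 0 Mb) (lexx _) L0; rewrite le_max lexx /= => /(_ isT).
  rewrite J0 mulr0 addr0 /= => h; apply: h => //.
  - by move=> s' y s'0 s'0' Dy; rewrite le_max (wMb s')// ?orbT// (le_trans s'0').
  - by rewrite E subrr ltW.
have c0 := gronwall_cst_ge0 n I0.
have cA : 0 <= gronwall_cst I n * A by exact: mulr_ge0.
have [sn'|/ltW sn'] := leP s (n%:R * delta).
  apply: le_trans (IH s x s0 sL sn' Dx) _; rewrite /= ler_wpM2r// lerDr mulr_ge0//.
  by rewrite addr_ge0// mulr_ge0.
have p0 : 0 <= n%:R * delta by rewrite mulr_ge0// ltW.
have pL := le_trans sn' sL.
apply: le_trans (step (n%:R * delta) _ p0 pL cA _ s x sn' sL _ Dx) _.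
- by move=> s' y s'0 s'n Dy; apply: IH => //; exact: le_trans pL.
- by rewrite lerBlDl; move: sn; rewrite -natr1 mulrDl mul1r.
rewrite /=; have : gronwall_cst I n * A * J (n%:R * delta) <= gronwall_cst I n * A * I.
  by rewrite ler_wpM2l// JI.
by move: cA; clear; lra.
Qed.

Definition btw (a s b : R) := (a <= s <= b) || (b <= s <= a).

Notation integrableR g := (leb.-integrable setT (EFin \o g)).
Notation K_ k := (prim (fun t => `|k t|)).

(** The hypothesis bounds [w] by its suprema over time intervals and over all
    indices, as it arises when the velocity depends on the whole flow. Finitely
    many time steps, forwards or backwards from [tau], cover the interval, and
    their number depends on the kernel only. *)
Lemma gronwall (T : R) (k : R -> R) : 0 < T -> integrableR k ->
  exists2 C, 0 <= C & forall (X : Type) (D : X -> Prop) (w : R -> X -> R) (tau A Mb : R),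
    0 <= A -> 0 <= tau -> tau <= T ->
    (forall s x, 0 <= s -> s <= T -> D x -> w s x <= Mb) ->
    (forall p t M1 M2, 0 <= p <= T -> 0 <= t <= T -> btw tau p t ->
      0 <= M1 -> 0 <= M2 ->
      (forall s x, btw tau s p -> D x -> w s x <= M1) ->
      (forall s x, btw p s t -> D x -> w s x <= M2) ->
      forall x, D x ->
        w t x <= A + M1 * `|K_ k p - K_ k tau| + M2 * `|K_ k t - K_ k p|) ->
    forall t x, 0 <= t -> t <= T -> D x -> w t x <= C * A.
Proof.
move=> T0 ik; have ikn := integrable_normR ik.
have K_le a b : 0 <= a -> a <= b -> K_ k a <= K_ k b.
  move=> a0 ab; rewrite -subr_ge0; apply: prim_ge0 => //.
  by apply: aeW => t _; exact: normr_ge0.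
have [delta delta0 Hd] := prim_small ik (ltac:(lra) : (0 : R) < 2^-1).
have d2 : 0 < delta / 2 by rewrite divr_gt0.
pose I := K_ k T - K_ k 0.
have I0 : 0 <= I by rewrite subr_ge0; apply: K_le => //; exact: ltW.
pose n := (Num.truncn (T / (delta / 2))).+1.
have Tn : T <= n%:R * (delta / 2) by rewrite -ler_pdivrMr//; exact/ltW/truncnS_gt.
exists (gronwall_cst I n); first exact: gronwall_cst_ge0.
move=> X D w tau A Mb A0 tau0 tauT wMb H t x t0 tT Dx.
have KI p : 0 <= p -> p <= T -> `|K_ k p - K_ k tau| <= I.
  move=> p0 pT; have := K_le 0 p (lexx _) p0; have := K_le p T p0 pT.
  have := K_le 0 tau (lexx _) tau0; have := K_le tau T tau0 tauT.
  by rewrite /I => *; rewrite ler_norml; apply/andP; split; lra.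
have half p q : 0 <= p -> p <= q -> q - p <= delta / 2 -> `|K_ k q - K_ k p| <= 2^-1.
  move=> p0 pq h; rewrite ger0_norm ?subr_ge0; last exact: K_le.
  by apply: ltW; apply: Hd => //; lra.
have fin (M2 u v c : R) : 0 <= M2 -> v <= 2^-1 -> u <= A + c + M2 * v -> u <= A + c + M2 / 2.
  move=> M20 hv /le_trans; apply; rewrite lerD2l; exact: ler_wpM2l.
have [tt|/ltW tt] := leP tau t.
  have -> : t = tau + (t - tau) by rewrite addrC subrK.
  apply: (@gronwall_steps X D (fun s => w (tau + s)) (fun p => `|K_ k (tau + p) - K_ k tau|)
    (T - tau) (delta / 2) I A Mb) => //.
  - by rewrite addr0 subrr normr0.
  - by move=> p p0 pL; apply: KI; lra.
  - by move=> s y s0 sL; apply: wMb; lra.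
  - move=> p q M1 M2 p0 pq qL qp M10 M20 h1 h2 y Dy.
    apply: (fin _ _ _ _ M20 (half (tau + p) (tau + q) _ _ _)); [lra|lra|lra|].
    apply: H => //; [apply/andP; lra|apply/andP; lra|rewrite /btw; apply/orP; left; apply/andP; lra| |].
    + by move=> s z /orP[]/andP[s1 s2] Dz; have := h1 (s - tau) z ltac:(lra) ltac:(lra) Dz; rewrite addrC subrK.
    + by move=> s z /orP[]/andP[s1 s2] Dz; have := h2 (s - tau) z ltac:(lra) ltac:(lra) Dz; rewrite addrC subrK.
  - by rewrite subr_ge0.
  - lra.
  - lra.
have -> : t = tau - (tau - t) by rewrite opprB addrC subrK.
apply: (@gronwall_steps X D (fun s => w (tau - s)) (fun p => `|K_ k (tau - p) - K_ k tau|)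
  tau (delta / 2) I A Mb) => //.
- by rewrite subr0 subrr normr0.
- by move=> p p0 pL; apply: KI; lra.
- by move=> s y s0 sL; apply: wMb; lra.
- move=> p q M1 M2 p0 pq qL qp M10 M20 h1 h2 y Dy.
  apply: (fin _ _ `|K_ k (tau - q) - K_ k (tau - p)| _ M20).
    by rewrite distrC; apply: half; lra.
  apply: H => //; [apply/andP; lra|apply/andP; lra|rewrite /btw; apply/orP; right; apply/andP; lra| |].
  + by move=> s z /orP[]/andP[s1 s2] Dz; have := h1 (tau - s) z ltac:(lra) ltac:(lra) Dz; rewrite opprB addrC subrK.
  + by move=> s z /orP[]/andP[s1 s2] Dz; have := h2 (tau - s) z ltac:(lra) ltac:(lra) Dz; rewrite opprB addrC subrK.
- by rewrite subr_ge0.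
- lra.
- lra.
Qed.

Lemma prim_btw_le g k a b : integrableR g -> integrableR k -> 0 <= a -> 0 <= b ->
  {ae leb, forall s, btw a s b -> `|g s| <= k s} ->
  `|prim g b - prim g a| <= `|prim k b - prim k a|.
Proof.
move=> ig ik a0 b0 h; have [ab|/ltW ba] := leP a b.
  apply: le_trans (ler_norm _); apply: prim_norm_le => //.
  by apply: (ae_imp h) => t {}h ht; apply: h; rewrite /btw ht.
rewrite distrC [leRHS]distrC; apply: le_trans (ler_norm _); apply: prim_norm_le => //.
by apply: (ae_imp h) => t {}h ht; apply: h; rewrite /btw ht orbT.
Qed.

End Gronwall.

(** * The velocity field at a fixed time *)

Section Preliminaries.
Context {R : realType}.

Lemma mxact_row n (A : 'M[R]_n) (u : 'rV[R]_n) i : mxact A u 0 i = dotp (row i A) u.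
Proof. by rewrite /mxact /dotp !mxE; apply: eq_bigr => j _; rewrite !mxE. Qed.

Lemma enorm_row n (A : 'M[R]_n) i : enorm (row i A) <= enorm A.
Proof.
rewrite /enorm big_ord1 [in leRHS](bigD1 i)//=; apply: ler_wsqrtr.
under eq_bigr do rewrite mxE.
by rewrite lerDl; apply: sumr_ge0 => j _; apply: sumr_ge0 => k _; exact: sqr_ge0.
Qed.

Lemma mxact_le n (A : 'M[R]_n) (u : 'rV[R]_n) i : `|mxact A u 0 i| <= enorm A * enorm u.
Proof.
rewrite mxact_row; apply: le_trans (dotp_le _ _) _.
by rewrite ler_wpM2r ?enorm_ge0// enorm_row.
Qed.

Lemma mxactBl n (A B : 'M[R]_n) (u : 'rV[R]_n) i :
  mxact A u 0 i - mxact B u 0 i = mxact (A - B) u 0 i.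
Proof. by rewrite !mxact_row linearB dotpBl. Qed.

Lemma expands_lipschitz (g : R -> R) (c k : R) : expands g 0 c ->
  (exists2 eta, 0 < eta & forall h, `|h| < eta -> `|g h - g 0| <= k * `|h|) -> `|c| <= k.
Proof.
move=> hg [eta eta0 H]; apply/ler_addgt0Pr => e /hg[delta delta0 Hd].
pose h := Num.min eta delta / 2.
have m0 : 0 < Num.min eta delta by rewrite lt_min eta0.
have h0 : 0 < h by rewrite divr_gt0.
have hm : h < Num.min eta delta by rewrite /h; clear -m0; lra.
have nh : `|h| = h by rewrite gtr0_norm.
have := H h; have := Hd h; rewrite nh add0r.
move: hm; rewrite lt_min => /andP[-> ->] /(_ isT) h1 /(_ isT) h2.
rewrite -(ler_pM2l h0); have -> : h * `|c| = `|h * c| by rewrite normrM nh.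
have -> : h * c = (g h - g 0) - (g h - g 0 - h * c) by ring.
by apply: le_trans (ler_normB _ _) _; clear -h1 h2; lra.
Qed.

End Preliminaries.

Section FixedTime.
Context {R : realType} {d : nat}.
Variables (V : Pc R d -> 'rV[R]_d -> 'rV[R]_d)
  (B : Pc R d -> 'rV[R]_d -> 'rV[R]_d -> 'M[R]_d) (r rho l L : R).
Notation K := (cball r : set 'rV[R]_d).
Hypothesis rho0 : 0 <= rho.
Hypotheses (l0 : 0 <= l) (L0 : 0 <= L).
Hypothesis V_lip : forall mu nu x y,
  PP (cball (rho + 1)) mu -> PP (cball (rho + 1)) nu ->
  cball (rho + 1) x -> cball (rho + 1) y ->
  enorm (V mu x - V mu y) <= l * enorm (x - y) /\
  enorm (V mu x - V nu x) <= L * W 1 mu nu.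
Hypothesis V_diff : forall mu x, differentiable (V mu) x.
Hypothesis DV_cont : C0 dist2 (PP (cball rho) `*` cball rho)
  (fun z => (jacobian (V z.1) z.2)^T).
Hypothesis V_grad : forall mu x (i : 'I_d),
  is_gradient (fun nu => V nu x 0 i) mu (fun y => row i (B mu x y)).
Hypothesis B_cont : C0 dist3 (PP (cball rho) `*` cball rho `*` cball rho)
  (fun z => B z.1.1 z.1.2 z.2).

(** The derivative of [V (push f mu) (f x)] when [f] moves in direction [w]. *)
Definition linearisation (mu : Pc R d) (f w : 'rV[R]_d -> 'rV[R]_d)
    (x : 'rV[R]_d) : 'rV[R]_d :=
  mxact (jacobian (V (push K f mu)) (f x))^T (w x) +
  \row_i \int[mu]_(y in K) mxact (B (push K f mu) (f x) (f y)) (w y) 0 i.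

Lemma mxact_jacobian mu x u : mxact (jacobian (V mu) x)^T u = 'd (V mu) x u.
Proof. by rewrite /mxact trmx_mul !trmxK /jacobian mul_rV_lin1. Qed.

Lemma linearisationE mu f w x i : linearisation mu f w x 0 i =
  'd (V (push K f mu)) (f x) (w x) 0 i +
  \int[mu]_(y in K) mxact (B (push K f mu) (f x) (f y)) (w y) 0 i.
Proof. by rewrite mxE mxact_jacobian [X in _ + X]mxE. Qed.

Section Direction.
Variables (mu : Pc R d) (f w : 'rV[R]_d -> 'rV[R]_d) (M : R).
Hypotheses (muK : PP K mu) (uf : ucont r f) (uw : ucont r w).
Hypotheses (M0 : 0 <= M) (wM : forall x, K x -> enorm (w x) <= M).

Let ufh h : ucont r (fun x => f x + h *: w x).
Proof.
have := ucont_lincomb 1 h uf uw; congr (ucont r _).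
by apply/funext => x; rewrite scale1r.
Qed.

(** The derivative at [t] is that of [gradient_expansion] for maps based at
    [f + t w]. *)
Lemma expands_direction x i t :
  expands (fun h => V (push K (fun y => f y + h *: w y) mu) x 0 i) t
    (\int[mu]_(y in K) mxact (B (push K (fun y => f y + t *: w y) mu) x
       (f y + t *: w y)) (w y) 0 i).
Proof.
have [Mf Mf0 fM] := ucont_bounded uf.
have b y : K y -> enorm (f y + t *: w y) + M <= Mf + `|t| * M + M.
  move=> Ky; rewrite lerD2r; apply: le_trans (enormD _ _) _; apply: lerD; first exact: fM.
  by rewrite enormZ ler_wpM2l// wM.
have b0 : 0 <= Mf + `|t| * M + M by rewrite !addr_ge0// mulr_ge0.
have := gradient_expansion muK (ufh t) uw b0 M0 b wM (V_grad _ x i).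
rewrite (_ : \int[mu]_(y in K) dotp _ _ = \int[mu]_(y in K) mxact (B (push K
    (fun y => f y + t *: w y) mu) x (f y + t *: w y)) (w y) 0 i); last first.
  by apply: eq_Rintegral => y _; rewrite mxact_row.
move=> H e /H[delta delta0 Hd]; exists delta => // h /Hd; rewrite add0r.
rewrite (_ : (fun x0 => f x0 + t *: w x0 + h *: w x0) = (fun y => f y + (t + h) *: w y)); last first.
  by apply/funext => y; rewrite scalerDl addrA.
rewrite (_ : (fun x0 => f x0 + t *: w x0 + 0 *: w x0) = (fun y => f y + t *: w y))//.
by apply/funext => y; rewrite scale0r addr0.
Qed.

Lemma integrable_direction x i : mu.-integrable K (EFin \o (fun y : Borel R d =>
  mxact (B (push K f mu) x (f y)) (w y) 0 i)).
Proof.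
have [[L2B _] _] := V_grad (push K f mu) x i.
have iJ := integrable_J muK uf uw M0 wM L2B.
have mK := @measurable_cball R d r.
have := integrableS measurableT mK (@subsetT _ _) iJ.
apply: eq_integrable => // y.
by rewrite inE => Ky /=; rewrite !clipE// mxact_row.
Qed.

Hypothesis fB : forall x, K x -> cball rho (f x).

Let lamB : PP (cball rho) (push K f mu).
Proof. exact: push_PP. Qed.

Let f0 : (fun y => f y + 0 *: w y) = f.
Proof. by apply/funext => y; rewrite scale0r addr0. Qed.

(** Both terms are derivatives of Lipschitz functions along a line, on which
    the point and the measure move with speed at most [M]. *)
Lemma linearisation_le x i : K x -> `|linearisation mu f w x 0 i| <= (l + L) * M.
Proof.
move=> Kx; have fx := fB Kx.
have s1 : cball rho `<=` (cball (rho + 1) : set 'rV[R]_d).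
  by apply: cball_sub; rewrite lerDl.
pose eta := (M + 1)^-1.
have M10 : 0 < M + 1 by rewrite ltr_wpDl.
have eta0 : 0 < eta by rewrite invr_gt0.
have etaM h : `|h| < eta -> `|h| * M <= 1.
  move=> hh; apply: (@le_trans _ _ (eta * (M + 1))); last by rewrite mulVf ?gt_eqF.
  by apply: ler_pM => //; [exact: ltW|rewrite lerDl].
have moved h y : `|h| < eta -> K y -> cball (rho + 1) (f y + h *: w y).
  move=> /etaM hh Ky; apply: le_trans (enormD _ _) _; apply: lerD; first exact: fB.
  by apply: le_trans hh; rewrite enormZ ler_wpM2l// wM.
rewrite mxE; apply: le_trans (ler_normD _ _) _; rewrite mulrDl; apply: lerD.
  rewrite mxact_jacobian.
  have h1 : expands (fun h => V (push K f mu) (f x + h *: w x) 0 i) 0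
      ('d (V (push K f mu)) (f x + 0 *: w x) (w x) 0 i) by exact: expands_line.
  rewrite scale0r addr0 in h1; apply: (expands_lipschitz h1).
  exists eta => // h hh; rewrite scale0r addr0.
  have := coord_le_enorm (V (push K f mu) (f x + h *: w x) - V (push K f mu) (f x)) 0 i.
  rewrite !mxE => h2; apply: (le_trans h2).
  have pl : PP (cball (rho + 1)) (push K f mu) by move=> z /lamB /s1.
  have [h3 _] := V_lip pl pl (moved h x hh Kx) (s1 _ fx).
  apply: (le_trans h3); rewrite (addrC (f x)) addrK enormZ -mulrA ler_wpM2l//.
  by rewrite mulrC ler_wpM2r// wM.
rewrite mxE.
have h1 := expands_direction (f x) i 0.
rewrite f0 in h1.
have E : \int[mu]_(y in K) mxact (B (push K f mu) (f x) (f y + 0 *: w y)) (w y) 0 i =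
    \int[mu]_(y in K) mxact (B (push K f mu) (f x) (f y)) (w y) 0 i.
  by apply: eq_Rintegral => y _; rewrite scale0r addr0.
rewrite E in h1; apply: (expands_lipschitz h1).
exists eta => // h hh; rewrite f0.
have := coord_le_enorm (V (push K (fun y => f y + h *: w y) mu) (f x) - V (push K f mu) (f x)) 0 i.
rewrite !mxE => h2; apply: (le_trans h2).
have pl : PP (cball (rho + 1)) (push K f mu) by move=> z /lamB /s1.
have ph : PP (cball (rho + 1)) (push K (fun y => f y + h *: w y) mu).
  by apply: push_PP => // y; exact: moved.
have [_ h3] := V_lip ph pl (s1 _ fx) (s1 _ fx).
apply: (le_trans h3); rewrite -mulrA ler_wpM2l//; apply: W1_push => //.
  by rewrite mulr_ge0.
by move=> y Ky; rewrite opprD addNKr enormN enormZ mulrC ler_wpM2r// wM.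
Qed.

End Direction.

Lemma linearisation_lincomb mu f w1 w2 M (a b : R) x i : PP K mu -> ucont r f ->
  ucont r w1 -> ucont r w2 -> 0 <= M ->
  (forall x, K x -> enorm (w1 x) <= M) -> (forall x, K x -> enorm (w2 x) <= M) ->
  linearisation mu f (fun y => a *: w1 y + b *: w2 y) x 0 i =
  a * linearisation mu f w1 x 0 i + b * linearisation mu f w2 x 0 i.
Proof.
move=> muK uf u1 u2 M0 m1 m2.
have mK := @measurable_cball R d r.
have i1 := integrable_direction muK uf u1 M0 m1 (f x) i.
have i2 := integrable_direction muK uf u2 M0 m2 (f x) i.
rewrite !linearisationE linearD !linearZ /=.
set D1 := 'd _ _ (w1 x); set D2 := 'd _ _ (w2 x); rewrite !mxE.
have -> : \int[mu]_(y in K) mxact (B (push K f mu) (f x) (f y)) (a *: w1 y + b *: w2 y) 0 i =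
    a * \int[mu]_(y in K) mxact (B (push K f mu) (f x) (f y)) (w1 y) 0 i +
    b * \int[mu]_(y in K) mxact (B (push K f mu) (f x) (f y)) (w2 y) 0 i.
  rewrite -!RintegralZl// -RintegralD//.
  - by apply: eq_Rintegral => y _; rewrite !mxact_row dotpDr !dotpZr.
  - have := integrableZl mK a i1; congr (_.-integrable _ _); exact/funext.
  - have := integrableZl mK b i2; congr (_.-integrable _ _); exact/funext.
by ring.
Qed.

(** The remainder is uniformly small: by the mean value theorem it is
    controlled by the oscillation of the derivatives between two close maps. *)
Lemma linearisation_remainder e : 0 < e -> exists2 delta, 0 < delta &
  forall mu f g M, PP K mu -> ucont r f -> ucont r g ->
    (forall x, K x -> cball rho (f x)) -> (forall x, K x -> cball rho (g x)) ->
    0 <= M -> M <= delta -> (forall x, K x -> enorm (g x - f x) <= M) ->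
    forall x i, K x ->
      `|V (push K g mu) (g x) 0 i - V (push K f mu) (f x) 0 i
        - linearisation mu f (fun y => g y - f y) x 0 i| <= e * M.
Proof.
move=> e0; have e2 : 0 < e / 2 by rewrite divr_gt0.
have DV3 : C0 dist3 (PP (cball rho) `*` cball rho `*` cball rho)
    (fun z : Pc R d * 'rV[R]_d * 'rV[R]_d => (jacobian (V z.1.1) z.1.2)^T).
  move=> [[m0 x0] y0] [[hm hx] hy] e' /(DV_cont (conj hm hx : (PP _ `*` cball _) (m0, x0)))[delta d0 H].
  exists delta => // -[[m1 x1] y1] [[hm1 hx1] hy1] hd; apply: (H (m1, x1)) => //.
  by apply: le_lt_trans hd; rewrite /dist3 /= lerDl enorm_ge0.
have [d1 d10 H1] := C0_uniform r (G := fun mu x _ => (jacobian (V mu) x)^T) rho0 DV3 e2.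
have [d2 d20 H2] := C0_uniform r rho0 B_cont e2.
exists (Num.min d1 d2); first by rewrite lt_min d10.
move=> mu f g M muK uf ug fB gB M0; rewrite le_min => /andP[M1 M2] gf x i Kx.
pose w y := g y - f y.
have uw : ucont r w.
  have := ucont_lincomb 1 (-1) ug uf; congr (ucont r _).
  by apply/funext => y; rewrite scale1r scaleN1r.
have segE c y : f y + c *: w y = f y + c *: (g y - f y) by [].
have g1 : (fun y => f y + 1 *: w y) = g.
  by apply/funext => y; rewrite scale1r /w addrC subrK.
have f0 : (fun y => f y + 0 *: w y) = f.
  by apply/funext => y; rewrite scale0r addr0.
have mK := @measurable_cball R d r.
(* moving the point *)
have [c1 c101 E1] := mvt_line (f x) (g x) i (V_diff (push K g mu)).
have hx : `|V (push K g mu) (g x) 0 i - V (push K g mu) (f x) 0 i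
    - mxact (jacobian (V (push K f mu)) (f x))^T (w x) 0 i| <= e / 2 * M.
  rewrite E1 -mxact_jacobian -/(w x).
  rewrite mxactBl.
  apply: le_trans (mxact_le _ _ _) _; apply: ler_pM; rewrite ?enorm_ge0//; last exact: gf.
  apply: (H1 mu f g (f x) (f x + c1 *: (g x - f x)) (f x) (f x)) => //.
  - by move=> z Kz; exact: le_trans (gf z Kz) M1.
  - exact: fB.
  - by apply: cball_segment => //; [exact: fB|exact: gB].
  - exact: fB.
  - exact: fB.
  - rewrite addrC addKr enormZ; apply: le_trans M1; have /andP[c1_0 c1_1] := c101.
    rewrite ger0_norm//; apply: le_trans (gf x Kx).
    by rewrite -[leRHS]mul1r ler_wpM2r ?enorm_ge0.
  - by rewrite subrr enorm0 ltW.
(* moving the measure *)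
have [c c01 E2] := expands_mvt (fun t => expands_direction muK uf uw M0 gf (f x) i t).
rewrite g1 f0 in E2.
pose fc y := f y + c *: w y.
have ufc : ucont r fc.
  have := ucont_lincomb 1 c uf uw; congr (ucont r _).
  by apply/funext => y; rewrite scale1r.
have fcB y : K y -> cball rho (fc y).
  by move=> Ky; apply: cball_segment => //; [exact: fB|exact: gB].
have fcM y : K y -> enorm (fc y - f y) <= M.
  move=> Ky; rewrite /fc addrC addKr enormZ; have /andP[c_0 c_1] := c01.
  rewrite ger0_norm//; apply: le_trans (gf y Ky).
  by rewrite -[leRHS]mul1r ler_wpM2r ?enorm_ge0.
have ic := integrable_direction muK ufc uw M0 gf (f x) i.
have if_ := integrable_direction muK uf uw M0 gf (f x) i.
have hmu : `|V (push K g mu) (f x) 0 i - V (push K f mu) (f x) 0 i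
    - \int[mu]_(y in K) mxact (B (push K f mu) (f x) (f y)) (w y) 0 i| <= e / 2 * M.
  rewrite E2 -RintegralB//.
  have iB : mu.-integrable K (EFin \o (fun y : Borel R d =>
      mxact (B (push K fc mu) (f x) (fc y)) (w y) 0 i - mxact (B (push K f mu) (f x) (f y)) (w y) 0 i)).
    have := integrableB mK ic if_; congr (_.-integrable _ _); exact/funext.
  apply: le_trans (le_normr_Rintegral mK iB) _.
  have -> : e / 2 * M = \int[mu]_(y in K) (cst (e / 2 * M) y).
    by rewrite Rintegral_cst// [X in fine X](PP_full muK) mulr1.
  apply: le_Rintegral => //.
  - have := integrable_norm iB; exact.
  - apply: integrableS measurableT mK (@subsetT _ _) _.
    exact: finite_measure_integrable_cst.
  - move=> y Ky; rewrite /cst.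
    rewrite mxactBl.
    apply: le_trans (mxact_le _ _ _) _; apply: ler_pM; rewrite ?enorm_ge0//; last exact: gf.
    apply: (H2 mu f fc (f x) (f x) (f y) (fc y)) => //.
    + by move=> z Kz; exact: le_trans (fcM z Kz) M2.
    + exact: fB.
    + exact: fB.
    + exact: fB.
    + exact: fcB.
    + by rewrite subrr enorm0 ltW.
    + exact: le_trans (fcM y Ky) M2.
rewrite /linearisation mxE [(\row__ _) 0 i]mxE -/w.
have -> : e * M = e / 2 * M + e / 2 * M by field.
set a1 := V _ (g x) 0 i in hx *; set a2 := V _ (f x) 0 i in hx hmu.
set a3 := V (push K f mu) (f x) 0 i in hmu *.
set b1 := mxact _ _ 0 i in hx *; set b2 := \int[mu]_(y in K) _ in hmu *.
have -> : a1 - a3 - (b1 + b2) = (a1 - a2 - b1) + (a2 - a3 - b2) by ring.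
by apply: le_trans (ler_normD _ _) _; exact: lerD.
Qed.

End FixedTime.

(** * Measurability and averages in time *)

Section TimeMeasurability.
Context {R : realType}.
Implicit Types (T t s : R) (f g k : R -> R).

Notation integrableR g := (leb.-integrable setT (EFin \o g)).

Lemma ae_forall_nat (Q : nat -> R -> Prop) :
  (forall n, {ae leb, forall t, Q n t}) -> {ae leb, forall t, forall n, Q n t}.
Proof.
move=> h; have := negligible_bigcup h; apply: negligibleS => t /= nQ.
by apply: contrapT => h'; apply: nQ => n; apply: contrapT => h''; apply: h'; exists n.
Qed.

Lemma L1_nonneg_rep T f : L1_nonneg T f ->
  exists2 g, represents T f g & forall t, 0 <= g t.
Proof.
move=> [f0 [g ig fg]].
have m0T : measurable (`[0, T]%classic : set R) by exact: measurable_itv.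
pose g1 := g \_ `[0, T].
exists (fun t => `|g1 t|) => //; split.
  apply: integrable_normR.
  have /integrable_mkcond := ig; move=> /(_ m0T).
  congr (_.-integrable _ _); apply/funext => t /=.
  by rewrite /g1 !patchE; case: ifP.
apply: (ae_imp fg) => t {}fg t0T; rewrite /g1 patchE mem_set//.
by rewrite -fg// ger0_norm// f0.
Qed.

Lemma dominated_rep T f m gm c : represents T m gm -> (forall t, 0 <= gm t) -> 0 <= c ->
  Lmeasurable T f -> {ae leb, forall t, t \in `[0, T] -> `|f t| <= c * m t} ->
  exists2 g, represents T f g & forall t, `|g t| <= c * gm t.
Proof.
move=> [im mgm] gm0 c0 [g mg fg] fc.
have m0T : measurable (`[0, T]%classic : set R) by exact: measurable_itv.
have mgm' D : measurable_fun D gm.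
  by apply: measurable_funTS; move/integrableP: im => [/measurable_EFinP].
(* the representative is truncated where the domination fails *)
pose g1 t := if `|(g \_ `[0, T]) t| <= c * gm t then (g \_ `[0, T]) t else 0.
have mg0 : measurable_fun setT (g \_ `[0, T]).
  by apply/(measurable_restrictT _ m0T).
have mg1 : measurable_fun setT g1.
  apply: measurable_fun_ifT => //; apply: measurable_fun_ler.
    exact: measurableT_comp.
  exact: measurable_funM.
have g1c t : `|g1 t| <= c * gm t.
  by rewrite /g1; case: ifP => // _; rewrite normr0 mulr_ge0.
exists g1 => //; split.
  have ic : integrableR (fun t => c * gm t).
    have := integrableZl measurableT c im.
    by congr (_.-integrable _ _); apply/funext => t /=.
  apply: (le_integrable measurableT _ _ ic); first exact/measurable_EFinP.
  by move=> t _ /=; rewrite lee_fin [leRHS]ger0_norm ?mulr_ge0.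
apply: (ae_imp (ae_and fg (ae_and fc mgm))) => t [h1 [h2 h3]] t0T.
rewrite /g1 patchE mem_set// -h1//.
by have := h2 t0T; rewrite h3// => ->.
Qed.

(** A function of two times which is measurable in the second one and
    continuous in the first one on the diagonal is measurable along the
    diagonal: it is the limit of its values with the first time rounded. *)
Lemma Lmeasurable_diagonal T (F : R -> R -> R) :
  (forall s, s \in `[0, T] -> Lmeasurable T (F s)) ->
  {ae leb, forall t, t \in `[0, T] -> forall e, 0 < e -> exists2 delta, 0 < delta &
    forall s, s \in `[0, T] -> `|s - t| < delta -> `|F s t - F t t| < e} ->
  Lmeasurable T (fun t => F t t).
Proof.
move=> mF cF.
have m0T : measurable (`[0, T]%classic : set R) by exact: measurable_itv.
have /choice[G GP] : forall s, exists g, s \in `[0, T] ->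
    measurable_fun `[0, T] g /\ {ae leb, forall t, t \in `[0, T] -> F s t = g t}.
  move=> s; have [/mF[g mg fg]|h] := boolP (s \in `[0, T]); first by exists g.
  by exists (fun=> 0).
pose node (n j : nat) : R := j%:R / n.+1%:R.
pose idx n t := Num.truncn (t * n.+1%:R).
have n0 (n : nat) : 0 < n.+1%:R :> R by [].
have idxP n t : 0 <= t -> node n (idx n t) <= t < node n (idx n t) + n.+1%:R^-1.
  move=> t0; have /truncn_itv/andP[h1 h2] : 0 <= t * n.+1%:R by rewrite mulr_ge0.
  rewrite /node ler_pdivrMr// h1 /= -{2}[n.+1%:R^-1]mul1r -mulrDl ltr_pdivlMr//.
  by rewrite natr1.
pose H n t := if node n (idx n t) <= T then G (node n (idx n t)) t else 0.
have node0T n j : node n j <= T -> node n j \in `[0, T].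
  by move=> h; rewrite in_itv /= h andbT divr_ge0.
have mH n : measurable_fun `[0, T] (H n).
  pose I j := `[node n j, node n j + n.+1%:R^-1[%classic : set R.
  have cover : `[0, T]%classic = \bigcup_j (`[0, T] `&` I j) :> set R.
    apply/seteqP; split=> [t t0T|t [j _ []]//].
    exists (idx n t) => //; split => //; rewrite /I /= in_itv /=; apply: idxP.
    by move: t0T; rewrite /= in_itv /= => /andP[].
  rewrite cover; apply/measurable_fun_bigcup.
    by move=> j; apply: measurableI => //; exact: measurable_itv.
  move=> j.
  have idxE t : (`[0, T] `&` I j) t -> idx n t = j.
    move=> [] /=; rewrite !in_itv /= => /andP[t0 _] /andP[h1 h2].
    have /andP[h3 h4] := idxP n t t0.
    have : node n j < node n (idx n t).+1.
      by rewrite /node -[(idx n t).+1%:R]natr1 mulrDl mul1r; exact: le_lt_trans h4.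
    have : node n (idx n t) < node n j.+1.
      by rewrite /node -[j.+1%:R]natr1 mulrDl mul1r; exact: le_lt_trans h2.
    rewrite /node !ltr_pM2r ?invr_gt0// !ltr_nat !ltnS => h5 h6.
    by apply/eqP; rewrite eqn_leq h5 h6.
  have [nT|nT] := boolP (node n j <= T).
    apply: (eq_measurable_fun (G (node n j))).
      by move=> t; rewrite inE => /idxE E; rewrite /H E nT.
    have [mG _] := GP _ (node0T _ _ nT).
    by apply: measurable_funS mG => // t [].
  apply: (@eq_measurable_fun _ _ _ _ _ (fun=> 0 : R)); last exact: measurable_cst.
  by move=> t; rewrite inE => /idxE E; rewrite /H E (negbTE nT).
have HF : {ae leb, forall t, t \in `[0, T] -> forall n, H n t = F (node n (idx n t)) t}.
  have hh n j : {ae leb, forall t, node n j <= T -> t \in `[0, T] -> F (node n j) t = G (node n j) t}.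
    have [nT|nT] := boolP (node n j <= T); last first.
      by apply: aeW.
    by have [_ h] := GP _ (node0T _ _ nT); apply: (ae_imp h) => t {}h _; exact: h.
  have := ae_forall_nat (fun n => ae_forall_nat (hh n)).
  move/ae_imp; apply => t h t0T n.
  have t0T' := t0T; move: t0T'; rewrite in_itv /= => /andP[t0 tT].
  have /andP[h1 _] := idxP n t t0.
  by rewrite /H (le_trans h1 tT) -h// (le_trans h1 tT).
have [N [mN N0 sN]] := ae_and HF cF.
exists (fun t => if t \in N then 0 else F t t); last first.
  exists N; split => // t /= h; apply: contrapT => nN; apply: h => _.
  by rewrite memNset.
pose H' n t := if t \in N then 0 else H n t.
apply: (@measurable_fun_cvg _ _ _ _ H') => [n|t t0T].
  apply: measurable_fun_if => //; last by apply: measurable_funS (mH n) => // x [].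
  apply: (@measurable_fun_bool _ _ _ _ true).
  rewrite (_ : _ @^-1` _ = N); first exact: measurableI.
  by apply/seteqP; split=> x /=; [move/set_mem|move/mem_set].
rewrite /H'; case: ifPn => [_|/negP tN]; first exact: cvg_cst.
have [h1 h2] : (t \in `[0, T] -> forall n, H n t = F (node n (idx n t)) t) /\
   (t \in `[0, T] -> forall e, 0 < e -> exists2 delta, 0 < delta &
    forall s, s \in `[0, T] -> `|s - t| < delta -> `|F s t - F t t| < e).
  by apply: contrapT => h; apply: tN; apply/mem_set/sN.
have t0T' := t0T; move: t0T'; rewrite /= in_itv /= => /andP[t0 tT].
apply/cvgrPdist_lt => e /(h2 t0T)[delta delta0 Hd].
have [n1 _ Hn] := near_infty_natSinv_lt (PosNum delta0).
exists n1 => // n /= /Hn /= hn; rewrite distrC h1//; apply: Hd.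
  by apply: node0T; have /andP[h3 _] := idxP n t t0; exact: le_trans tT.
have /andP[h3 h4] := idxP n t t0.
rewrite distrC ger0_norm ?subr_ge0//; apply: le_lt_trans hn.
by rewrite lerBlDl; exact: ltW.
Qed.

Lemma lebesgue_limit_bound tau (G : R -> \bar R) : lebesgue_limit tau G ->
  forall e, 0 < e -> exists2 delta, 0 < delta & forall h, 0 < `|h| -> `|h| < delta ->
  (\int[leb]_(t in `[(Num.min tau (tau + h))%R, (Num.max tau (tau + h))%R]) G t <= (e * `|h|)%:E)%E.
Proof.
move=> lim e e0.
have : \forall h \near (0 : R)^', ((`|h|^-1)%:E * \int[leb]_(t in `[(Num.min tau (tau + h))%R, (Num.max tau (tau + h))%R]) G t < e%:E)%E.
  have : nbhs (0%E : \bar R) [set x | (x < e%:E)%E].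
    by apply: open_nbhs_nbhs; split; [exact: open_ereal_lt_ereal|rewrite /= lte_fin].
  by move/lim.
move=> /nbhs_ballP[delta /= delta0 H]; exists delta => // h h0 hd.
have := H h; rewrite /ball /= sub0r normrN => /(_ hd).
rewrite -normr_gt0 => /(_ h0).
rewrite -lte_pdivlMl ?invr_gt0// invrK => /ltW.
by rewrite -EFinM mulrC.
Qed.

(** At a Lebesgue point the increments of the primitive are equivalent to
    those of the affine function. *)
Lemma lebesgue_increment T f g (c e1 e2 tau h : R) (G : R -> \bar R) : represents T f g ->
  tau \in `[0, T] -> tau + h \in `[0, T] -> 0 <= e1 -> 0 <= e2 ->
  (forall s, btw tau s (tau + h) -> ((Num.max 0 (`|f s - c| - e1))%:E <= G s)%E) ->
  (\int[leb]_(t in `[(Num.min tau (tau + h))%R, (Num.max tau (tau + h))%R]) G t <= (e2 * `|h|)%:E)%E ->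
  `|prim g (tau + h) - prim g tau - h * c| <= (e1 + e2) * `|h|.
Proof.
move=> [ig fg] tau0T th0T e10 e20 fG hG.
set a := Num.min tau (tau + h) in hG; set b := Num.max tau (tau + h) in hG.
have [a0 bT] : 0 <= a /\ b <= T.
  move: tau0T th0T; rewrite !in_itv /= => /andP[? ?] /andP[? ?].
  by rewrite /a /b le_min ge_max; split; apply/andP.
have ab : a <= b by rewrite /a /b ge_min le_max lexx.
have bE : b - a = `|h|.
  rewrite /a /b; have [h0|/ltW h0] := leP 0 h.
    have : tau <= tau + h by rewrite lerDl.
    by move=> th; rewrite min_l// max_r// addrC addKr ger0_norm.
  have : tau + h <= tau by rewrite gerDl.
  by move=> th; rewrite min_r// max_l// opprD addNKr ler0_norm.
have btwE s : a <= s <= b -> btw tau s (tau + h).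
  rewrite /btw /a /b; have [th|/ltW th] := leP tau (tau + h).
    by move=> ->.
  by move=> ->; rewrite orbT.
have mI : measurable (`[a, b]%classic : set R) by exact: measurable_itv.
have mI' : @measurable _ (g_sigma_algebraType R.-ocitv.-measurable) `[a, b]%classic by exact: mI.
have mg D : measurable_fun D g.
  by apply: measurable_funTS; move/integrableP: ig => [/measurable_EFinP].
pose ex (u : R) := Num.max 0 (`|u - c| - e1).
have mex : measurable_fun setT ex.
  apply: measurable_maxr => //; apply: measurable_funB => //.
  by apply: measurableT_comp => //; exact: measurable_funB.
have mexg D : measurable_fun D (fun s => ex (g s)).
  apply: measurable_funTS; exact: (measurableT_comp mex (mg setT)).
have iab c' : integrableR (fun s => c' * \1_(`[a, b]%classic : set R) s).
  have : leb.-integrable `[a, b] (EFin \o (fun=> c')).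
    apply: continuous_compact_integrable; first exact: segment_compact.
    by apply: continuous_subspaceT => x; exact: cst_continuous.
  move/integrable_mkcond => /(_ mI); congr (_.-integrable _ _); apply/funext => s /=.
  by rewrite patchE indicE; case: ifP; rewrite ?mulr1 ?mulr0.
have iE : leb.-integrable `[a, b] (EFin \o (fun s => ex (g s))).
  have i1 : leb.-integrable `[a, b] (EFin \o (fun s => `|g s| + `|c|)).
    have := integrableD mI' (integrable_itv `[a, b] (integrable_normR ig)) (integrable_itv `[a, b] (iab `|c|)).
    apply: eq_integrable => // s; rewrite inE => sab /=.
    by rewrite indicE mem_set// mulr1.
  apply: (le_integrable mI' _ _ i1); first by apply/measurable_EFinP; exact: mexg.
  move=> s sab /=; rewrite lee_fin [leRHS]ger0_norm; last by rewrite addr_ge0.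
  rewrite ger0_norm /ex; last by rewrite le_max lexx.
  rewrite ge_max addr_ge0//=; apply: le_trans (ler_normB _ _).
  by rewrite gerBl.
have hex : \int[leb]_(s in `[a, b]) ex (g s) <= e2 * `|h|.
  rewrite /Rintegral -lee_fin fineK; last exact: integrable_fin_num.
  apply: le_trans hG.
  have <- : (\int[leb]_(s in `[a, b]) (ex (f s))%:E = \int[leb]_(s in `[a, b]) (ex (g s))%:E)%E.
    apply: ge0_ae_eq_lower_integral => //.
    - by apply/measurable_EFinP; exact: mexg.
    - by move=> s _; rewrite lee_fin le_max lexx.
    - by move=> s _; rewrite lee_fin le_max lexx.
    - apply: (ae_imp fg) => s {}fg; rewrite /= in_itv /= => /andP[s1 s2].
      by rewrite fg// in_itv /= (le_trans a0 s1) (le_trans s2 bT).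
  apply: lower_integral_le => s; rewrite /= in_itv /= => sab.
    by rewrite lee_fin le_max lexx.
  exact/fG/btwE.
have key : `|prim g b - prim g a - (b - a) * c| <= (e1 + e2) * `|h|.
  have cE : (b - a) * c = \int[leb]_(s in `[a, b]) (cst c s).
    rewrite Rintegral_cst// mulrC; congr (_ * _).
    have := lebesgue_measure_itv `[a, b]; rewrite /= lte_fin => ->.
    by case: ltP => [//|h']; rewrite (_ : b = a) ?subrr//; apply/eqP; rewrite eq_le h'.
  have ic : leb.-integrable `[a, b] (EFin \o cst c).
    have := integrable_itv `[a, b] (iab c).
    by apply: eq_integrable => // s; rewrite inE => sab /=; rewrite indicE mem_set// mulr1.
  have ie1 : leb.-integrable `[a, b] (EFin \o cst e1).
    have := integrable_itv `[a, b] (iab e1).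
    by apply: eq_integrable => // s; rewrite inE => sab /=; rewrite indicE mem_set// mulr1.
  have igc : leb.-integrable `[a, b] (EFin \o (fun s => g s - c)).
    have := integrableB mI' (integrable_itv `[a, b] ig) ic.
    by congr (_.-integrable _ _); exact/funext.
  rewrite primB// cE -RintegralB//; last exact: (integrable_itv `[a, b] ig).
  apply: le_trans (le_normr_Rintegral mI' igc) _.
  apply: (@le_trans _ _ (\int[leb]_(s in `[a, b]) (e1 + ex (g s)))).
    apply: le_Rintegral => //.
    - have := integrable_norm igc; exact.
    - have := integrableD mI' ie1 iE.
      by congr (_.-integrable _ _); exact/funext.
    - move=> s _; rewrite -lerBlDl /ex le_max; apply/orP; right; exact: lexx.
  rewrite RintegralD//.
  have -> : \int[leb]_(s in `[a, b]) e1 = (b - a) * e1.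
    rewrite Rintegral_cst// mulrC; congr (_ * _).
    have := lebesgue_measure_itv `[a, b]; rewrite /= lte_fin => ->.
    by case: ltP => [//|h']; rewrite (_ : b = a) ?subrr//; apply/eqP; rewrite eq_le h'.
  by rewrite bE mulrC mulrDl lerD2l.
have [h0|/ltW h0] := leP 0 h.
  have th : tau <= tau + h by rewrite lerDl.
  have nh : `|h| = h by rewrite ger0_norm.
  by move: key; rewrite bE nh /a /b min_l// max_r.
have th : tau + h <= tau by rewrite gerDl.
have nh : `|h| = - h by rewrite ler0_norm.
move: key; rewrite bE nh /a /b min_r// max_l// -normrN.
by congr (`|_| <= _); ring.
Qed.

End TimeMeasurability.

(** * Bounds on the flow *)

Section FlowBounds.
Context {R : realType} {d : nat}.
Variables (T : R) (v : R -> Pc R d -> 'rV[R]_d -> 'rV[R]_d)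
  (Dmuv : R -> Pc R d -> 'rV[R]_d -> 'rV[R]_d -> 'M[R]_d) (m : R -> R) (r : R)
  (Phi : R -> R -> Pc R d -> 'rV[R]_d -> 'rV[R]_d).
Hypotheses (T0 : 0 < T) (r0 : 0 < r) (hCE : CE T v Dmuv m).
Notation K := (cball r : set 'rV[R]_d).
Hypothesis hPhi : nonlocal_flow T v K Phi.

Definition path_velocity (F : R -> 'rV[R]_d -> 'rV[R]_d) (mu : Pc R d)
    (x : 'rV[R]_d) (i : 'I_d) (s : R) : R := v s (push K (F s) mu) (F s x) 0 i.

Lemma path_velocity_growth F mu x i M : PP K mu -> ucont2 T r F -> K x -> 0 <= M ->
  (forall s y, s \in `[0, T] -> K y -> enorm (F s y) <= M) ->
  {ae leb, forall s, s \in `[0, T] -> `|path_velocity F mu x i s| <= (1 + M + M) * m s}.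
Proof.
move=> muK uF Kx M0 FM; apply: (ae_imp (CE_growth hCE)) => s h s0T.
apply: le_trans (coord_le_enorm _ _ _) _; apply: le_trans (h s0T _ _) _.
have [m0 _] := CE_m hCE; rewrite mulrC ler_wpM2r ?m0//.
apply: lerD; first by rewrite lerD2l FM.
apply: M1_push => //; first exact: ucont2_slice uF.
by move=> y; exact: FM.
Qed.

(** Measurability is that of [Lmeasurable_diagonal]: at almost every time the
    velocity is continuous in the measure and in the point, both of which
    depend continuously on time. *)
Lemma path_velocity_rep F mu x i M gm : PP K mu -> ucont2 T r F -> K x -> 0 <= M ->
  (forall s y, s \in `[0, T] -> K y -> enorm (F s y) <= M) ->
  represents T m gm -> (forall t, 0 <= gm t) ->
  exists2 g, represents T (path_velocity F mu x i) g &
    forall t, `|g t| <= (1 + M + M) * gm t.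
Proof.
move=> muK uF Kx M0 FM mgm gm0.
apply: (dominated_rep mgm gm0) => //; first by rewrite !addr_ge0.
  pose G s t := v t (push K (F s) mu) (F s x) 0 i.
  apply: (@Lmeasurable_diagonal _ T G) => [s s0T|]; first exact: CE_measurable hCE _ _ _.
  have M1 : 0 < M + 1 by rewrite ltr_wpDl.
  have [l [L [_ _ hlL]]] := CE_lipschitz hCE M1.
  apply: (ae_imp hlL) => t {}hlL t0T e e0.
  have c0 : 0 < `|l t| + `|L t| + 1 by rewrite ltr_wpDl// addr_ge0.
  pose e' := e / (`|l t| + `|L t| + 1).
  have e'0 : 0 < e' by rewrite divr_gt0.
  have [delta delta0 Hd] := uF _ e'0; exists delta => // s s0T st.
  have FB u y : u \in `[0, T] -> K y -> cball (M + 1) (F u y).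
    by move=> u0 Ky; apply: le_trans (FM u y u0 Ky) _; rewrite lerDl.
  have us u : u \in `[0, T] -> ucont r (F u) by move=> u0; exact: ucont2_slice uF.
  have pp u : u \in `[0, T] -> PP (cball (M + 1)) (push K (F u) mu).
    by move=> u0; apply: push_PP => //; [exact: us|move=> y; exact: FB].
  have close y : K y -> enorm (F t y - F s y) < e'.
    by move=> Ky; rewrite enormB; apply: Hd => //; rewrite subrr enorm0.
  have [h1 h2] := hlL t0T _ _ _ _ (pp s s0T) (pp t t0T) (FB s x s0T Kx) (FB t x t0T Kx).
  have [_ h2'] := hlL t0T _ _ _ _ (pp s s0T) (pp t t0T) (FB t x t0T Kx) (FB t x t0T Kx).
  have W1 : W 1 (push K (F s) mu) (push K (F t) mu) <= e'.
    apply: W1_push => //; [exact: us|exact: us|exact: ltW|by move=> y Ky; exact/ltW/close].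
  rewrite /G; have := coord_le_enorm (v t (push K (F s) mu) (F s x) - v t (push K (F t) mu) (F t x)) 0 i.
  rewrite !mxE => /le_lt_trans; apply.
  apply: le_lt_trans (enorm_trans (v t (push K (F s) mu) (F t x)) _ _) _.
  have -> : e = (`|l t| + `|L t| + 1) * e' by rewrite /e' mulrC divfK// gt_eqF.
  rewrite !mulrDl mul1r; apply: (@le_lt_trans _ _ (`|l t| * e' + `|L t| * e')); last by rewrite ltrDl.
  apply: lerD.
    apply: le_trans h1 _; apply: le_trans (_ : `|l t| * enorm (F s x - F t x) <= _).
      by rewrite ler_wpM2r ?enorm_ge0// ler_norm.
    by rewrite ler_wpM2l// enormB; exact/ltW/close.
  apply: le_trans h2' _; apply: le_trans (_ : `|L t| * W 1 (push K (F s) mu) (push K (F t) mu) <= _).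
    by rewrite ler_wpM2r ?W_ge0// ler_norm.
  exact: ler_wpM2l.
exact: path_velocity_growth.
Qed.

Lemma flow_ucont2 tau mu : tau \in `[0, T] -> PP K mu ->
  ucont2 T r (fun t => Phi tau t mu).
Proof. by move=> t0 muK; apply: within_ucont2; exact: (hPhi t0 muK).1. Qed.

Lemma flow_integral tau mu x i g : tau \in `[0, T] -> PP K mu -> K x ->
  represents T (path_velocity (fun t => Phi tau t mu) mu x i) g ->
  forall t, t \in `[0, T] -> Phi tau t mu x 0 i = x 0 i + (prim g t - prim g tau).
Proof.
move=> tau0 muK Kx hg t t0; rewrite ((hPhi tau0 muK).2 t x t0 Kx) !mxE.
by congr (_ + _); exact: oriented_int_rep hg tau0 t0.
Qed.

(** Gronwall's inequality for the growth condition; the first moment of the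
    transported measure is at most the supremum of the flow over [K]. *)
Lemma flow_bounded : exists2 rho, r <= rho & forall tau t mu x,
  tau \in `[0, T] -> t \in `[0, T] -> PP K mu -> K x -> enorm (Phi tau t mu x) <= rho.
Proof.
have [gm mgm gm0] := L1_nonneg_rep (CE_m hCE).
have [im mgm_ae] := mgm.
pose k t : R := (2 * d%:R) * gm t + 0 * gm t.
have ik : leb.-integrable setT (EFin \o k) by exact: integrable_lincomb.
have kE : (fun t => `|k t|) = k.
  apply/funext => t; rewrite ger0_norm// /k mul0r addr0; exact: mulr_ge0.
have [C C0 HC] := gronwall T0 ik.
have gm_le a b : 0 <= a -> a <= b -> prim gm a <= prim gm b.
  by move=> a0 ab; rewrite -subr_ge0; apply: prim_ge0 => //; apply: aeW => t _.
pose I := prim gm T - prim gm 0.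
have I0 : 0 <= I by rewrite subr_ge0 gm_le// ltW.
pose A := r + d%:R * I.
have A0 : 0 <= A by rewrite addr_ge0 ?mulr_ge0// ltW.
exists (C * A + r); first by rewrite lerDr mulr_ge0.
move=> tau t mu x tau0 t0 muK Kx.
apply: (@le_trans _ _ (C * A)); last by rewrite lerDl ltW.
have uP := flow_ucont2 tau0 muK.
have [Mb Mb0 hMb] := ucont2_bounded uP.
have [tau00 tauT] : 0 <= tau /\ tau <= T by move: tau0; rewrite in_itv /= => /andP.
apply: (HC _ (fun y => K y) (fun s y => enorm (Phi tau s mu y)) tau A Mb) => //; last 2 first.
- by move: t0; rewrite in_itv /= => /andP[].
- by move: t0; rewrite in_itv /= => /andP[].
- by move=> s y s0 sT; apply: hMb; rewrite in_itv /= s0.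
rewrite kE => p s M1 M2 /andP[p0 pT] /andP[s0 sT] bt M10 M20 h1 h2 y Ky.
have s0T : s \in `[0, T] by rewrite in_itv /= s0.
have btw0T a u b : 0 <= a -> a <= T -> 0 <= b -> b <= T -> btw a u b -> u \in `[0, T].
  move=> a0 aT b0 bT /orP[/andP[h h']|/andP[h h']]; rewrite in_itv /=.
    by rewrite (le_trans a0 h) (le_trans h' bT).
  by rewrite (le_trans b0 h) (le_trans h' aT).
have coord i : `|Phi tau s mu y 0 i - y 0 i| <=
    I + (2 * M1 * `|prim gm p - prim gm tau| + 2 * M2 * `|prim gm s - prim gm p|).
  have [g hg _] := path_velocity_rep i muK uP Ky Mb0 (fun s y => hMb s y) mgm gm0.
  have [ig gv] := hg.
  rewrite (flow_integral tau0 muK Ky hg s0T) addrC addKr.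
  have piece a b M : 0 <= a -> a <= T -> 0 <= b -> b <= T -> 0 <= M ->
      (forall u z, btw a u b -> K z -> enorm (Phi tau u mu z) <= M) ->
      `|prim g b - prim g a| <= (1 + 2 * M) * `|prim gm b - prim gm a|.
    move=> a0 aT b0 bT M0 hM.
    have iM : leb.-integrable setT (EFin \o (fun t => (1 + 2 * M) * gm t + 0 * gm t)).
      exact: integrable_lincomb.
    have : `|prim g b - prim g a| <= `|prim (fun t => (1 + 2 * M) * gm t + 0 * gm t) b
        - prim (fun t => (1 + 2 * M) * gm t + 0 * gm t) a|.
      apply: prim_btw_le => //.
      apply: (ae_imp (ae_and gv (ae_and mgm_ae (CE_growth hCE)))) => u [e1 [e2 e3]] bu.
      have u0T := btw0T _ _ _ a0 aT b0 bT bu.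
      rewrite -e1// mul0r addr0 -e2//.
      apply: le_trans (coord_le_enorm _ _ _) _; apply: le_trans (e3 u0T _ _) _.
      have [m0 _] := CE_m hCE; rewrite mulrC ler_wpM2r ?m0//.
      have : enorm (Phi tau u mu y) <= M by exact: hM.
      have : Defs.M1 (push K (Phi tau u mu) mu) <= M.
        apply: M1_push => //; first exact: ucont2_slice uP.
        by move=> z Kz; exact: hM.
      by lra.
    rewrite !prim_lincomb// !mul0r !addr0 -mulrBr normrM ger0_norm//.
    by rewrite addr_ge0// mulr_ge0.
  have q1 := piece tau p M1 tau00 tauT p0 pT M10 h1.
  have q2 := piece p s M2 p0 pT s0 sT M20 h2.
  have -> : prim g s - prim g tau = (prim g p - prim g tau) + (prim g s - prim g p) by ring.
  apply: le_trans (ler_normD _ _) _.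
  have tot : `|prim gm p - prim gm tau| + `|prim gm s - prim gm p| <= I.
    have o1 := gm_le 0 s (lexx _) s0; have o2 := gm_le s T s0 sT.
    have o3 := gm_le 0 tau (lexx _) tau00; have o4 := gm_le tau T tau00 tauT.
    case/orP: bt => /andP[b1 b2].
      have o5 := gm_le tau p tau00 b1; have o6 := gm_le p s p0 b2.
      rewrite !ger0_norm ?subr_ge0// /I; move: o1 o2 o3 o4 o5 o6; lra.
    have o5 := gm_le p tau p0 b2; have o6 := gm_le s p s0 b1.
    rewrite !ler0_norm ?subr_le0// /I; move: o1 o2 o3 o4 o5 o6; lra.
  by move: q1 q2 tot; lra.
have : enorm (Phi tau s mu y - y) <= d%:R *
    (I + (2 * M1 * `|prim gm p - prim gm tau| + 2 * M2 * `|prim gm s - prim gm p|)).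
  by apply: enorm_rV_le => i; rewrite !mxE; exact: coord.
have := enorm_subl (Phi tau s mu y) y.
have : enorm y <= r by [].
have kk a b : `|prim k b - prim k a| = 2 * d%:R * `|prim gm b - prim gm a|.
  by rewrite /k !prim_lincomb// !mul0r !addr0 -mulrBr normrM ger0_norm// mulr_ge0.
by rewrite !kk /A; lra.
Qed.

End FlowBounds.

(** * Regularity of the velocity and vector-valued integral inequalities *)

(** What the hypotheses give at almost every fixed time. The Lipschitz bounds
    are taken on a larger ball than the continuity of the derivatives, so that
    maps with values in the smaller ball can be perturbed. *)
Definition velocity_regular {R : realType} {d : nat}
    (V : Pc R d -> 'rV[R]_d -> 'rV[R]_d)
    (B : Pc R d -> 'rV[R]_d -> 'rV[R]_d -> 'M[R]_d) (rho l L : R) : Prop :=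
  [/\ forall mu nu x y,
        PP (cball (rho + 1)) mu -> PP (cball (rho + 1)) nu ->
        cball (rho + 1) x -> cball (rho + 1) y ->
        enorm (V mu x - V mu y) <= l * enorm (x - y) /\
        enorm (V mu x - V nu x) <= L * W 1 mu nu,
      forall mu x, differentiable (V mu) x,
      C0 dist2 (PP (cball rho) `*` cball rho) (fun z => (jacobian (V z.1) z.2)^T),
      forall mu x (i : 'I_d),
        is_gradient (fun nu => V nu x 0 i) mu (fun y => row i (B mu x y)) &
      C0 dist3 (PP (cball rho) `*` cball rho `*` cball rho)
        (fun z => B z.1.1 z.1.2 z.2)].

Lemma btw_itv {R : realType} (T a s b : R) : a \in `[0, T] -> b \in `[0, T] -> btw a s b ->
  s \in `[0, T].
Proof.
rewrite !in_itv /= => /andP[a0 aT] /andP[b0 bT] /orP[/andP[h h']|/andP[h h']].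
  by rewrite (le_trans a0 h) (le_trans h' bT).
by rewrite (le_trans b0 h) (le_trans h' aT).
Qed.

Lemma CE_regular {R : realType} {d : nat} (T : R)
    (v : R -> Pc R d -> 'rV[R]_d -> 'rV[R]_d)
    (Dmuv : R -> Pc R d -> 'rV[R]_d -> 'rV[R]_d -> 'M[R]_d) (m : R -> R) (rho : R) :
  0 < rho -> CE T v Dmuv m ->
  exists k : R -> R, [/\ leb.-integrable setT (EFin \o k), forall t, 0 <= k t &
    {ae leb, forall s, s \in `[0, T] -> exists l L,
      [/\ 0 <= l, 0 <= L, l + L = k s & velocity_regular (v s) (Dmuv s) rho l L]}].
Proof.
move=> rho0 hCE; have rho1 : 0 < rho + 1 by rewrite ltr_wpDl// ltW.
have [l [L [l1 L1 lip]]] := CE_lipschitz hCE rho1.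
have [gl [il lgl] gl0] := L1_nonneg_rep l1.
have [gL [iL LgL] gL0] := L1_nonneg_rep L1.
exists (fun t => 1 * gl t + 1 * gL t); split.
- exact: integrable_lincomb.
- by move=> t; rewrite !mul1r addr_ge0.
have A1 := ae_and lip (ae_and lgl LgL).
have A2 := ae_and (CE_diff_x hCE) (CE_Dx_continuous hCE rho0).
have A3 := ae_and (CE_diff_mu hCE) (CE_Dmu_continuous hCE rho0).
apply: (ae_imp (ae_and A1 (ae_and A2 A3))) => s [[h1 [h2 h3]] [[h4 h5] [h6 h7]]] s0.
exists (gl s), (gL s); split => //; first by rewrite !mul1r.
split; [|exact: h4|exact: h5|exact: h6|exact: h7].
by move=> mu nu x y p1 p2 p3 p4; rewrite -h2// -h3//; exact: h1.
Qed.

Section VectorGronwall.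
Context {R : realType} {d : nat}.
Variables (T : R) (k : R -> R).
Hypotheses (T0 : 0 < T) (ik : leb.-integrable setT (EFin \o k)) (k0 : forall t, 0 <= k t).

(** The error [e] on the increments is additive, and it is met twice: once on
    either side of the intermediate time of [gronwall]. *)
Lemma vector_gronwall : exists2 C, 0 <= C &
  forall (X : Type) (D : X -> Prop) (w : R -> X -> 'rV[R]_d) (tau A Mb e : R),
  0 <= A -> 0 <= e -> tau \in `[0, T] ->
  (forall s x, s \in `[0, T] -> D x -> enorm (w s x) <= Mb) ->
  (forall x, D x -> enorm (w tau x) <= A) ->
  (forall a b M x i, a \in `[0, T] -> b \in `[0, T] -> 0 <= M ->
    (forall s y, btw a s b -> D y -> enorm (w s y) <= M) -> D x ->
    `|w b x 0 i - w a x 0 i| <= M * `|prim k b - prim k a| + e) ->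
  forall t x, t \in `[0, T] -> D x -> enorm (w t x) <= C * (A + e).
Proof.
pose kd t := d%:R * k t + 0 * k t.
have ikd : leb.-integrable setT (EFin \o kd) by exact: integrable_lincomb.
have kdE : (fun t => `|kd t|) = kd.
  by apply/funext => t; rewrite ger0_norm// /kd mul0r addr0 mulr_ge0.
have [C C0 HC] := gronwall T0 ikd.
exists (C * (1 + 2 * d%:R)); first by rewrite mulr_ge0// addr_ge0// mulr_ge0.
move=> X D w tau A Mb e A0 e0 tau0 hMb hA H t x t0 Dx.
have A'0 : 0 <= A + 2 * d%:R * e by rewrite addr_ge0// mulr_ge0// mulr_ge0.
apply: (@le_trans _ _ (C * (A + 2 * d%:R * e))); last first.
  rewrite -[leRHS]mulrA ler_wpM2l//.
  have : 0 <= 2 * d%:R * A by rewrite mulr_ge0// mulr_ge0.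
  by lra.
have itvP s : s \in `[0, T] <-> 0 <= s <= T by rewrite in_itv.
have [tau00 tauT] : 0 <= tau /\ tau <= T by move: tau0; rewrite in_itv /= => /andP.
apply: (HC X D (fun s x => enorm (w s x)) tau _ Mb) => //; first last.
- by move: t0; rewrite in_itv /= => /andP[].
- by move: t0; rewrite in_itv /= => /andP[].
- move=> p s M1 M2 /itvP p0 /itvP s0 bt M10 M20 h1 h2 y Dy.
  rewrite kdE /kd !prim_lincomb// !mul0r !addr0 -!mulrBr !normrM ger0_norm//.
  have vec a b M : a \in `[0, T] -> b \in `[0, T] -> 0 <= M ->
      (forall s y, btw a s b -> D y -> enorm (w s y) <= M) ->
      enorm (w b y - w a y) <= d%:R * (M * `|prim k b - prim k a| + e).
    by move=> a0 b0 M0 hM; apply: enorm_rV_le => i; rewrite !mxE; exact: H.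
  have v1 := vec tau p M1 tau0 p0 M10 h1.
  have v2 := vec p s M2 p0 s0 M20 h2.
  have v3 := hA y Dy.
  have v4 := enorm_subl (w s y) (w p y).
  have v5 := enorm_subl (w p y) (w tau y).
  by lra.
- by move=> s y s0 sT Dy; apply: hMb => //; apply/itvP; rewrite s0.
Qed.

End VectorGronwall.

(** * Arithmetic of the estimates and vector-valued derivatives *)

Lemma norm_diff_le {R : realType} (a b t e : R) : 0 <= a -> 0 <= b -> a <= t -> b <= t ->
  t <= e / 2 -> 0 < e -> `|b - a| <= e.
Proof. by move=> *; rewrite ler_norml; apply/andP; split; lra. Qed.

Lemma cross_diff {R : realType} (a1 a2 b1 b2 x1 x2 y1 y2 : R) :
  a1 - a2 = x1 - x2 -> b1 - b2 = y1 - y2 -> a1 - b1 - (a2 - b2) = x1 - y1 - (x2 - y2).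
Proof. by move=> h1 h2; lra. Qed.

Lemma excess_lt {R : realType} (a1 a2 b1 b2 c e : R) : `|a1 - b1| <= e / 3 ->
  `|a2 - b2| <= e / 3 -> `|1 * b1 + (-1) * b2| <= c -> 0 < e ->
  `|1 * a1 + (-1) * a2| - c < e.
Proof.
move=> h1 h2 h3 e0; rewrite ltrBlDr.
have -> : 1 * a1 + (-1) * a2 = (a1 - b1) + (1 * b1 + (-1) * b2) - (a2 - b2) by ring.
have := ler_normB (a1 - b1 + (1 * b1 + (-1) * b2)) (a2 - b2).
have := ler_normD (a1 - b1) (1 * b1 + (-1) * b2).
by lra.
Qed.

Lemma third_add {R : realType} (e : R) : 0 < e -> e / 3 + e / 3 < e.
Proof. lra. Qed.

Lemma four_point {R : realType} (a b a' b' x e : R) : `|b - b'| <= e / 4 -> `|a - a'| <= e / 4 ->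
  `|b' - a' - x| <= e / 2 -> `|b - a - x| <= e.
Proof.
move=> h1 h2 h3.
have -> : b - a - x = (b - b') - (a - a') + (b' - a' - x) by ring.
have := ler_normD (b - b' - (a - a')) (b' - a' - x).
have := ler_normB (b - b') (a - a').
by lra.
Qed.

Lemma two_sided {R : realType} (M ka kb a1 a2 b1 b2 : R) :
  M * ka + (- 1) * (1 * a1 + (-1) * a2) <= M * kb + (- 1) * (1 * b1 + (-1) * b2) ->
  M * ka + (- - 1) * (1 * a1 + (-1) * a2) <= M * kb + (- - 1) * (1 * b1 + (-1) * b2) ->
  `|b1 - b2 - (a1 - a2)| <= M * (kb - ka).
Proof. by move=> h1 h2; rewrite ler_norml; apply/andP; split; lra. Qed.

Lemma norm_le_small {R : realType} (a : R) : (forall e, 0 < e -> `|a| <= e) -> a = 0.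
Proof.
move=> h; apply/eqP; rewrite -normr_eq0 eq_le normr_ge0 andbT.
by apply/ler_addgt0Pr => e /h; rewrite add0r.
Qed.

Lemma measurable_btw {R : realType} (a b : R) : measurable_fun setT (fun s : R => btw a s b).
Proof.
apply: measurable_or; apply: measurable_and; exact: measurable_fun_ler.
Qed.

Lemma ae_forall_ord {R : realType} {d : nat} (Q : 'I_d -> R -> Prop) :
  (forall i, {ae leb, forall s, Q i s}) -> {ae leb, forall s, forall i, Q i s}.
Proof.
move=> h; have h' (j : nat) : {ae leb, forall s, forall i : 'I_d, i = j :> nat -> Q i s}.
  have [jd|jd] := ltnP j d; last first.
    by apply: aeW => s i ij; have := ltn_ord i; rewrite ij ltnNge jd.
  apply: (ae_imp (h (Ordinal jd))) => s {}h i ij.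
  by rewrite (_ : i = Ordinal jd)//; exact/val_inj.
by apply: (ae_imp (ae_forall_nat h')) => s {}h i; exact: (h i).
Qed.

Section VectorDerivatives.
Context {R : realType}.

Lemma expands_lincomb (g1 g2 : R -> R) t l1 l2 (a b : R) :
  expands g1 t l1 -> expands g2 t l2 ->
  expands (fun s => a * g1 s + b * g2 s) t (a * l1 + b * l2).
Proof.
move=> h1 h2 e e0; pose c := `|a| + `|b| + 1.
have c0 : 0 < c by rewrite ltr_wpDl// addr_ge0.
have e1 : 0 < e / c by rewrite divr_gt0.
have [d1 d10 H1] := h1 _ e1; have [d2 d20 H2] := h2 _ e1.
exists (Num.min d1 d2); first by rewrite lt_min d10.
move=> h; rewrite lt_min => /andP[/H1 {}H1 /H2 {}H2].
have -> : a * g1 (t + h) + b * g2 (t + h) - (a * g1 t + b * g2 t) - h * (a * l1 + b * l2) =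
  a * (g1 (t + h) - g1 t - h * l1) + b * (g2 (t + h) - g2 t - h * l2) by ring.
apply: le_trans (ler_normD _ _) _; rewrite !normrM.
apply: (@le_trans _ _ (`|a| * (e / c * `|h|) + `|b| * (e / c * `|h|))).
  by apply: lerD; apply: ler_wpM2l.
rewrite -mulrDl -[leRHS]mul1r mulrA (mulrA (`|a| + `|b|)) mulrA ler_wpM2r//.
by rewrite mul1r ler_pdivrMr// [leLHS]mulrC ler_wpM2l ?(ltW e0)// /c lerDl.
Qed.

Lemma expands_shift (g g' : R -> R) t l c eta : 0 < eta ->
  (forall h, `|h| < eta -> g (t + h) = c + g' (t + h)) -> expands g' t l -> expands g t l.
Proof.
move=> eta0 E hg e /hg[delta d0 H].
exists (Num.min eta delta); first by rewrite lt_min eta0.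
move=> h; rewrite lt_min => /andP[h1 h2]; rewrite E//.
have := E 0; rewrite normr0 addr0 => /(_ eta0) ->.
by rewrite opprD addrACA subrr add0r; exact: H.
Qed.

Lemma expands_rV d (f : R -> 'rV[R]_d) (t : R) (l : 'rV[R]_d) :
  (forall i, expands (fun s => f s 0 i) t (l 0 i)) -> is_derive t 1 f l.
Proof.
move=> hf.
have cv : h^-1 *: ((f \o shift t) (h *: (1 : R)) - f t) @[h --> (0 : R)^'] --> l.
  apply/cvgrPdist_le => e e0.
  have e1 : 0 < e / d.+1%:R by rewrite divr_gt0.
  have : \forall h \near (0 : R)^', forall i, `|f (t + h) 0 i - f t 0 i - h * l 0 i| <= e / d.+1%:R * `|h|.
    apply: (@filter_forall _ _ (fun i h => `|f (t + h) 0 i - f t 0 i - h * l 0 i| <= e / d.+1%:R * `|h|)) => i.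
    have [de d0 H] := hf i _ e1; near=> h; apply: H.
    by near: h; exact: dnbhs0_lt.
  move=> hn; near=> h.
  have h0 : h != 0 by near: h; exact: nbhs_dnbhs_neq.
  have H : forall i, `|f (t + h) 0 i - f t 0 i - h * l 0 i| <= e / d.+1%:R * `|h| by near: h.
  apply: le_trans (norm_le_enorm _) _.
  apply: (@le_trans _ _ (d%:R * (e / d.+1%:R))); last first.
    by rewrite mulrCA ler_piMr ?(ltW e0)// ler_pdivrMr// mul1r ler_nat.
  apply: enorm_rV_le => i; rewrite !mxE /= /GRing.scale /= mulr1 [h + t]addrC.
  have -> : l 0 i - h^-1 * (f (t + h) 0 i - f t 0 i) = - (h^-1 * (f (t + h) 0 i - f t 0 i - h * l 0 i)).
    by field.
  by rewrite normrN normrM normfV mulrC ler_pdivrMr ?normr_gt0.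
by split; [apply/cvg_ex; exists l | exact: cvg_lim].
Unshelve. all: by end_near. Qed.

Lemma rV_expands d (f : R -> 'rV[R]_d) (t : R) (l : 'rV[R]_d) i :
  is_derive t 1 f l -> expands (fun s => f s 0 i) t (l 0 i).
Proof.
move=> [/cvg_ex[l' /[dup] cv /cvg_lim E] D] e e0.
have ll' : l = l' by rewrite -D -E.
rewrite {}ll' in D *.
move/cvgrPdist_le/(_ e e0): cv => /nbhs_ballP[de /= d0 H].
exists de => // h hd; have [->|h0] := eqVneq h 0.
  by rewrite addr0 mul0r !subrr normr0 mulr0.
have := H h; rewrite /ball /= sub0r normrN => /(_ hd h0) {}H.
have := le_trans (coord_le_norm _ 0 i) H.
rewrite !mxE /GRing.scale /= mulr1 [h + t]addrC => {}H.
have -> : f (t + h) 0 i - f t 0 i - h * l' 0 i = - (h * (l' 0 i - h^-1 * (f (t + h) 0 i - f t 0 i))).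
  by field.
by rewrite normrN normrM mulrC ler_wpM2r.
Qed.

End VectorDerivatives.

(** * Difference quotients of the flow in its initial time *)

Section Quotients.
Context {R : realType} {d : nat}.
Variables (T : R) (v : R -> Pc R d -> 'rV[R]_d -> 'rV[R]_d)
  (Dmuv : R -> Pc R d -> 'rV[R]_d -> 'rV[R]_d -> 'M[R]_d) (m : R -> R) (r : R)
  (Phi : R -> R -> Pc R d -> 'rV[R]_d -> 'rV[R]_d).
Hypotheses (T0 : 0 < T) (r0 : 0 < r) (hCE : CE T v Dmuv m).
Notation K := (cball r : set 'rV[R]_d).
Hypothesis hPhi : nonlocal_flow T v K Phi.
Variables (rho : R) (gm k : R -> R).
Hypotheses (r_rho : r <= rho) (rhoB : forall tau t mu x,
  tau \in `[0, T] -> t \in `[0, T] -> PP K mu -> K x -> enorm (Phi tau t mu x) <= rho).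
Hypotheses (mgm : represents T m gm) (gm0 : forall t, 0 <= gm t).
Hypotheses (ik : leb.-integrable setT (EFin \o k)) (k0 : forall t, 0 <= k t).
Hypothesis regular : {ae leb, forall s, s \in `[0, T] -> exists l L,
  [/\ 0 <= l, 0 <= L, l + L = k s & velocity_regular (v s) (Dmuv s) rho l L]}.

Notation pv tau mu x i := (path_velocity v r (fun t => Phi tau t mu) mu x i).

Let rho0 : 0 <= rho.
Proof. exact: le_trans (ltW r0) r_rho. Qed.

Lemma flow_rep tau mu x i : tau \in `[0, T] -> PP K mu -> K x ->
  exists2 g, represents T (pv tau mu x i) g & forall t, `|g t| <= (1 + rho + rho) * gm t.
Proof.
move=> tau0 muK Kx.
by apply: (path_velocity_rep hCE i muK (flow_ucont2 hPhi tau0 muK) Kx rho0 _ mgm gm0) => s y s0 Ky; exact: rhoB.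
Qed.

Lemma flow_difference_velocity tau1 tau2 mu x i s M : tau1 \in `[0, T] -> tau2 \in `[0, T] ->
  PP K mu -> K x -> s \in `[0, T] -> 0 <= M ->
  (exists l L, [/\ 0 <= l, 0 <= L, l + L = k s & velocity_regular (v s) (Dmuv s) rho l L]) ->
  (forall y, K y -> enorm (Phi tau1 s mu y - Phi tau2 s mu y) <= M) ->
  `|pv tau1 mu x i s - pv tau2 mu x i s| <= k s * M.
Proof.
move=> t1 t2 muK Kx s0 M0 [l [L [l0 L0 lL [lip _ _ _ _]]]] hM.
have u1 := ucont2_slice s0 (flow_ucont2 hPhi t1 muK).
have u2 := ucont2_slice s0 (flow_ucont2 hPhi t2 muK).
have B1 y : K y -> cball (rho + 1) (Phi tau1 s mu y).
  by move=> Ky; apply: le_trans (rhoB t1 s0 muK Ky) _; rewrite lerDl.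
have B2 y : K y -> cball (rho + 1) (Phi tau2 s mu y).
  by move=> Ky; apply: le_trans (rhoB t2 s0 muK Ky) _; rewrite lerDl.
have p1 := push_PP muK u1 B1; have p2 := push_PP muK u2 B2.
have [h1 _] := lip _ _ _ _ p1 p1 (B1 x Kx) (B2 x Kx).
have [_ h2] := lip _ _ _ _ p1 p2 (B2 x Kx) (B2 x Kx).
have := coord_le_enorm (v s (push K (Phi tau1 s mu) mu) (Phi tau1 s mu x) -
  v s (push K (Phi tau2 s mu) mu) (Phi tau2 s mu x)) 0 i.
rewrite !mxE => /le_trans; apply.
apply: le_trans (enorm_trans (v s (push K (Phi tau1 s mu) mu) (Phi tau2 s mu x)) _ _) _.
rewrite -lL mulrDl; apply: lerD.
  by apply: le_trans h1 _; rewrite ler_wpM2l// hM.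
apply: le_trans h2 _; rewrite ler_wpM2l//; apply: W1_push => // y Ky.
by rewrite enormB; exact: hM.
Qed.

Lemma flow_difference_increment tau1 tau2 mu x i a b M :
  tau1 \in `[0, T] -> tau2 \in `[0, T] -> PP K mu -> K x ->
  a \in `[0, T] -> b \in `[0, T] -> 0 <= M ->
  (forall s y, btw a s b -> K y -> enorm (Phi tau1 s mu y - Phi tau2 s mu y) <= M) ->
  `|(Phi tau1 b mu x - Phi tau2 b mu x) 0 i - (Phi tau1 a mu x - Phi tau2 a mu x) 0 i|
    <= M * `|prim k b - prim k a|.
Proof.
move=> t1 t2 muK Kx a0 b0 M0 hM.
have [g1 [ig1 hg1] _] := flow_rep i t1 muK Kx; have [g2 [ig2 hg2] _] := flow_rep i t2 muK Kx.
rewrite !mxE !(flow_integral hPhi t1 muK Kx (conj ig1 hg1))//.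
rewrite !(flow_integral hPhi t2 muK Kx (conj ig2 hg2))//.
pose g s := 1 * g1 s + (-1) * g2 s.
pose kM s := M * k s + 0 * k s.
have ig : leb.-integrable setT (EFin \o g) by exact: integrable_lincomb.
have ikM : leb.-integrable setT (EFin \o kM) by exact: integrable_lincomb.
have [a00 b00] : 0 <= a /\ 0 <= b.
  by move: a0 b0; rewrite !in_itv /= => /andP[? _] /andP[? _].
have : `|prim g b - prim g a| <= `|prim kM b - prim kM a|.
  apply: prim_btw_le => //.
  apply: (ae_imp (ae_and (ae_and hg1 hg2) regular)) => s [[e1 e2] reg] bs.
  have s0 := btw_itv a0 b0 bs.
  rewrite /g /kM mul0r addr0 mul1r mulN1r -e1// -e2// mulrC.
  apply: flow_difference_velocity => //; first exact: reg.
  by move=> y; exact: hM.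
rewrite /g /kM !prim_lincomb// !mul0r !addr0 -mulrBr normrM ger0_norm//.
by congr (`|_| <= _); ring.
Qed.

Variable tau : R.
Hypotheses (tau0 : tau \in `[0, T])
  (tau_m : lebesgue_limit tau (fun t => (`|m t - m tau|)%:E)).

Lemma flow_self tau' mu x : tau' \in `[0, T] -> PP K mu -> K x -> Phi tau' tau' mu x = x.
Proof.
move=> t0 muK Kx; apply/rowP => i; have [g hg _] := flow_rep i t0 muK Kx.
by rewrite (flow_integral hPhi t0 muK Kx hg)// subrr addr0.
Qed.

(** Between [tau] and [tau + h] the flow moves by at most a multiple of the
    integral of [m], which is of order h at a Lebesgue point of [m]. *)
Lemma flow_start : exists2 C, 0 <= C & exists2 eta, 0 < eta &
  forall h s mu x, `|h| < eta -> tau + h \in `[0, T] -> btw tau s (tau + h) ->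
    PP K mu -> K x -> enorm (Phi (tau + h) s mu x - x) <= C * `|h|.
Proof.
have [eta eta0 Heta] := lebesgue_limit_bound tau_m ltr01.
exists (d%:R * ((1 + rho + rho) * (1 + `|m tau|))).
  by rewrite !mulr_ge0// !addr_ge0.
exists eta => // h s mu x hh h0 bs muK Kx.
have s0 := btw_itv tau0 h0 bs.
have [igm _] := mgm.
have gm_le a b : 0 <= a -> a <= b -> prim gm a <= prim gm b.
  by move=> a0 ab; rewrite -subr_ge0; apply: prim_ge0 => //; apply: aeW => t _.
have inc : `|prim gm (tau + h) - prim gm tau| <= (1 + `|m tau|) * `|h|.
  have [->|hn0] := eqVneq h 0; first by rewrite addr0 subrr !normr0 mulr0.
  rewrite -[prim gm (tau + h) - prim gm tau](subrK (h * m tau)).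
  apply: le_trans (ler_normD _ _) _; rewrite mulrDl; apply: lerD; last by rewrite normrM mulrC.
  rewrite -[1 in leRHS]add0r.
  apply: (lebesgue_increment mgm tau0 h0 (lexx _) ler01 _ (Heta h _ hh)) => [u bu|].
    by rewrite subr0 lee_fin ge_max lexx normr_ge0.
  by rewrite normr_gt0.
have [tau00 h00 s00] : [/\ 0 <= tau, 0 <= tau + h & 0 <= s].
  by move: tau0 h0 s0; rewrite !in_itv /= => /andP[? _] /andP[? _] /andP[? _].
rewrite -[leRHS]mulrA; apply: enorm_rV_le => i; rewrite !mxE.
have [g hg gle] := flow_rep i h0 muK Kx.
rewrite (flow_integral hPhi h0 muK Kx hg s0) addrC addKr.
pose c := 1 + rho + rho.
have c0 : 0 <= c by rewrite !addr_ge0.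
have ic : leb.-integrable setT (EFin \o (fun t => c * gm t + 0 * gm t)) by exact: integrable_lincomb.
have [ig _] := hg.
have : `|prim g s - prim g (tau + h)| <= `|prim (fun t => c * gm t + 0 * gm t) s - prim (fun t => c * gm t + 0 * gm t) (tau + h)|.
  apply: prim_btw_le => //; apply: aeW => u _.
  by rewrite mul0r addr0; exact: gle.
move=> /le_trans; apply.
rewrite !prim_lincomb// !mul0r !addr0 -mulrBr normrM ger0_norm// -mulrA ler_wpM2l//.
apply: le_trans inc.
case/orP: bs => /andP[b1 b2].
  have h1 := gm_le _ _ tau00 b1; have h2 := gm_le _ _ s00 b2.
  rewrite distrC !ger0_norm ?subr_ge0//; first by rewrite lerD2l lerN2.
  exact: le_trans h1 h2.
have h1 := gm_le _ _ h00 b1; have h2 := gm_le _ _ s00 b2.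
rewrite [leRHS]distrC !ger0_norm ?subr_ge0//; first by rewrite lerD2r.
exact: le_trans h1 h2.
Qed.

(** The two flows solve the same equation and differ at time [tau] by the
    displacement bounded in [flow_start]. *)
Lemma flow_lipschitz : exists2 C, 0 <= C & exists2 eta, 0 < eta &
  forall h t mu x, `|h| < eta -> tau + h \in `[0, T] -> t \in `[0, T] ->
    PP K mu -> K x -> enorm (Phi (tau + h) t mu x - Phi tau t mu x) <= C * `|h|.
Proof.
have [C1 C10 [eta eta0 start]] := flow_start.
have [C C0 HC] := @vector_gronwall R d T k T0 ik k0.
exists (C * C1); first exact: mulr_ge0.
exists eta => // h t mu x hh h0 t0 muK Kx.
have := HC _ (fun z : Pc R d * 'rV[R]_d => PP K z.1 /\ K z.2)
  (fun s z => Phi (tau + h) s z.1 z.2 - Phi tau s z.1 z.2) tau (C1 * `|h|) (rho + rho) 0.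
rewrite addr0 -mulrA => H; apply: (H _ _ _ _ _ _ t (mu, x)) => //.
- exact: mulr_ge0.
- move=> s [nu y] /= s0 [nuK Ky]; apply: le_trans (enormD _ _) _; rewrite enormN.
  by apply: lerD; exact: rhoB.
- move=> [nu y] /= [nuK Ky]; rewrite (flow_self tau0 nuK Ky); apply: start => //.
  by rewrite /btw lexx; case: (leP tau (tau + h)) => // /ltW ->; rewrite ?orbT.
- move=> a b M [nu y] i a0 b0 M0 hM /= [nuK Ky]; rewrite addr0.
  apply: flow_difference_increment => // s z bs Kz.
  exact: (hM s (nu, z) bs (conj nuK Kz)).
Qed.

Definition quotient h t mu x : 'rV[R]_d := h^-1 *: (Phi (tau + h) t mu x - Phi tau t mu x).

Lemma quotient_ucont2 h mu : tau + h \in `[0, T] -> PP K mu ->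
  ucont2 T r (fun t => quotient h t mu).
Proof.
move=> h0 muK; have u1 := flow_ucont2 hPhi h0 muK; have u2 := flow_ucont2 hPhi tau0 muK.
have := ucont2_lincomb h^-1 (- h^-1) u1 u2; congr (ucont2 T r _).
by apply/funext => t; apply/funext => x; rewrite /quotient scalerBr scaleNr.
Qed.

Variables (C eta : R).
Hypotheses (C_ge0 : 0 <= C) (eta0 : 0 < eta) (C_lip : forall h t mu x,
  `|h| < eta -> tau + h \in `[0, T] -> t \in `[0, T] ->
  PP K mu -> K x -> enorm (Phi (tau + h) t mu x - Phi tau t mu x) <= C * `|h|).

Lemma quotient_le h t mu x : 0 < `|h| -> `|h| < eta -> tau + h \in `[0, T] -> t \in `[0, T] ->
  PP K mu -> K x -> enorm (quotient h t mu x) <= C.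
Proof.
move=> hn hh h0 t0 muK Kx; rewrite /quotient enormZ normfV ler_pdivrMl// mulrC.
exact: C_lip.
Qed.

(** At a regular time, the quotient of the velocities is close to the
    linearised velocity of the quotient of the flows. *)
Lemma quotient_linearisation s : s \in `[0, T] ->
  (exists l L, [/\ 0 <= l, 0 <= L, l + L = k s & velocity_regular (v s) (Dmuv s) rho l L]) ->
  forall e, 0 < e -> exists2 delta, 0 < delta & forall h mu x i,
    0 < `|h| -> `|h| < delta -> tau + h \in `[0, T] -> PP K mu -> K x ->
    `|h^-1 * (pv (tau + h) mu x i s - pv tau mu x i s) -
      linearisation (v s) (Dmuv s) r mu (Phi tau s mu) (quotient h s mu) x 0 i| <= e.
Proof.
move=> s0 [l [L [l0 L0 lL [lip Vd Dc Vg Bc]]]] e e0.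
have C1 : 0 < C + 1 by rewrite ltr_wpDl.
have e1 : 0 < e / (C + 1) by rewrite divr_gt0.
have [delta delta0 Hd] := linearisation_remainder r rho0 Vd Dc Vg Bc e1.
exists (Num.min eta (delta / (C + 1))); first by rewrite lt_min eta0 divr_gt0.
move=> h mu x i hn; rewrite lt_min => /andP[hh hd] h0 muK Kx.
have uh := ucont2_slice s0 (flow_ucont2 hPhi h0 muK).
have ut := ucont2_slice s0 (flow_ucont2 hPhi tau0 muK).
have uq := ucont2_slice s0 (quotient_ucont2 h0 muK).
have qC y : K y -> enorm (quotient h s mu y) <= C by move=> Ky; exact: quotient_le.
have hne : h != 0 by rewrite -normr_gt0.
have M0 : 0 <= C * `|h| by exact: mulr_ge0.
have Md : C * `|h| <= delta.
  apply: (@le_trans _ _ ((C + 1) * `|h|)); first by rewrite ler_wpM2r// lerDl.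
  by rewrite mulrC -ler_pdivlMr// ltW.
have := Hd mu (Phi tau s mu) (Phi (tau + h) s mu) _ muK ut uh
  (fun y Ky => rhoB tau0 s0 muK Ky) (fun y Ky => rhoB h0 s0 muK Ky) M0 Md
  (fun y Ky => C_lip hh h0 s0 muK Ky) x i Kx.
have E : (fun y => Phi (tau + h) s mu y - Phi tau s mu y) =
    (fun y => h *: quotient h s mu y + 0 *: quotient h s mu y).
  by apply/funext => y; rewrite scale0r addr0 /quotient scalerA divff// scale1r.
rewrite E (linearisation_lincomb Vg h 0 x i muK ut uq uq C_ge0 qC qC) mul0r addr0.
rewrite -!/(path_velocity v r (fun t => Phi tau t mu) mu x i s).
rewrite -!/(path_velocity v r (fun t => Phi (tau + h) t mu) mu x i s).
set D := path_velocity _ _ _ _ _ _ _ - _; set l' := linearisation _ _ _ _ _ _ _ _ _.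
move=> hD; have -> : h^-1 * D - l' = h^-1 * (D - h * l') by rewrite [RHS]mulrBr mulKf.
rewrite normrM normfV ler_pdivrMl//; apply: le_trans hD _.
have c1 : (C + 1)^-1 * C <= 1 by rewrite mulrC ler_pdivrMr// mul1r lerDl.
by rewrite mulrA [leRHS]mulrC ler_wpM2r// -mulrA ler_piMr// ltW.
Qed.

Notation q := quotient.

(** * Convergence of the difference quotients *)

Definition step h := [/\ 0 < `|h|, `|h| < eta & tau + h \in `[0, T]].

Lemma quotient_rep h mu x i : step h -> PP K mu -> K x ->
  exists Q : R -> R, [/\ leb.-integrable setT (EFin \o Q),
    {ae leb, forall s, s \in `[0, T] ->
      Q s = h^-1 * (pv (tau + h) mu x i s - pv tau mu x i s)},
    {ae leb, forall s, s \in `[0, T] -> `|Q s| <= C * k s} &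
    forall a b, a \in `[0, T] -> b \in `[0, T] ->
      q h b mu x 0 i - q h a mu x 0 i = prim Q b - prim Q a].
Proof.
move=> [hn he h0] muK Kx.
have [g1 [i1 e1] _] := flow_rep i h0 muK Kx.
have [g0 [i0 e0] _] := flow_rep i tau0 muK Kx.
exists (fun s => h^-1 * g1 s + (- h^-1) * g0 s).
have Qe : {ae leb, forall s, s \in `[0, T] -> h^-1 * g1 s + - h^-1 * g0 s =
      h^-1 * (pv (tau + h) mu x i s - pv tau mu x i s)}.
  by apply: (ae_imp (ae_and e1 e0)) => s [h1 h2] s0; rewrite h1// h2//; ring.
split => //; first exact: integrable_lincomb.
  apply: (ae_imp (ae_and Qe regular)) => s [h1 reg] s0; rewrite h1//.
  rewrite normrM normfV ler_pdivrMl//.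
  have := @flow_difference_velocity (tau + h) tau mu x i s (C * `|h|)
    h0 tau0 muK Kx s0 (mulr_ge0 C_ge0 (normr_ge0 h)) (reg s0) (fun y Ky => C_lip he h0 s0 muK Ky).
  by congr (_ <= _); ring.
move=> a b a0 b0; rewrite !prim_lincomb// /quotient !mxE.
rewrite !(flow_integral hPhi h0 muK Kx (conj i1 e1))//.
by rewrite !(flow_integral hPhi tau0 muK Kx (conj i0 e0))//; ring.
Qed.

(** Otherwise there are violating data for steps tending to 0. At almost every
    time the excess of the difference of the velocity quotients over [k M]
    tends to 0 along them, by [quotient_linearisation], and it is dominated by
    a multiple of [k]; so its integral tends to 0, a contradiction. *)
Lemma quotient_increment e : 0 < e -> exists2 delta, 0 < delta &
  forall h h' mu x i a b M, step h -> step h' -> `|h| < delta -> `|h'| < delta ->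
    PP K mu -> K x -> a \in `[0, T] -> b \in `[0, T] -> 0 <= M ->
    (forall s y, btw a s b -> K y -> enorm (q h s mu y - q h' s mu y) <= M) ->
    `|(q h b mu x - q h' b mu x) 0 i - (q h a mu x - q h' a mu x) 0 i|
      <= M * `|prim k b - prim k a| + e.
Proof.
move=> e0; apply: contrapT => H.
pose bad (n : nat) (p : (R * R * Pc R d) * ('rV[R]_d * 'I_d) * (R * R * R)) :=
  let: ((h, h', mu), (x, i), (a, b, M)) := p in
  [/\ step h /\ step h', `|h| < n.+1%:R^-1 /\ `|h'| < n.+1%:R^-1, PP K mu /\ K x,
    [/\ a \in `[0, T], b \in `[0, T] & 0 <= M] &
    (forall s y, btw a s b -> K y -> enorm (q h s mu y - q h' s mu y) <= M) /\
    M * `|prim k b - prim k a| + e <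
    `|(q h b mu x - q h' b mu x) 0 i - (q h a mu x - q h' a mu x) 0 i|].
have /choice[p pP] : forall n, exists p, bad n p.
  move=> n; apply: contrapT => nb; apply: H.
  exists n.+1%:R^-1; first by rewrite invr_gt0.
  move=> h h' mu x i a b M H1 H2 H3 H4 H5 H6 H7 H8 H9 H10.
  rewrite leNgt; apply/negP => H11; apply: nb.
  by exists ((h, h', mu), (x, i), (a, b, M)); split.
clear H.
pose h n := (p n).1.1.1.1; pose h' n := (p n).1.1.1.2; pose mu n := (p n).1.1.2.
pose x n := (p n).1.2.1; pose i n := (p n).1.2.2.
pose a n := (p n).2.1.1; pose b n := (p n).2.1.2; pose M n := (p n).2.2.
have {pP} P n : [/\ step (h n) /\ step (h' n),
    `|h n| < n.+1%:R^-1 /\ `|h' n| < n.+1%:R^-1, PP K (mu n) /\ K (x n),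
    [/\ a n \in `[0, T], b n \in `[0, T] & 0 <= M n] &
    (forall s y, btw (a n) s (b n) -> K y -> enorm (q (h n) s (mu n) y - q (h' n) s (mu n) y) <= M n) /\
    M n * `|prim k (b n) - prim k (a n)| + e <
    `|(q (h n) (b n) (mu n) (x n) - q (h' n) (b n) (mu n) (x n)) 0 (i n)
      - (q (h n) (a n) (mu n) (x n) - q (h' n) (a n) (mu n) (x n)) 0 (i n)|].
  have := pP n; rewrite /h /h' /mu /x /i /a /b /M.
  by move: (p n) => [[[[? ?] ?] [? ?]] [[? ?] ?]].
have /choice[Q QP] : forall n, exists Q : R -> R, [/\ leb.-integrable setT (EFin \o Q),
    {ae leb, forall s, s \in `[0, T] ->
      Q s = (h n)^-1 * (pv (tau + h n) (mu n) (x n) (i n) s - pv tau (mu n) (x n) (i n) s)},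
    {ae leb, forall s, s \in `[0, T] -> `|Q s| <= C * k s} &
    forall a b, a \in `[0, T] -> b \in `[0, T] ->
      q (h n) b (mu n) (x n) 0 (i n) - q (h n) a (mu n) (x n) 0 (i n) = prim Q b - prim Q a].
  by move=> n; have [[s1 s2] _ [muK Kx] _ _] := P n; exact: quotient_rep.
have /choice[Q' Q'P] : forall n, exists Q : R -> R, [/\ leb.-integrable setT (EFin \o Q),
    {ae leb, forall s, s \in `[0, T] ->
      Q s = (h' n)^-1 * (pv (tau + h' n) (mu n) (x n) (i n) s - pv tau (mu n) (x n) (i n) s)},
    {ae leb, forall s, s \in `[0, T] -> `|Q s| <= C * k s} &
    forall a b, a \in `[0, T] -> b \in `[0, T] ->
      q (h' n) b (mu n) (x n) 0 (i n) - q (h' n) a (mu n) (x n) 0 (i n) = prim Q b - prim Q a].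
  by move=> n; have [[s1 s2] _ [muK Kx] _ _] := P n; exact: quotient_rep.
pose G n s := 1 * Q n s + (-1) * Q' n s.
have iG n : leb.-integrable setT (EFin \o G n).
  by have [? _ _ _] := QP n; have [? _ _ _] := Q'P n; exact: integrable_lincomb.
pose f n s := if btw (a n) s (b n) then Num.max 0 (`|G n s| - k s * M n) else 0.
have mk : measurable_fun setT k by move/integrableP: ik => [/measurable_EFinP].
have mf n : measurable_fun setT (f n).
  have mG : measurable_fun setT (G n) by move/integrableP: (iG n) => [/measurable_EFinP].
  apply: measurable_fun_ifT => //; first exact: measurable_btw.
  apply: measurable_maxr => //; apply: measurable_funB; first exact: measurableT_comp.
  exact: measurable_funM.
have f0 n s : 0 <= f n s by rewrite /f; case: ifP => // _; rewrite le_max lexx.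
have fG n s : f n s <= `|G n s|.
  rewrite /f; case: ifP => // _; rewrite ge_max normr_ge0 /= gerBl mulr_ge0//.
  by have [_ _ _ [_ _ ?] _] := P n.
have m0T : @measurable _ (g_sigma_algebraType R.-ocitv.-measurable) (`[0, T]%classic : set R).
  exact: measurable_itv.
have small : forall e', 0 < e' -> exists n0, forall n, (n0 <= n)%N -> n.+1%:R^-1 < e' :> R.
  move=> e' e'0; have := near_infty_natSinv_lt (PosNum e'0).
  by move=> [n0 _ hn]; exists n0 => n /hn.
pose k2 s := (C + C) * k s + 0 * k s.
have ik2 : leb.-integrable setT (EFin \o k2) by exact: integrable_lincomb.
have dom n : {ae leb, forall s, `[0, T]%classic s -> 0 <= f n s <= k2 s}.
  have [_ _ B1 _] := QP n; have [_ _ B2 _] := Q'P n.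
  apply: (ae_imp (ae_and B1 B2)) => s [h1 h2] s0; rewrite f0 /=.
  apply: le_trans (fG n s) _; rewrite /k2 mul0r addr0 mulrDl /G mul1r mulN1r.
  by apply: le_trans (ler_normB _ _) _; apply: lerD; [exact: h1|exact: h2].
have cvg0 : {ae leb, forall s, `[0, T]%classic s -> forall e', 0 < e' ->
    exists n0, forall n, (n0 <= n)%N -> f n s < e'}.
  have A1 : {ae leb, forall s, forall n, s \in `[0, T] ->
      Q n s = (h n)^-1 * (pv (tau + h n) (mu n) (x n) (i n) s - pv tau (mu n) (x n) (i n) s)}.
    by apply: ae_forall_nat => n; have [_ ? _ _] := QP n.
  have A2 : {ae leb, forall s, forall n, s \in `[0, T] ->
      Q' n s = (h' n)^-1 * (pv (tau + h' n) (mu n) (x n) (i n) s - pv tau (mu n) (x n) (i n) s)}.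
    by apply: ae_forall_nat => n; have [_ ? _ _] := Q'P n.
  apply: (ae_imp (ae_and (ae_and A1 A2) regular)) => s [[QE Q'E] reg] s0 e' e'0.
  have e3 : 0 < e' / 3 by rewrite divr_gt0.
  have [delta delta0 Hd] := quotient_linearisation s0 (reg s0) e3.
  have [n0 Hn0] := small _ delta0; exists n0 => n /Hn0 hn.
  have [[[s1 s1' s1''] [s2 s2' s2'']] [hd hd'] [muK Kx] [_ _ M0] [hM _]] := P n.
  rewrite /f; case: ifP => // bs; rewrite gt_max e'0 /=.
  have h1 := Hd _ _ _ (i n) s1 (lt_trans hd hn) s1'' muK Kx.
  have h2 := Hd _ _ _ (i n) s2 (lt_trans hd' hn) s2'' muK Kx.
  rewrite -QE// in h1; rewrite -Q'E// in h2.
  have [l [L [l0 L0 lL [lip Vd _ Vg _]]]] := reg s0.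
  have ut := ucont2_slice s0 (flow_ucont2 hPhi tau0 muK).
  have u1 := ucont2_slice s0 (quotient_ucont2 s1'' muK).
  have u2 := ucont2_slice s0 (quotient_ucont2 s2'' muK).
  have c1 y : K y -> enorm (q (h n) s (mu n) y) <= C by move=> Ky; exact: quotient_le.
  have c2 y : K y -> enorm (q (h' n) s (mu n) y) <= C by move=> Ky; exact: quotient_le.
  have uw := ucont_lincomb 1 (-1) u1 u2.
  have wM y : K y -> enorm (1 *: q (h n) s (mu n) y + (-1) *: q (h' n) s (mu n) y) <= M n.
    by move=> Ky; rewrite scale1r scaleN1r; exact: hM.
  have h3 := linearisation_le l0 L0 lip Vd Vg muK ut uw M0 wM (fun y Ky => rhoB tau0 s0 muK Ky) (i n) Kx.
  rewrite (linearisation_lincomb Vg 1 (-1) (x n) (i n) muK ut u1 u2 C_ge0 c1 c2) lL in h3.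
  exact: excess_lt h1 h2 h3 e'0.
have e2 : 0 < e / 2 by rewrite divr_gt0.
have mf' n : measurable_fun (`[0, T]%classic : set R) (f n) by apply: measurable_funTS; exact: mf.
have [n0 Hn0] := dominated_to0 m0T mf' (integrableS measurableT m0T (@subsetT _ _) ik2) dom cvg0 e2.
pose n := n0.
have [_ _ [muK Kx] [a0 b0 M0] [_]] := P n; apply/negP; rewrite -leNgt.
have [_ _ _ E1] := QP n; have [_ _ _ E2] := Q'P n.
have i1 : leb.-integrable setT (EFin \o Q n) by have [] := QP n.
have i2 : leb.-integrable setT (EFin \o Q' n) by have [] := Q'P n.
have -> : (q (h n) (b n) (mu n) (x n) - q (h' n) (b n) (mu n) (x n)) 0 (i n)
      - (q (h n) (a n) (mu n) (x n) - q (h' n) (a n) (mu n) (x n)) 0 (i n) =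
    prim (G n) (b n) - prim (G n) (a n).
  have E1' := E1 _ _ a0 b0; have E2' := E2 _ _ a0 b0.
  have sub z1 z2 : (z1 - z2 : 'rV[R]_d) 0 (i n) = z1 0 (i n) - z2 0 (i n) by rewrite !mxE.
  rewrite !sub /G !prim_lincomb// !mul1r !mulN1r.
  exact: cross_diff.
have if_ : leb.-integrable setT (EFin \o f n).
  apply: (le_integrable measurableT _ _ (integrable_normR (iG n))).
    by apply/measurable_EFinP; exact: mf.
  move=> s _ /=; rewrite lee_fin normr_id ger0_norm//; exact: fG.
pose H s := M n * k s + 1 * f n s.
have iH : leb.-integrable setT (EFin \o H) by exact: integrable_lincomb.
have [a00 aT] : 0 <= a n /\ a n <= T by move: a0; rewrite in_itv /= => /andP.
have [b00 bT] : 0 <= b n /\ b n <= T by move: b0; rewrite in_itv /= => /andP.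
have : `|prim (G n) (b n) - prim (G n) (a n)| <= `|prim H (b n) - prim H (a n)|.
  apply: prim_btw_le => //; apply: aeW => s bs; rewrite /H mul1r /f bs -lerBlDl le_max.
  by apply/orP; right; rewrite mulrC.
move=> /le_trans; apply.
rewrite /H !prim_lincomb// !mul1r.
have -> : M n * prim k (b n) + prim (f n) (b n) - (M n * prim k (a n) + prim (f n) (a n)) =
   M n * (prim k (b n) - prim k (a n)) + (prim (f n) (b n) - prim (f n) (a n)) by ring.
apply: le_trans (ler_normD _ _) _; rewrite normrM (ger0_norm M0) lerD2l.
have f_le u w : 0 <= u -> u <= w -> prim (f n) u <= prim (f n) w.
  by move=> u0 uw; rewrite -subr_ge0; apply: prim_ge0 => //; apply: aeW => s _.
have fT : prim (f n) T <= e / 2.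
  rewrite /prim /Rintegral -lee_fin fineK; first exact: Hn0.
  by apply: integrable_fin_num => //; exact: (integrableS measurableT m0T (@subsetT _ _) if_).
have fp u : 0 <= prim (f n) u by apply: Rintegral_ge0 => s _.
exact: norm_diff_le (fp _) (fp _) (f_le _ _ a00 aT) (f_le _ _ b00 bT) fT e0.
Qed.

Hypothesis tau_v : C0_lebesgue_point dist2 (PP (cball rho) `*` cball rho)
  (fun t z => v t z.1 z.2) tau.

Lemma velocity_push_id mu x : PP K mu -> K x ->
  v tau (push K (fun y => y) mu) x = v tau mu x.
Proof.
move=> muK Kx; have [Cv _] := tau_v.
have uid : ucont r (fun y : 'rV[R]_d => y) by move=> e e0; exists e.
have sK : K `<=` cball rho by exact: cball_sub.
have pid : PP (cball rho) (push K (fun y => y) mu) by apply: push_PP => // y /sK.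
apply/eqP; rewrite -subr_eq0; apply/eqP/rowP => i; rewrite [RHS]mxE.
apply/eqP; rewrite -normr_eq0 eq_le normr_ge0 andbT; apply/ler_addgt0Pr => e e0.
rewrite add0r; apply: le_trans (coord_le_enorm _ _ _) _.
have muB : PP (cball rho) mu by move=> z /muK /sK.
have [delta delta0 Hd] := Cv (mu, x) (conj muB (sK _ Kx)) e e0.
apply: ltW; apply: (Hd (_, x)); first by split => //; exact: sK.
rewrite /dist2 /= subrr enorm0 addr0; apply: le_lt_trans delta0.
by apply: W1_push_id => // y _; rewrite subrr enorm0.
Qed.

(** At time [tau] the quotient is minus the average velocity over the interval
    between [tau] and [tau + h], on which the flow stays close to the identity
    and [v] is close to its value at [tau] in the mean, uniformly in space. *)
Lemma quotient_start e : 0 < e -> exists2 delta, 0 < delta &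
  forall h mu x, step h -> `|h| < delta -> PP K mu -> K x ->
    enorm (q h tau mu x + v tau mu x) <= e.
Proof.
move=> e0.
pose e1 := e / (2 * d.+1%:R).
have e10 : 0 < e1 by rewrite divr_gt0// mulr_gt0.
have [Cv lim] := tau_v.
have Cv3 : C0 dist3 (PP (cball rho) `*` cball rho `*` cball rho)
    (fun z : Pc R d * 'rV[R]_d * 'rV[R]_d => v tau z.1.1 z.1.2).
  move=> [[mu0 x0] y0] [[hm hx] hy] e' /(Cv _ (conj hm hx : (PP _ `*` cball _) (mu0, x0)))[delta d0 H].
  exists delta => // -[[m1 x1] y1] [[hm1 hx1] hy1] hd; apply: (H (m1, x1)) => //.
  by apply: le_lt_trans hd; rewrite /dist3 /= lerDl enorm_ge0.
have [d1 d10 H1] := C0_uniform r (G := fun mu x _ => v tau mu x) rho0 Cv3 e10.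
have [C1 C10 [d2 d20 H2]] := flow_start.
have [d3 d30 H3] := lebesgue_limit_bound lim e10.
have C11 : 0 < C1 + 1 by rewrite ltr_wpDl.
exists (Num.min (d1 / (C1 + 1)) (Num.min d2 d3)).
  by rewrite !lt_min divr_gt0// d20.
move=> h mu x [hn he h0]; rewrite !lt_min => /and3P[h1 h2 h3] muK Kx.
have uid : ucont r (fun y : 'rV[R]_d => y) by move=> e' e'0; exists e'.
have sK : K `<=` cball rho by exact: cball_sub.
have near_id s y : btw tau s (tau + h) -> K y -> enorm (Phi (tau + h) s mu y - y) <= d1.
  move=> bs Ky; apply: le_trans (H2 _ _ _ _ h2 h0 bs muK Ky) _.
  apply: (@le_trans _ _ ((C1 + 1) * `|h|)); first by rewrite ler_wpM2r// lerDl.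
  by rewrite mulrC -ler_pdivlMr// ltW.
apply: (@le_trans _ _ (d%:R * (2 * e1))); last first.
  rewrite /e1 -(ler_pM2r (_ : 0 < d.+1%:R)) ?ltr0Sn//.
  have -> : d%:R * (2 * (e / (2 * d.+1%:R))) * d.+1%:R = d%:R * e.
    have E (N : R) : N != 0 -> d%:R * (2 * (e / (2 * N))) * N = d%:R * e by move=> N0; field.
    by rewrite E// pnatr_eq0.
  by rewrite [leRHS]mulrC ler_wpM2r ?ler_nat// ltW.
apply: enorm_rV_le => i.
have [g hg _] := flow_rep i h0 muK Kx.
have inc : `|prim g (tau + h) - prim g tau - h * v tau mu x 0 i| <= (e1 + e1) * `|h|.
  apply: (lebesgue_increment hg tau0 h0 (ltW e10) (ltW e10) _ (H3 h hn h3)) => s bs.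
  have s0 := btw_itv tau0 h0 bs.
  have us := ucont2_slice s0 (flow_ucont2 hPhi h0 muK).
  have Bs y : K y -> cball rho (Phi (tau + h) s mu y) by move=> Ky; exact: rhoB.
  have ps := push_PP muK us Bs.
  have c1 : enorm (v tau (push K (Phi (tau + h) s mu) mu) (Phi (tau + h) s mu x) - v tau mu x) <= e1.
    rewrite -(velocity_push_id muK Kx).
    apply: (H1 mu (fun y => y) (Phi (tau + h) s mu) x _ x x) => //.
    - by move=> z; exact: near_id.
    - exact: sK.
    - exact: Bs.
    - exact: sK.
    - exact: sK.
    - exact: near_id.
    - by rewrite subrr enorm0 ltW.
  pose D := v s (push K (Phi (tau + h) s mu) mu) (Phi (tau + h) s mu x)
     - v tau (push K (Phi (tau + h) s mu) mu) (Phi (tau + h) s mu x).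
  apply: (@le_trans _ _ (enorm D)%:E).
    rewrite lee_fin ge_max enorm_ge0 /= lerBlDr /path_velocity.
    have -> : v s (push K (Phi (tau + h) s mu) mu) (Phi (tau + h) s mu x) 0 i - v tau mu x 0 i =
      (D + (v tau (push K (Phi (tau + h) s mu) mu) (Phi (tau + h) s mu x) - v tau mu x)) 0 i.
      by rewrite /D !mxE; ring.
    apply: le_trans (coord_le_enorm _ _ _) _; apply: le_trans (enormD _ _) _.
    by rewrite lerD2l.
  apply: ereal_sup_ubound.
  by exists (push K (Phi (tau + h) s mu) mu, Phi (tau + h) s mu x) => //; split => //; exact: Bs.
rewrite mxE /quotient (flow_self tau0 muK Kx) !mxE.
rewrite (flow_integral hPhi h0 muK Kx hg tau0).
have hne : h != 0 by rewrite -normr_gt0.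
have -> : h^-1 * (x 0 i + (prim g tau - prim g (tau + h)) - x 0 i) + v tau mu x 0 i =
    - h^-1 * (prim g (tau + h) - prim g tau - h * v tau mu x 0 i).
  by field.
rewrite normrM normrN normfV ler_pdivrMl//; apply: le_trans inc _.
by rewrite mulrC mulr_natl.
Qed.

Lemma quotient_cauchy e : 0 < e -> exists2 delta, 0 < delta &
  forall h h' t mu x, step h -> step h' -> `|h| < delta -> `|h'| < delta ->
    t \in `[0, T] -> PP K mu -> K x -> enorm (q h t mu x - q h' t mu x) <= e.
Proof.
move=> e0; have [C2 C20 HC] := @vector_gronwall R d T k T0 ik k0.
pose e1 := e / (3 * (C2 + 1)).
have C21 : 0 < C2 + 1 by rewrite ltr_wpDl.
have e10 : 0 < e1 by rewrite divr_gt0// mulr_gt0.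
have [d1 d10 H1] := quotient_start e10; have [d2 d20 H2] := quotient_increment e10.
exists (Num.min d1 d2); first by rewrite lt_min d10.
move=> h h' t mu x sh sh'; rewrite !lt_min => /andP[h1 h2] /andP[h1' h2'] t0 muK Kx.
apply: (@le_trans _ _ (C2 * ((e1 + e1) + e1))); last first.
  have -> : e = (C2 + 1) * (e1 + e1 + e1) by rewrite /e1; field; rewrite gt_eqF.
  by rewrite ler_wpM2r ?addr_ge0 ?ltW// ltrDl.
apply: (HC _ (fun y => K y) (fun s y => q h s mu y - q h' s mu y) tau (e1 + e1) (C + C) e1) => //.
- by rewrite addr_ge0// ltW.
- exact: ltW.
- move=> s y s0 Ky; apply: le_trans (enormD _ _) _; rewrite enormN.
  by have [? ? ?] := sh; have [? ? ?] := sh'; apply: lerD; exact: quotient_le.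
- move=> y Ky; apply: le_trans (enorm_trans (- v tau mu y) _ _) _.
  rewrite opprK; apply: lerD; first exact: H1.
  by rewrite -opprD enormN addrC; exact: H1.
- move=> a b M y i a0 b0 M0 hM Ky; exact: H2.
Qed.

(** * The linearised equation *)

Hypothesis tauT : tau < T.

Notation lin s mu w x i := (linearisation (v s) (Dmuv s) r mu (Phi tau s mu) w x 0 i).

(** A sequence of admissible steps along which the limit of the quotients is
    taken; they are positive since [tau] is not the final time. *)
Definition test_step (n : nat) : R := Num.min (T - tau) (eta / 2) / n.+1%:R.

Let h0 : 0 < Num.min (T - tau) (eta / 2).
Proof. by rewrite lt_min subr_gt0 tauT divr_gt0. Qed.

Lemma test_step_gt0 n : 0 < test_step n.
Proof. by rewrite divr_gt0. Qed.

Lemma test_stepP n : step (test_step n).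
Proof.
have p := test_step_gt0 n.
have le : test_step n <= Num.min (T - tau) (eta / 2).
  by rewrite /test_step ler_pdivrMr// ler_peMr ?(ltW h0)// ler1n.
move: le; rewrite le_min => /andP[l1 l2]; split.
- by rewrite gtr0_norm.
- by rewrite gtr0_norm//; apply: le_lt_trans l2 _; rewrite gtr_pMr// invf_lt1// ltr1n.
- move: tau0; rewrite !in_itv /= => /andP[t0 _].
  by rewrite addr_ge0 ?(ltW p)//= -lerBrDl.
Qed.

Lemma test_step_small delta : 0 < delta ->
  exists n0, forall n, (n0 <= n)%N -> `|test_step n| < delta.
Proof.
move=> d0; have d1 : 0 < delta / Num.min (T - tau) (eta / 2) by rewrite divr_gt0.
have [n0 _ hn] := near_infty_natSinv_lt (PosNum d1).
exists n0 => n /hn /=; rewrite gtr0_norm ?test_step_gt0//.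
by rewrite ltr_pdivlMr// mulrC.
Qed.

Definition psi mu t x : 'rV[R]_d := \row_i limn (fun n => q (test_step n) t mu x 0 i).

Lemma psi_cvg mu t x : PP K mu -> t \in `[0, T] -> K x ->
  seq_cvg (fun n => q (test_step n) t mu x) (psi mu t x).
Proof.
move=> muK t0 Kx; apply: seq_cvg_coord => i; rewrite mxE.
apply: cauchy_cvg; apply: cauchy_exP => e e0.
have e2 : 0 < e / 2 by rewrite divr_gt0.
have [delta d0 H] := quotient_cauchy e2; have [n0 Hn] := test_step_small d0.
exists (q (test_step n0) t mu x 0 i); exists n0 => // n /= hn.
have := H _ _ t mu x (test_stepP n0) (test_stepP n) (Hn _ (leqnn _)) (Hn _ hn) t0 muK Kx.
have := coord_le_enorm (q (test_step n0) t mu x - q (test_step n) t mu x) 0 i.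
rewrite /ball /= ![(_ - _ : 'rV_d) _ _]mxE [(- _ : 'rV_d) _ _]mxE => h1 h2.
apply: le_lt_trans h1 _; apply: le_lt_trans h2 _.
by rewrite gtr_pMr// invf_lt1// ltr1n.
Qed.

Lemma psi_limit e : 0 < e -> exists2 delta, 0 < delta &
  forall h t mu x, step h -> `|h| < delta -> t \in `[0, T] -> PP K mu -> K x ->
    enorm (q h t mu x - psi mu t x) <= e.
Proof.
move=> e0; have [delta d0 H] := quotient_cauchy e0; exists delta => // h t mu x sh hd t0 muK Kx.
apply/ler_addgt0Pr => e' /(psi_cvg muK t0 Kx)[n1 H1].
have [n2 H2] := test_step_small d0; pose n := maxn n1 n2.
apply: le_trans (enorm_trans (q (test_step n) t mu x) _ _) _; apply: lerD.
  by apply: H => //; [exact: test_stepP|apply: H2; exact: leq_maxr].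
by apply/ltW/H1; exact: leq_maxl.
Qed.

Lemma psi_ucont2 mu : PP K mu -> ucont2 T r (psi mu).
Proof.
move=> muK; apply: ucont2_uniform_limit => e /psi_limit[delta d0 H].
have [n Hn] := test_step_small d0; have [_ _ s0] := test_stepP n.
exists (fun t => q (test_step n) t mu); first exact: quotient_ucont2.
move=> t x t0 Kx; rewrite enormB; apply: H => //; first exact: test_stepP.
exact: Hn.
Qed.

Lemma psi_start mu x : PP K mu -> K x -> psi mu tau x = - v tau mu x.
Proof.
move=> muK Kx; apply/eqP; rewrite -subr_eq0 opprK; apply/eqP/rowP => i; rewrite [RHS]mxE.
apply/eqP; rewrite -normr_eq0 eq_le normr_ge0 andbT; apply/ler_addgt0Pr => e e0.
rewrite add0r; apply: le_trans (coord_le_enorm _ _ _) _.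
have e2 : 0 < e / 2 by rewrite divr_gt0.
have [d1 d10 H1] := psi_limit e2.
have [d2 d20 H2] := quotient_start e2.
have [n1 Hn1] := test_step_small d10; have [n2 Hn2] := test_step_small d20.
pose n := maxn n1 n2.
have a1 := H1 _ tau mu x (test_stepP n) (Hn1 _ (leq_maxl _ _)) tau0 muK Kx.
have a2 := H2 _ mu x (test_stepP n) (Hn2 _ (leq_maxr _ _)) muK Kx.
rewrite (splitr e).
have -> : psi mu tau x + v tau mu x = (q (test_step n) tau mu x + v tau mu x)
   - (q (test_step n) tau mu x - psi mu tau x).
  by rewrite opprB [RHS]addrC [in RHS]addrA subrK.
by apply: le_trans (enormD _ _) _; rewrite enormN; exact: lerD.
Qed.

Lemma psi_le mu t x : PP K mu -> t \in `[0, T] -> K x -> enorm (psi mu t x) <= C.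
Proof.
move=> muK t0 Kx; apply: (seq_cvg_ball _ (psi_cvg muK t0 Kx)) => n.
by have [s1 s2 s3] := test_stepP n; exact: quotient_le.
Qed.

Let m0T : @measurable _ (g_sigma_algebraType R.-ocitv.-measurable) (`[0, T]%classic : set R).
Proof. exact: measurable_itv. Qed.

(** The velocity quotients converge almost everywhere to the linearised
    velocity, which is therefore measurable, and whose integral is the
    increment of the limit. *)
Lemma psi_integral mu x i : PP K mu -> K x -> exists g : R -> R,
  [/\ leb.-integrable setT (EFin \o g),
      {ae leb, forall s, s \in `[0, T] -> g s = lin s mu (psi mu s) x i},
      (forall s, `|g s| <= C * k s) &
      forall a b, a \in `[0, T] -> b \in `[0, T] ->
        psi mu b x 0 i - psi mu a x 0 i = prim g b - prim g a].
Proof.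
move=> muK Kx.
have /choice[Q QP] := fun n => quotient_rep i (test_stepP n) muK Kx.
have A1 := ae_forall_nat (fun n => let: And4 _ h _ _ := QP n in h).
have A2 := ae_forall_nat (fun n => let: And4 _ _ h _ := QP n in h).
have [N [mN N0 sN]] := ae_and (ae_and A1 A2) regular.
have goodP s : s \in `[0, T] -> ~ N s -> [/\
    forall n, Q n s = (test_step n)^-1 * (path_velocity v r (fun t => Phi (tau + test_step n) t mu) mu x i s
      - path_velocity v r (fun t => Phi tau t mu) mu x i s),
    forall n, `|Q n s| <= C * k s &
    exists l L, [/\ 0 <= l, 0 <= L, l + L = k s & velocity_regular (v s) (Dmuv s) rho l L]].
  move=> s0 nN; apply: contrapT => h; apply: nN; apply: sN => /= -[[h1 h2] h3]; apply: h.
  by split => [n|n|]; [exact: h1|exact: h2|exact: h3].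
have lim_lin s : s \in `[0, T] -> ~ N s -> forall e, 0 < e -> exists n0, forall n, (n0 <= n)%N ->
    `|lin s mu (psi mu s) x i - Q n s| < e.
  move=> s0 nN e e0; have [QE _ reg] := goodP s s0 nN.
  have e3 : 0 < e / 3 by rewrite divr_gt0.
  have [d1 d10 H1] := quotient_linearisation s0 reg e3.
  have kk : 0 < k s + 1 by rewrite ltr_wpDl.
  have e4 : 0 < e / 3 / (k s + 1) by rewrite divr_gt0.
  have [d2 d20 H2] := psi_limit e4.
  have [n1 Hn1] := test_step_small d10; have [n2 Hn2] := test_step_small d20.
  exists (maxn n1 n2) => n; rewrite geq_max => /andP[/Hn1 a1 /Hn2 a2].
  have [s1 s2 s3] := test_stepP n.
  have b1 := H1 _ mu x i s1 a1 s3 muK Kx; rewrite -QE in b1.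
  have [l [L [l0 L0 lL [lip Vd _ Vg _]]]] := reg.
  have ut := ucont2_slice s0 (flow_ucont2 hPhi tau0 muK).
  have u1 := ucont2_slice s0 (quotient_ucont2 s3 muK).
  have u2 := ucont2_slice s0 (psi_ucont2 muK).
  have c1 y : K y -> enorm (q (test_step n) s mu y) <= C by move=> Ky; exact: quotient_le.
  have c2 y : K y -> enorm (psi mu s y) <= C by move=> Ky; exact: psi_le.
  have uw := ucont_lincomb 1 (-1) u2 u1.
  have wM y : K y -> enorm (1 *: psi mu s y + (-1) *: q (test_step n) s mu y) <= e / 3 / (k s + 1).
    move=> Ky; rewrite scale1r scaleN1r enormB; apply: H2 => //; exact: test_stepP.
  have b2 := linearisation_le l0 L0 lip Vd Vg muK ut uw (ltW e4) wM (fun y Ky => rhoB tau0 s0 muK Ky) i Kx.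
  rewrite (linearisation_lincomb Vg 1 (-1) x i muK ut u2 u1 C_ge0 c2 c1) lL in b2.
  have b3 : k s * (e / 3 / (k s + 1)) <= e / 3.
    by rewrite mulrCA ler_piMr ?(ltW e3)// ler_pdivrMr// mul1r lerDl.
  rewrite distrC in b1.
  have b4 := le_trans b2 b3.
  have tri := ler_distD (lin s mu (q (test_step n) s mu) x i) (lin s mu (psi mu s) x i) (Q n s).
  rewrite mul1r mulN1r in b4.
  apply: le_lt_trans tri _; apply: le_lt_trans (lerD b4 b1) _.
  exact: third_add.
pose good s := (s \in `[0, T]) && (s \notin N).
have mgood : measurable_fun setT (good : R -> bool).
  apply: measurable_and.
    apply: (@measurable_fun_bool _ _ _ _ true); rewrite setTI.
    by rewrite (_ : _ @^-1` _ = `[0, T]%classic)//; apply/seteqP; split.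
  apply: (@measurable_fun_bool _ _ _ _ true); rewrite setTI.
  rewrite (_ : _ @^-1` _ = ~` N); first exact: measurableC.
  by apply/seteqP; split => s /=; [move/negP => h /mem_set|move=> h; apply/negP => /set_mem].
have goodE s : good s -> s \in `[0, T] /\ ~ N s.
  by move=> /andP[? /negP h]; split => // Ns; apply: h; exact/mem_set.
pose g s := if good s then lin s mu (psi mu s) x i else 0.
pose Q' n s := if good s then Q n s else 0.
have mQ' n : measurable_fun setT (Q' n).
  apply: measurable_fun_ifT => //.
  by have [h _ _ _] := QP n; move/integrableP: h => [/measurable_EFinP].
have cQ' s : Q' ^~ s @ \oo --> g s.
  rewrite /Q' /g; case: ifPn => [/goodE[s0 nN]|_]; last exact: cvg_cst.
  by apply/cvgrPdist_lt => e /(lim_lin s s0 nN)[n0 Hn]; exists n0.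
have mg : measurable_fun setT g.
  by apply: (@measurable_fun_cvg _ _ _ _ Q') => // s _; exact: cQ'.
have gC s : `|g s| <= C * k s.
  rewrite /g; case: ifPn => [/goodE[s0 nN]|_]; last by rewrite normr0 mulr_ge0.
  have [_ QC _] := goodP s s0 nN.
  apply/ler_addgt0Pr => e /(lim_lin s s0 nN)[n0 /(_ n0 (leqnn _)) Hn].
  have := ler_normD (lin s mu (psi mu s) x i - Q n0 s) (Q n0 s); rewrite subrK.
  move=> /le_trans; apply; rewrite addrC; apply: lerD; first exact: QC.
  exact: ltW.
have iCk : leb.-integrable setT (EFin \o (fun s => C * k s + 0 * k s)) by exact: integrable_lincomb.
have ig : leb.-integrable setT (EFin \o g).
  apply: (le_integrable measurableT _ _ iCk); first exact/measurable_EFinP.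
  move=> s _ /=; rewrite lee_fin mul0r addr0 [leRHS]ger0_norm ?mulr_ge0//; exact: gC.
have NT : {ae leb, forall s, ~ N s} by exists N; split => // s /= /contrapT.
exists g; split => //.
  apply: (ae_imp NT) => s nN s0; rewrite /g /good s0 /=.
  by case: ifPn => // /negPn /set_mem.
move=> a b a0 b0; apply/eqP; rewrite -subr_eq0; apply/eqP/norm_le_small => e e0.
pose f n s := `|1 * Q n s + (-1) * g s|.
have iQ n : leb.-integrable setT (EFin \o Q n) by have [] := QP n.
have iQg n : leb.-integrable setT (EFin \o (fun s => 1 * Q n s + (-1) * g s)) by exact: integrable_lincomb.
have if_ n : leb.-integrable setT (EFin \o f n) by exact: integrable_normR.
have i2 : leb.-integrable setT (EFin \o (fun s => (C + C) * k s + 0 * k s)) by exact: integrable_lincomb.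
have mf n : measurable_fun (`[0, T]%classic : set R) (f n).
  by apply: measurable_funTS; move/integrableP: (if_ n) => [/measurable_EFinP].
have dom n : {ae leb, forall s, `[0, T]%classic s -> 0 <= f n s <= (C + C) * k s + 0 * k s}.
  have [_ _ B1 _] := QP n; apply: (ae_imp B1) => s h1 s0.
  rewrite /f normr_ge0 /= mul0r addr0 mulrDl mul1r mulN1r.
  by apply: le_trans (ler_normB _ _) _; apply: lerD; [exact: h1|exact: gC].
have cvg0 : {ae leb, forall s, `[0, T]%classic s -> forall e', 0 < e' ->
    exists n0, forall n, (n0 <= n)%N -> f n s < e'}.
  apply: (ae_imp NT) => s nN s0 e' e'0.
  have [n0 Hn] := lim_lin s s0 nN _ e'0; exists n0 => n /Hn.
  rewrite /f mul1r mulN1r distrC /g /good (_ : s \in `[0, T])//=.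
  by case: ifPn => // /negPn /set_mem.
have e4 : 0 < e / 4 by rewrite divr_gt0.
have e3 : 0 < e / 2 by rewrite divr_gt0.
have e2 : 0 < e / 2 / 2 by rewrite !divr_gt0.
have [n1 Hn1] := dominated_to0 m0T mf (integrableS measurableT m0T (@subsetT _ _) i2) dom cvg0 e2.
have [nb Hnb] := psi_cvg muK b0 Kx e4; have [na Hna] := psi_cvg muK a0 Kx e4.
pose n := (n1 + nb + na)%N.
have [_ _ _ E] := QP n.
have [a00 aT] : 0 <= a /\ a <= T by move: a0; rewrite in_itv /= => /andP.
have [b00 bT] : 0 <= b /\ b <= T by move: b0; rewrite in_itv /= => /andP.
have f_le u w : 0 <= u -> u <= w -> prim (f n) u <= prim (f n) w.
  move=> u0 uw; rewrite -subr_ge0; apply: prim_ge0 => //; apply: aeW => s _; exact: normr_ge0.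
have fT : prim (f n) T <= e / 2 / 2.
  rewrite /prim /Rintegral -lee_fin fineK.
    by apply: Hn1; rewrite /n -addnA leq_addr.
  by apply: integrable_fin_num => //; exact: (integrableS measurableT m0T (@subsetT _ _) (if_ n)).
have fp u : 0 <= prim (f n) u by apply: Rintegral_ge0 => s _; exact: normr_ge0.
have h1 : `|(prim (Q n) b - prim (Q n) a) - (prim g b - prim g a)| <= e / 2.
  have : `|prim (fun s => 1 * Q n s + (-1) * g s) b - prim (fun s => 1 * Q n s + (-1) * g s) a|
     <= `|prim (f n) b - prim (f n) a|.
    by apply: prim_btw_le => //; apply: aeW => s _.
  rewrite !prim_lincomb// => h1.
  have h2 := norm_diff_le (fp a) (fp b) (f_le _ _ a00 aT) (f_le _ _ b00 bT) fT e3.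
  apply: le_trans h2; apply: le_trans h1.
  by rewrite le_eqVlt; apply/orP; left; apply/eqP; congr (`|_|); ring.
have cc t (t0 : t \in `[0, T]) : enorm (q (test_step n) t mu x - psi mu t x) < e / 4 ->
    `|psi mu t x 0 i - q (test_step n) t mu x 0 i| <= e / 4.
  rewrite enormB => /ltW; apply: le_trans.
  by have := coord_le_enorm (psi mu t x - q (test_step n) t mu x) 0 i; rewrite !mxE.
have hb := cc b b0 (Hnb n ltac:(rewrite /n addnAC leq_addl//)).
have ha := cc a a0 (Hna n ltac:(rewrite /n leq_addl//)).
rewrite -(E a b a0 b0) in h1.
exact: four_point hb ha h1.
Qed.

Lemma psi_increment mu x a b : PP K mu -> K x -> 0 <= a -> a <= b -> b <= T ->
  enorm (psi mu b x - psi mu a x) <= d%:R * C * (prim k b - prim k a).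
Proof.
move=> muK Kx a0 ab bT.
have aI : a \in `[0, T] by rewrite in_itv /= a0 (le_trans ab bT).
have bI : b \in `[0, T] by rewrite in_itv /= bT (le_trans a0 ab).
rewrite -mulrA; apply: enorm_rV_le => i.
have [g [ig _ gC E]] := psi_integral i muK Kx.
have -> : (psi mu b x - psi mu a x) 0 i = psi mu b x 0 i - psi mu a x 0 i.
  by rewrite [LHS]mxE [X in _ + X]mxE.
rewrite E//.
have iCk : leb.-integrable setT (EFin \o (fun s => C * k s + 0 * k s)) by exact: integrable_lincomb.
have := @prim_norm_le _ g (fun s => C * k s + 0 * k s) a b ig iCk a0 ab.
rewrite !prim_lincomb// !mul0r !addr0 -mulrBr; apply.
by apply: aeW => s _; rewrite mul0r addr0; exact: gC.
Qed.

Let kE : (fun t => `|k t|) = k.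
Proof. by apply/funext => t; rewrite ger0_norm. Qed.

Lemma psi_abs_continuous mu x : PP K mu -> K x -> abs_continuous T (fun t => psi mu t x).
Proof.
move=> muK Kx e e0.
have dC : 0 < d%:R * C + 1 by rewrite ltr_wpDl// mulr_ge0.
have [delta d0 H] := prim_sum_small ik (divr_gt0 e0 dC); exists delta => // n a b ab tI sd.
have ab' j : 0 <= a j /\ a j <= b j by have [? [? _]] := ab j.
have := H n a b ab' tI sd; rewrite kE ltr_pdivlMr// => hs.
apply: le_lt_trans hs; rewrite mulr_suml; apply: ler_sum => j _.
have [a0 [abj bT]] := ab j.
apply: le_trans (psi_increment muK Kx a0 abj bT) _; rewrite mulrC ler_wpM2l ?lerDl//.
by apply: prim_ge0 => //; apply: aeW.
Qed.

Lemma psi_solution mu : PP K mu -> linearised_solution T v Dmuv K Phi tau mu (psi mu).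
Proof.
move=> muK; split; first exact: ucont2_within (psi_ucont2 muK).
move=> x Kx; split; [exact: psi_abs_continuous| |exact: psi_start].
have /choice[g gP] := fun i => psi_integral i muK Kx.
have A1 := ae_forall_ord (fun i => let: And4 _ h _ _ := gP i in h).
have A2 := ae_forall_ord (fun i => let: And4 h _ _ _ := gP i in prim_derive T0 h).
apply: (ae_imp (ae_and A1 A2)) => t [h1 h2] tI.
have tI' : t \in `[0, T] by apply: subset_itv_oo_cc tI.
rewrite (_ : linearised_rhs _ _ _ _ _ _ _ _ _ =
  linearisation (v t) (Dmuv t) r mu (Phi tau t mu) (psi mu t) x)//.
apply: expands_rV => i; rewrite -h1//.
have [_ _ _ E] := gP i.
have [t0 tT] : 0 < t /\ t < T by move: tI; rewrite in_itv /= => /andP.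
apply: (@expands_shift _ _ (prim (g i)) _ _ (psi mu t x 0 i - prim (g i) t) (Num.min t (T - t))).
- by rewrite lt_min t0 subr_gt0.
- move=> h; rewrite lt_min => /andP[ht hT].
  have thI : t + h \in `[0, T].
    move: ht hT; rewrite !ltr_norml => /andP[? ?] /andP[? ?]; rewrite in_itv /=.
    by apply/andP; split; apply/ltW; [rewrite addrC -ltrBlDr sub0r|rewrite addrC -ltrBrDr].
  by rewrite addrAC -addrA -(E _ _ tI' thI) addrC subrK.
- exact: is_derive_expands (h2 i tI).
Qed.

(** For either sign [sg], the function of time that is compared at [a] and [b]
    is absolutely continuous, and the bound on the linearised velocity of
    [w1 - w2] makes its derivative nonnegative. *)
Lemma solution_increment mu (w1 w2 : R -> 'rV[R]_d -> 'rV[R]_d) x i a b M sg : PP K mu -> K x ->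
  linearised_solution T v Dmuv K Phi tau mu w1 ->
  linearised_solution T v Dmuv K Phi tau mu w2 ->
  0 <= a -> a <= b -> b <= T -> 0 <= M -> `|sg| = 1 ->
  (forall s y, a <= s <= b -> K y -> enorm (w1 s y - w2 s y) <= M) ->
  M * prim k a + (- sg) * (1 * w1 a x 0 i + (-1) * w2 a x 0 i) <=
  M * prim k b + (- sg) * (1 * w1 b x 0 i + (-1) * w2 b x 0 i).
Proof.
move=> muK Kx S1 S2 a0 ab bT M0 sg1 hM.
have [c1 p1] := S1; have [c2 p2] := S2.
have [ac1 D1 _] := p1 x Kx; have [ac2 D2 _] := p2 x Kx.
have u1 := within_ucont2 c1; have u2 := within_ucont2 c2.
have [B1 B10 hB1] := ucont2_bounded u1; have [B2 B20 hB2] := ucont2_bounded u2.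
pose F s := M * prim k s + (- sg) * (1 * w1 s x 0 i + (-1) * w2 s x 0 i).
rewrite -/(F a) -/(F b).
apply: ac_nondecreasing => //.
- move=> e e0; have e3 : 0 < e / 3 by rewrite divr_gt0.
  have M1 : 0 < M + 1 by rewrite ltr_wpDl.
  have [d1 d10 H1] := ac1 _ e3; have [d2 d20 H2] := ac2 _ e3.
  have [d3 d30 H3] := prim_sum_small ik (divr_gt0 e3 M1).
  exists (Num.min d1 (Num.min d2 d3)); first by rewrite !lt_min d10 d20.
  move=> n y z yz tI; rewrite !lt_min => /and3P[s1 s2 s3].
  have yz1 j : 0 <= y j /\ y j <= z j /\ z j <= T.
    have [g1 [g2 g3]] := yz j; split; first exact: le_trans g1.
    by split => //; exact: le_trans bT.
  have yz2 j : 0 <= y j /\ y j <= z j by have [? [? _]] := yz1 j.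
  have := H3 n y z yz2 tI s3; rewrite kE ltr_pdivlMr// => h3.
  have h1 := H1 n y z yz1 tI s1; have h2 := H2 n y z yz1 tI s2.
  have -> : e = e / 3 + (e / 3 + e / 3) by field.
  apply: le_lt_trans (ltrD h3 (ltrD h1 h2)).
  rewrite mulr_suml -!big_split /=; apply: ler_sum => j _.
  have [y0 yzj] := yz2 j.
  have kp : 0 <= prim k (z j) - prim k (y j) by apply: prim_ge0 => //; apply: aeW.
  have sub (z1 z2 : 'rV[R]_d) : (z1 - z2) 0 i = z1 0 i - z2 0 i by rewrite [LHS]mxE [X in _ + X]mxE.
  have E : F (z j) - F (y j) = M * (prim k (z j) - prim k (y j)) +
    (- sg) * ((w1 (z j) x - w1 (y j) x) 0 i - (w2 (z j) x - w2 (y j) x) 0 i).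
    by rewrite /F !sub; ring.
  rewrite E; apply: le_trans (ler_normD _ _) _; apply: lerD.
    by rewrite ger0_norm ?mulr_ge0// [leRHS]mulrC ler_wpM2r// lerDl.
  rewrite normrM normrN sg1 mul1r; apply: le_trans (ler_normB _ _) _.
  by apply: lerD; exact: coord_le_enorm.
apply: (ae_imp (ae_and (ae_and D1 D2) (ae_and (prim_derive T0 ik) regular))).
move=> t [[h1 h2] [h3 h4]]; rewrite in_itv /= => /andP[at_ tb].
have tI : t \in `]0, T[ by rewrite in_itv /= (le_lt_trans a0 at_) (lt_le_trans tb bT).
have tI' : t \in `[0, T] by apply: subset_itv_oo_cc tI.
have {}h1 := rV_expands i (h1 tI); have {}h2 := rV_expands i (h2 tI).
have {}h3 := is_derive_expands (h3 tI).
have [l [L [l0 L0 lL [lip Vd _ Vg _]]]] := h4 tI'.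
have ut := ucont2_slice tI' (flow_ucont2 hPhi tau0 muK).
have v1 := ucont2_slice tI' u1; have v2 := ucont2_slice tI' u2.
have uw := ucont_lincomb 1 (-1) v1 v2.
have wM y : K y -> enorm (1 *: w1 t y + (-1) *: w2 t y) <= M.
  by move=> Ky; rewrite scale1r scaleN1r; apply: hM => //; rewrite !ltW.
have BB : 0 <= B1 + B2 by exact: addr_ge0.
have b1 y : K y -> enorm (w1 t y) <= B1 + B2.
  by move=> Ky; apply: le_trans (hB1 t y tI' Ky) _; rewrite lerDl.
have b2 y : K y -> enorm (w2 t y) <= B1 + B2.
  by move=> Ky; apply: le_trans (hB2 t y tI' Ky) _; rewrite lerDr.
have := linearisation_le l0 L0 lip Vd Vg muK ut uw M0 wM (fun y Ky => rhoB tau0 tI' muK Ky) i Kx.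
rewrite (linearisation_lincomb Vg 1 (-1) x i muK ut v1 v2 BB b1 b2) lL => bound.
exists (M * k t + (- sg) * (1 * lin t mu (w1 t) x i + (-1) * lin t mu (w2 t) x i)).
  have : `|(- sg) * (1 * lin t mu (w1 t) x i + -1 * lin t mu (w2 t) x i)| <= M * k t.
    by rewrite normrM normrN sg1 [leLHS]mul1r [leRHS]mulrC.
  by rewrite ler_norml => /andP[+ _]; rewrite -subr_ge0 opprK addrC.
exact: (expands_lincomb M (- sg) h3 (expands_lincomb 1 (-1) h1 h2)).
Qed.

Lemma solution_unique mu (w : R -> 'rV[R]_d -> 'rV[R]_d) t x : PP K mu ->
  linearised_solution T v Dmuv K Phi tau mu w -> t \in `[0, T] -> K x -> w t x = psi mu t x.
Proof.
move=> muK Sw t0 Kx; have Sp := psi_solution muK.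
have [C2 C20 HC] := @vector_gronwall R d T k T0 ik k0.
have uw := within_ucont2 Sw.1.
have [B1 B10 hB1] := ucont2_bounded uw.
have : enorm (w t x - psi mu t x) <= C2 * (0 + 0).
  apply: (HC _ (fun y => K y) (fun s y => w s y - psi mu s y) tau 0 (B1 + C) 0) => //.
  - move=> s y s0 Ky; apply: le_trans (enormD _ _) _; rewrite enormN.
    by apply: lerD; [exact: hB1|exact: psi_le].
  - move=> y Ky; have [_ _ ->] := Sw.2 y Ky; rewrite psi_start// subrr enorm0 //.
  - move=> a b M y i a0 b0 M0 hM Ky.
    have sub (z1 z2 : 'rV[R]_d) : (z1 - z2) 0 i = z1 0 i - z2 0 i by rewrite [LHS]mxE [X in _ + X]mxE.
    have [a00 aT] : 0 <= a /\ a <= T by move: a0; rewrite in_itv /= => /andP.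
    have [b00 bT] : 0 <= b /\ b <= T by move: b0; rewrite in_itv /= => /andP.
    have K_le u z : 0 <= u -> u <= z -> prim k u <= prim k z.
      by move=> u0 uz; rewrite -subr_ge0; apply: prim_ge0 => //; apply: aeW.
    rewrite !sub addr0.
    have inc u z (u0 : 0 <= u) (uz : u <= z) (zT : z <= T)
        (hh : forall s y, u <= s <= z -> K y -> enorm (w s y - psi mu s y) <= M) :
        `|w z y 0 i - psi mu z y 0 i - (w u y 0 i - psi mu u y 0 i)| <= M * `|prim k z - prim k u|.
      have i1 := solution_increment i muK Ky Sw Sp u0 uz zT M0 (normr1 R) hh.
      have i2 := solution_increment i muK Ky Sw Sp u0 uz zT M0 (normrN1 R) hh.
      rewrite [X in _ <= _ * X]ger0_norm ?subr_ge0 ?K_le//.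
      exact: two_sided i1 i2.
    have [ab|/ltW ba] := leP a b.
      by apply: inc => // s z sab Kz; apply: hM => //; rewrite /btw sab.
    rewrite distrC [X in _ <= _ * X]distrC.
    by apply: inc => // s z sab Kz; apply: hM => //; rewrite /btw sab orbT.
rewrite addr0 mulr0 => h; apply/eqP; rewrite -subr_eq0; apply/eqP/rowP => i.
rewrite [RHS]mxE; apply/eqP; rewrite -normr_eq0 eq_le normr_ge0 andbT.
exact: le_trans (coord_le_enorm _ _ _) h.
Qed.

Lemma flow_expansion e : 0 < e -> exists2 delta, 0 < delta &
  forall h t mu x, tau + h \in `[0, T] -> `|h| < delta -> t \in `[0, T] -> PP K mu -> K x ->
    enorm (Phi (tau + h) t mu x - (Phi tau t mu x + h *: psi mu t x)) <= e * `|h|.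
Proof.
move=> /psi_limit[delta d0 H].
exists (Num.min eta delta); first by rewrite lt_min eta0.
move=> h t mu x hI; rewrite lt_min => /andP[he hd] t0 muK Kx.
have [->|hn] := eqVneq h 0.
  by rewrite addr0 scale0r addr0 subrr enorm0 normr0 mulr0.
have hp : 0 < `|h| by rewrite normr_gt0.
have -> : Phi (tau + h) t mu x - (Phi tau t mu x + h *: psi mu t x) =
   h *: (q h t mu x - psi mu t x).
  by rewrite scalerBr /quotient scalerA divff// scale1r opprD addrA.
by rewrite enormZ mulrC ler_wpM2r//; apply: H.
Qed.

End Quotients.

(** * Differentiability of the flow in its initial time *)

Section Limits.
Context {R : realType}.

Lemma supnorm_le {Z : Type} {p n : nat} (A : set Z) (F : Z -> 'M[R]_(p, n)) (c : R) :
  (forall z, A z -> enorm (F z) <= c) -> (supnorm A F <= c%:E)%E.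
Proof. by move=> h; apply: ge_ereal_sup => _ [z Az <-]; rewrite lee_fin h. Qed.

Lemma supnorm_ge0 {Z : Type} {p n : nat} (A : set Z) (F : Z -> 'M[R]_(p, n)) :
  A !=set0 -> (0 <= supnorm A F)%E.
Proof.
move=> [z Az]; apply: le_trans (_ : (enorm (F z))%:E <= _)%E.
  by rewrite lee_fin enorm_ge0.
by apply: ereal_sup_ubound; exists z.
Qed.

Lemma cvg_ereal0 (F : set_system R) {FF : Filter F} (G : R -> \bar R) :
  (\forall h \near F, (0 <= G h)%E) ->
  (forall e : R, 0 < e -> \forall h \near F, (G h <= e%:E)%E) ->
  G h @[h --> F] --> (0 : \bar R).
Proof.
move=> h0 hG; apply/fine_cvgP; split.
  apply: filterS2 h0 (hG 1 ltr01) => h a b.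
  by rewrite ge0_fin_numE// (le_lt_trans b)// ltry.
apply/cvgrPdist_le => e e0.
apply: filterS2 h0 (hG e e0) => h a b /=.
have fG : G h \is a fin_num by rewrite ge0_fin_numE// (le_lt_trans b)// ltry.
rewrite sub0r normrN ger0_norm; last exact: fine_ge0.
by rewrite -lee_fin fineK.
Qed.

End Limits.

Lemma Pc_exists (R : realType) (d : nat) (r : R) : 0 <= r ->
  exists mu : Pc R d, PP (cball r) mu.
Proof.
move=> r0; pose P := uniform_prob (@ltr01 R).
have [||nu _ nuP] := @law_exists R _ _ P d (fun=> 0) r.
- exact: measurable_cst.
- by move=> w; exact: cball0.
- by exists nu.
Qed.

Theorem propositionA6 (R : realType) (d : nat) (hd : (0 < d)%N)
    (T : R) (hT : 0 < T)
    (v : R -> Pc R d -> 'rV[R]_d -> 'rV[R]_d)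
    (Dmuv : R -> Pc R d -> 'rV[R]_d -> 'rV[R]_d -> 'M[R]_d)
    (m : R -> R) (hCE : CE T v Dmuv m)
    (r : R) (hr : 0 < r)
    (Tstar : set R) (hTstar : uniform_lebesgue_set T v Dmuv Tstar)
    (Phi : R -> R -> Pc R d -> 'rV[R]_d -> 'rV[R]_d)
    (hPhi : nonlocal_flow T v (cball r) Phi) :
  let K : set 'rV[R]_d := cball r in
  let TT : set R := Tstar `&` lebesgue_points T m in
  forall tau : R, TT tau ->
  (forall mu : Pc R d, PP K mu ->
    C0_differentiable T K TT (fun s z => Phi s z.1 mu z.2) tau) /\
  exists Psi : Pc R d -> R -> 'rV[R]_d -> 'rV[R]_d,
    (forall mu : Pc R d, PP K mu ->
      linearised_solution T v Dmuv K Phi tau mu (Psi mu) /\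
      forall psi, linearised_solution T v Dmuv K Phi tau mu psi ->
        forall t x, t \in `[0, T] -> K x -> psi t x = Psi mu t x) /\
    let o (h : R) (mu : Pc R d) (t : R) (x : 'rV[R]_d) : 'rV[R]_d :=
      Phi (tau + h) t mu x - (Phi tau t mu x + h *: Psi mu t x) in
    let small_h := within [set h : R | tau + h \in `[0, T]] (0 : R)^' in
    (forall t : R, t \in `[0, T] ->
      ((`|h|^-1)%:E *
         supnorm (PP K `*` K) (fun z => o h z.1 t z.2))%E
      @[h --> small_h] --> (0 : \bar R)) /\
    ((`|h|^-1)%:E *
       supnorm (PP K `*` [set` `[0%R, T]] `*` K)
         (fun z => o h z.1.1 z.1.2 z.2))%E
    @[h --> small_h] --> (0 : \bar R).
Proof.
move=> K TT tau [tauS [tauI tau_m]].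
have [rho r_rho rhoB] := flow_bounded hT hr hCE hPhi.
have rho0 : 0 < rho by exact: lt_le_trans r_rho.
have [gm mgm gm0] := L1_nonneg_rep (CE_m hCE).
have [k [ik k0 regular]] := CE_regular rho0 hCE.
have tau0 : tau \in `[0, T] by apply: subset_itv_oo_cc tauI.
have [tau_gt0 tauT] : 0 < tau /\ tau < T by move: tauI; rewrite in_itv /= => /andP.
have [tau_v _ _] : [/\ C0_lebesgue_point dist2 (PP (cball rho) `*` cball rho) (fun t z => v t z.1 z.2) tau,
    C0_lebesgue_point dist2 (PP (cball rho) `*` cball rho) (fun t z => Dx v t z.1 z.2) tau &
    C0_lebesgue_point dist3 (PP (cball rho) `*` cball rho `*` cball rho)
      (fun t z => Dmuv t z.1.1 z.1.2 z.2) tau].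
  have [_ _ h] := hTstar; apply: h => //; first exact: cball_compact.
  by exists 0; apply: cball0; exact: ltW.
have [C C0 [eta eta0 C_lip]] := flow_lipschitz hT hr hCE hPhi r_rho rhoB mgm gm0 ik k0 regular tau0 tau_m.
have expansion := flow_expansion hT hr hCE hPhi r_rho rhoB mgm gm0 ik k0 regular tau0 tau_m C0 eta0 C_lip tau_v tauT.
have solution := psi_solution hT hr hCE hPhi r_rho rhoB mgm gm0 ik k0 regular tau0 tau_m C0 eta0 C_lip tau_v tauT.
have unique := solution_unique hT hr hCE hPhi r_rho rhoB mgm gm0 ik k0 regular tau0 tau_m C0 eta0 C_lip tau_v tauT.
set Psi := psi T Phi tau eta in expansion solution unique.
have [mu0 mu0K] := Pc_exists d (ltW hr).
have K0 : K 0 by exact: cball0 (ltW hr).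
split.
  move=> mu muK; exists (fun z => Psi mu z.1 z.2); first by have [h _] := solution mu muK.
  apply: cvg_ereal0.
    near=> s; rewrite mule_ge0// ?lee_fin ?invr_ge0//.
    by apply: supnorm_ge0; exists (tau, 0).
  move=> e e0; have [delta d0 H] := expansion e e0.
  rewrite near_withinE; near=> s => -[_ [sI _]].
  have sne : s != tau by near: s; exact: nbhs_dnbhs_neq.
  have sd : `|s - tau| < delta.
    near: s; apply: nbhs_dnbhs; rewrite nbhs_ballP; exists delta => // s /=.
    by rewrite /ball /= distrC.
  have sp : 0 < `|s - tau| by rewrite normr_gt0 subr_eq0.
  rewrite lee_pdivrMl//; rewrite -EFinM mulrC.
  apply: supnorm_le => -[t x] [/= t0 Kx].
  have := H (s - tau) t mu x; rewrite (addrC tau) subrK => h.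
  rewrite -addrA -opprD; apply: h => //.
  by apply: subset_itv_oo_cc sI.
exists Psi; split.
  by move=> mu muK; split; [exact: solution|move=> w Sw t x t0 Kx; exact: unique].
have main (Z : Type) (A : set Z) (o : R -> Z -> 'rV[R]_d) : A !=set0 ->
    (forall e, 0 < e -> exists2 delta, 0 < delta & forall h z, tau + h \in `[0, T] ->
       `|h| < delta -> A z -> enorm (o h z) <= e * `|h|) ->
    ((`|h|^-1)%:E * supnorm A (o h))%E
      @[h --> within [set h : R | tau + h \in `[0, T]] (0 : R)^'] --> (0 : \bar R).
  move=> A0 H; apply: cvg_ereal0.
    near=> h; rewrite mule_ge0// ?lee_fin ?invr_ge0//.
    exact: supnorm_ge0.
  move=> e e0; have [delta d0 Hd] := H e e0.
  rewrite near_withinE; near=> h => hI.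
  have hne : h != 0 by near: h; exact: nbhs_dnbhs_neq.
  have hlt : `|h| < delta by near: h; exact: dnbhs0_lt.
  have hp : 0 < `|h| by rewrite normr_gt0.
  rewrite lee_pdivrMl//; rewrite -EFinM mulrC.
  by apply: supnorm_le => z Az; exact: Hd.
split.
  move=> t t0; apply: main; first by exists (mu0, 0).
  move=> e e0; have [delta d0 H] := expansion e e0; exists delta => // h [mu x] hI hlt [/= muK Kx].
  exact: H.
apply: main; first by exists (mu0, tau, 0).
move=> e e0; have [delta d0 H] := expansion e e0; exists delta => // h [[mu t] x] hI hlt [[/= muK t0] Kx].
exact: H.
Unshelve. all: by end_near. Qed.
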